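(* Let $X$ be a locally connected metric continuum contained in the plane $\mathbb{R}^2$. Then (1) $X$ has the fixed point property if and only if $X$ has the periodic point property; (2) the four properties $wLFPP$, $LFPP$, $wLPPP$ and $LPPP$ for $X$ are mutually equivalent, i.e. $X$ has one of them if and only if it has each of the others.
   Context: A metric continuum is a nonempty compact connected metrizable space; a continuum in the plane carries the subspace topology. A periodic point of a map $f:X\to X$ is a point $x\in X$ with $f^n(x)=x$ for some integer $n\ge 1$. A topological space $X$ has the fixed point property ($X\in FPP$) if each continuous map $f:X\to X$ has a fixed point; $X$ has the periodic point property ($X\in PPP$) if each continuous map $f:X\to X$ has a periodic point. $X$ has the local fixed point property ($X\in LFPP$) if $X$ has an open basis $\mathcal{B}$ such that $\overline{B}\in FPP$ for each $B\in\mathcal{B}$. $X$ has the weak local fixed point property ($X\in wLFPP$) if $X$ has an open basis $\mathcal{B}$ such that, for each $B\in\mathcal{B}$ and each continuous map $f:X\to X$, whenever $f(\overline{B})\subset B$, then $f$ has a fixed point in $B$. $X$ has the local periodic point property ($X\in LPPP$) if $X$ has an open basis $\mathcal{B}$ such that $\overline{B}\in PPP$ for each $B\in\mathcal{B}$. $X$ has the weak local periodic point property ($X\in wLPPP$) if $X$ has an open basis $\mathcal{B}$ such that, for each $B\in\mathcal{B}$ and each continuous map $f:X\to X$, whenever $f(\overline{B})\subset B$, then $f$ has a periodic point in $B$. Here $\overline{B}$ is the closure of $B$ in $X$ (with the subspace topology), and bases are understood to consist of nonempty open sets. *)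

(* Defs.v *)
From HB Require Import structures.
From mathcomp Require Import all_boot all_order all_algebra.
From mathcomp Require Import all_classical all_reals all_analysis.

Set Implicit Arguments.
Unset Strict Implicit.
Unset Printing Implicit Defensive.

Import Order.TTheory GRing.Theory Num.Theory.
Import numFieldNormedType.Exports.

Local Open Scope classical_set_scope.
Local Open Scope ring_scope.

(* A subset [A : set T] regarded as a space in its own right is the sigma-type
   [set_type A], which carries the topology induced by its inclusion into [T];
   all properties below are therefore stated for topological spaces. *)

Definition metrizable (R : realType) (T : topologicalType) : Prop :=
  exists d : T -> T -> R,
    [/\ forall x y, 0 <= d x y,
        forall x y, d x y = 0 <-> x = y,
        forall x y, d x y = d y x,
        forall x y z, d x z <= d x y + d y z &
        forall U : set T, open U <->
          (forall x, U x -> exists2 e : R, 0 < e & [set y | d x y < e] `<=` U)].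

Definition metric_continuum (R : realType) (T : topologicalType) : Prop :=
  [/\ [set: T] !=set0, compact [set: T], connected [set: T] & metrizable R T].

Definition locally_connected (T : topologicalType) : Prop :=
  exists2 B : set (set T), basis B & forall U, B U -> connected U.

(* The library's [basis] does not exclude the empty set. *)
Definition nonempty_basis (T : topologicalType) (B : set (set T)) : Prop :=
  basis B /\ forall U, B U -> U !=set0.

Definition periodic_point (T : Type) (f : T -> T) (x : T) : Prop :=
  exists2 n : nat, (1 <= n)%N & iter n f x = x.

Definition FPP (T : topologicalType) : Prop :=
  forall f : T -> T, continuous f -> exists x, f x = x.

Definition PPP (T : topologicalType) : Prop :=
  forall f : T -> T, continuous f -> exists x, periodic_point f x.

Definition LFPP (T : topologicalType) : Prop :=
  exists2 B : set (set T), nonempty_basis B &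
    forall U, B U -> FPP (set_type (closure U)).

Definition wLFPP (T : topologicalType) : Prop :=
  exists2 B : set (set T), nonempty_basis B &
    forall U (f : T -> T), B U -> continuous f -> f @` closure U `<=` U ->
      exists2 x, U x & f x = x.

Definition LPPP (T : topologicalType) : Prop :=
  exists2 B : set (set T), nonempty_basis B &
    forall U, B U -> PPP (set_type (closure U)).

Definition wLPPP (T : topologicalType) : Prop :=
  exists2 B : set (set T), nonempty_basis B &
    forall U (f : T -> T), B U -> continuous f -> f @` closure U `<=` U ->
      exists2 x, U x & periodic_point f x.

(* Main.v *)
Require Import Defs.
From HB Require Import structures.
From mathcomp Require Import all_boot all_order all_algebra.
From mathcomp Require Import all_classical all_reals all_analysis.
From mathcomp Require Import ring lra zify.

Set Implicit Arguments.
Unset Strict Implicit.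
Unset Printing Implicit Defensive.

Import Order.TTheory GRing.Theory Num.Theory.
Import numFieldNormedType.Exports.

Local Open Scope classical_set_scope.
Local Open Scope ring_scope.

(** Everything rests on one dichotomy.  Let [K] be a nonempty compact connected
    plane set which is uniformly locally connected ([ulc]).  For a point [p] off
    [K] ask whether [x - p] has a continuous angle for [x] in [K].

    If the angle exists for every [p] off [K] ([nonseparating]), every
    continuous self-map [f] of [K] has a fixed point ([plane_fixed_point]).
    Suppose that [f] moves every point, and lay a fine square grid over [K].
    Attach to each vertex [v] near [K] a nearby point [a] of [K], and compare,
    along the edges, the direction in which [v] sees a chosen point [p0] of [K]
    with the direction [f a - a].  Around the square centred at [p0] the first
    direction turns by [2 * pi], around any other square by [0]; the second one
    varies little on a square that meets [K], so it turns by [0] around it.  On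
    an edge that misses [K] the two turns differ by a coboundary
    ([edge_identity]): [p0] and [f a] both lie in [K], hence are seen from the
    two ends of the edge under angles that change in the same way, and [v] sees
    [f a] nearly in the direction in which [a] sees it.  The other edges cancel
    in the sum over all squares ([sum_circulation]), and so [2 * pi = 0].

    If the angle fails to exist for some [p], there is a continuous map from the
    plane without [p] to [K] which has no periodic point ([free_map],
    [free_self_map]).  Indeed some closed chain of small steps in [K] turns
    around [p], and local connectedness refines it to a loop ([essential_loop],
    [chain_path]).  The path formed by the points of the loop together with
    their angles contains an arc ([path_arc]); a shortest piece of this arc over
    which the point of [K] returns is a simple loop that still turns around [p]
    ([simple_essential_loop]).  A simple loop turns exactly once
    ([simple_loop_degree]), hence its parameter can be read off the angle up to
    a correction, which is continuous on the loop and extends to the plane.  The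
    map sends [x] to the point of the loop whose parameter is so read off at
    [x], shifted by an irrational number; on the loop it is an irrational
    rotation.

    Equivalence of the two global properties: if [X] has the periodic point
    property, the second alternative is impossible for [K := X], and the first
    one gives the fixed point property.

    Equivalence of the four local properties: all implications are formal except
    the one from the weak local periodic point property to the local fixed point
    property ([wLPPP_LFPP]).  A point of [X] has a small neighbourhood [W] with
    locally connected closure [K] ([small_continuum]).  Fill the holes of [K]
    ([fill]).  A point of a hole that lies off [X] would give a map of [X] into
    [K] without periodic points, against the weak property of a basic set
    around [K]; so the filled set is contained in [X].  It does not separate the
    plane and is still locally connected ([fill_nonseparating], [fill_cik]),
    hence it has the fixed point property, and it is the closure of the open set
    made of [W] and the holes. *)

(** * Angles of plane vectors *)

Section Angles.
Variable R : realType.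
Implicit Types (z w u : R * R) (a b t : R).

Definition dot z w : R := z.1 * w.1 + z.2 * w.2.

(** Plane vectors read as complex numbers: [quot z w] is [z] times the conjugate
    of [w], which has the angle of [z / w] and needs no division. *)
Definition quot z w : R * R := (z.1 * w.1 + z.2 * w.2, z.2 * w.1 - z.1 * w.2).

Definition is_angle z t := exists2 r : R, 0 < r & z = (r * cos t, r * sin t).

Definition norm2 z : R := Num.sqrt (z.1 ^+ 2 + z.2 ^+ 2).

(** The complement of the closed negative half of the real axis, where the
    principal angle is continuous. *)
Definition off_ray z := (z.2 != 0) || (0 < z.1).

(** The principal angle, by the half-angle formula. *)
Definition arg z : R := 2 * atan (z.2 / (z.1 + norm2 z)).

Lemma is_angle_neq0 z t : is_angle z t -> z != 0.
Proof.
case=> r r0 ->; apply/eqP => -[/eqP + /eqP].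
rewrite !mulf_eq0 !(gt_eqF r0) /= => /eqP c0 /eqP s0.
by have /eqP := cos2Dsin2 t; rewrite c0 s0 !expr0n /= addr0 eq_sym oner_eq0.
Qed.

Lemma is_angle_quot z w a b :
  is_angle z a -> is_angle w b -> is_angle (quot z w) (a - b).
Proof.
case=> r r0 -> [s s0 ->]; exists (r * s); first exact: mulr_gt0.
by rewrite /quot /= cosB sinB; congr (_, _); ring.
Qed.

Lemma is_angle_quotK z w b c :
  is_angle (quot z w) c -> is_angle w b -> is_angle z (b + c).
Proof.
case=> r r0 [h1 h2] [s s0 hw]; exists (r / s); first exact: divr_gt0.
move: h1 h2; rewrite hw /= => h1 h2.
have cs := cos2Dsin2 b.
case: z h1 h2 => z1 z2 /= h1 h2; rewrite cosD sinD; congr (_, _).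
  transitivity (((z1 * (s * cos b) + z2 * (s * sin b)) * cos b -
    (z2 * (s * cos b) - z1 * (s * sin b)) * sin b) / s).
    have -> : (z1 * (s * cos b) + z2 * (s * sin b)) * cos b -
      (z2 * (s * cos b) - z1 * (s * sin b)) * sin b =
      z1 * s * (cos b ^+ 2 + sin b ^+ 2) by ring.
    by rewrite cs mulr1 mulfK// gt_eqF.
  by rewrite h1 h2; ring.
transitivity (((z1 * (s * cos b) + z2 * (s * sin b)) * sin b +
  (z2 * (s * cos b) - z1 * (s * sin b)) * cos b) / s).
  have -> : (z1 * (s * cos b) + z2 * (s * sin b)) * sin b +
    (z2 * (s * cos b) - z1 * (s * sin b)) * cos b =
    z2 * s * (cos b ^+ 2 + sin b ^+ 2) by ring.
  by rewrite cs mulr1 mulfK// gt_eqF.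
by rewrite h1 h2; ring.
Qed.

Lemma is_angle_scale z t k : 0 < k -> is_angle (k * z.1, k * z.2) t <-> is_angle z t.
Proof.
move=> k0; split=> -[r r0 e].
  exists (r / k); first exact: divr_gt0.
  case: e; case: z => z1 z2 /= e1 e2; congr (_, _).
    by rewrite mulrAC -e1 [k * _]mulrC mulfK// gt_eqF.
  by rewrite mulrAC -e2 [k * _]mulrC mulfK// gt_eqF.
by exists (k * r); [exact: mulr_gt0|rewrite e /= !mulrA].
Qed.

(** Reduce [t] modulo [2 * pi], and use the injectivity of the cosine on each half
    of a period. *)
Lemma cos_eq1_int t : cos t = 1 -> exists k : int, t = 2 * pi * k%:~R.
Proof.
move=> ct; have p0 : 0 < 2 * pi :> R by rewrite mulr_gt0// pi_gt0.
have per : forall (k : int) (x : R), cos (x + 2 * pi * k%:~R) = cos x.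
  have pn (n : nat) (x : R) : cos (x + 2 * pi * n%:R) = cos x.
    have -> : x + 2 * pi * n%:R = x + (pi *+ 2) *+ n.
      by rewrite -[pi *+ 2]mulr_natl -[X in _ = x + X]mulr_natr.
    exact: (periodicn (@cosD2pi R)).
  case=> n x; first by rewrite -pmulrn pn.
  by rewrite -(pn n.+1) NegzE mulrNz mulrN subrK.
set k := Num.floor (t / (2 * pi)); exists k.
set x := t - 2 * pi * k%:~R.
have x0 : 0 <= x by rewrite subr_ge0 mulrC -ler_pdivlMr// floor_le.
have x2 : x < 2 * pi.
  have := floorD1_gt (t / (2 * pi)).
  by rewrite -/k intrD ltr_pdivrMr// /x; lra.
have cx : cos x = 1 by rewrite -(per k x) /x subrK.
suff x_eq0 : x = 0 by apply/eqP; rewrite -subr_eq0 -/x x_eq0.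
have [xp|xp] := leP x pi.
  apply: (@cos_inj R) => //; rewrite ?in_itv/= ?x0 ?xp ?lexx ?pi_ge0//.
  by rewrite cx cos0.
have : 2 * pi - x = 0.
  apply: (@cos_inj R) => //; rewrite ?in_itv/= ?lexx ?pi_ge0//.
    by apply/andP; split; lra.
  by have := per 1 (- x); rewrite cosN cx mulr1 addrC cos0.
by move=> h; move: x2; rewrite -subr_gt0 h ltxx.
Qed.

Lemma is_angle_uniq z a b : is_angle z a -> is_angle z b ->
  exists k : int, a - b = 2 * pi * k%:~R.
Proof.
move=> za zb; apply: cos_eq1_int.
have [r r0 [e1 e2]] := is_angle_quot za zb.
have s0 : sin (a - b) = 0.
  move/eqP : e2; rewrite mulrC subrr eq_sym mulf_eq0 gt_eqF //= => /eqP //.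
have := cos2Dsin2 (a - b); rewrite s0 expr0n addr0 => /eqP.
rewrite sqrf_eq1 => /orP[/eqP//|/eqP c1].
have : 0 <= z.1 * z.1 + z.2 * z.2 by rewrite addr_ge0// -expr2 sqr_ge0.
by rewrite e1 c1 mulrN1 oppr_ge0 leNgt r0.
Qed.

Lemma norm2_sqr z : norm2 z ^+ 2 = z.1 ^+ 2 + z.2 ^+ 2.
Proof. by rewrite sqr_sqrtr// addr_ge0// sqr_ge0. Qed.

Lemma norm2_ge0 z : 0 <= norm2 z. Proof. exact: sqrtr_ge0. Qed.

Lemma off_ray_gt0 z : off_ray z -> 0 < z.1 + norm2 z.
Proof.
move=> h; have := norm2_sqr z; have := norm2_ge0 z; move: (norm2 z) => n n0 e.
case/orP : h => h; last by lra.
have : 0 < z.2 ^+ 2 by rewrite exprn_even_gt0.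
by move: h => _ h; nra.
Qed.

Lemma arg_is_angle z : off_ray z -> is_angle z (arg z).
Proof.
move=> h; have n0 := off_ray_gt0 h.
rewrite /arg; set q := z.2 / _; set t := atan q.
have e := norm2_sqr z; have nn := norm2_ge0 z.
have np : 0 < norm2 z.
  rewrite lt_neqAle nn andbT eq_sym; apply/eqP => e0.
  by move: n0; rewrite e0 addr0 => z1; move: e; rewrite e0 expr0n /= => /eqP;
    rewrite eq_sym paddr_eq0 ?sqr_ge0// sqrf_eq0 (gt_eqF z1).
exists (norm2 z) => //.
have ct : cos t ^+ 2 = (1 + q ^+ 2)^-1.
  by rewrite cos_atan exprVn sqr_sqrtr// addr_ge0// sqr_ge0.
have cp : cos t != 0.
  rewrite -sqrf_eq0 ct invr_eq0 gt_eqF// ltr_wpDr ?sqr_ge0//.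
have st : sin t = q * cos t.
  by have := atanK q; rewrite -/t /tan => <-; rewrite mulfVK.
have q2 : 1 + q ^+ 2 = 2 * norm2 z / (z.1 + norm2 z).
  rewrite /q expr_div_n (_ : z.2 ^+ 2 = norm2 z ^+ 2 - z.1 ^+ 2); last first.
    by rewrite e; ring.
  by field; rewrite gt_eqF.
have ct' : cos t ^+ 2 = (z.1 + norm2 z) / (2 * norm2 z) by rewrite ct q2 invf_div.
rewrite (_ : 2 * t = t + t); last by rewrite mulr_natl mulr2n.
rewrite cosD sinD st.
have -> : cos t * cos t - q * cos t * (q * cos t) = cos t ^+ 2 * (1 - q ^+ 2).
  by ring.
have -> : q * cos t * cos t + cos t * (q * cos t) = cos t ^+ 2 * (2 * q) by ring.
have -> : 1 - q ^+ 2 = 2 - 2 * norm2 z / (z.1 + norm2 z) by rewrite -q2; ring.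
have n0' : z.1 + norm2 z != 0 by rewrite gt_eqF.
have np' : norm2 z != 0 by rewrite gt_eqF.
rewrite ct' /q [LHS]surjective_pairing; congr (_, _); field;
  by rewrite ?n0' ?np'.
Qed.

Lemma arg_lt_pi z : `|arg z| < pi.
Proof.
rewrite /arg; set q := _ / _.
have := atan_gtNpi2 q; have := atan_ltpi2 q.
by rewrite ltr_norml; move=> ? ?; apply/andP; split; lra.
Qed.

Lemma arg_uniq z t : off_ray z -> is_angle z t -> `|t| < pi -> t = arg z.
Proof.
move=> h zt tp; have [k e] := is_angle_uniq zt (arg_is_angle h).
have ap := arg_lt_pi z.
have p0 : 0 < pi :> R := pi_gt0 R.
have : `|t - arg z| < 2 * pi.
  by rewrite (le_lt_trans (ler_normB _ _))// mulr_natl mulr2n ltrD.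
rewrite e normrM gtr0_norm ?mulr_gt0// -[ltRHS]mulr1 ltr_pM2l ?mulr_gt0//.
rewrite -intr_norm -[ltRHS]/(1%:~R) ltr_int.
move=> k1; have k0 : k = 0 by case: k k1 {e} => [[|n]|n].
by move: e; rewrite k0 mulr0 => /eqP; rewrite subr_eq0 => /eqP.
Qed.

Lemma gt0_off_ray z : 0 < z.1 -> off_ray z.
Proof. by move=> h; rewrite /off_ray h orbT. Qed.

Lemma arg_lt_pihalf z : 0 < z.1 -> `|arg z| < pi / 2.
Proof.
move=> h; have [r r0 e] := arg_is_angle (gt0_off_ray h).
have c0 : 0 < cos (arg z) by move: h; rewrite (congr1 fst e) /= pmulr_rgt0.
have := arg_lt_pi z; rewrite ltr_norml => /andP[a1 a2].
rewrite ltNge; apply/negP => a3.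
have : cos (arg z) <= 0.
  rewrite -cos_norm -[`|_|](subrK (pi / 2)) cosDpihalf oppr_le0.
  apply: sin_ge0_pi; rewrite subr_ge0 a3 /=.
  have : `|arg z| < pi by exact: arg_lt_pi.
  by have := pi_gt0 R; lra.
by rewrite leNgt c0.
Qed.

Lemma is_angle_ex z : z != 0 -> exists t, is_angle z t.
Proof.
move=> z0; have [h|] := boolP (off_ray z); first by exists (arg z); exact: arg_is_angle.
rewrite /off_ray negb_or negbK -leNgt => /andP[/eqP z2 z1].
exists pi; exists (- z.1).
  rewrite oppr_gt0 lt_neqAle z1 andbT; apply: contra_neq z0 => z1'.
  by case: z z1' z2 {z1} => /= ? ? -> ->.
rewrite cospi sinpi mulr0 mulrN1 opprK; case: z z2 {z0 z1} => /= ? ? -> //.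
Qed.

Lemma continuous_norm2 : continuous norm2.
Proof.
move=> z.
apply: (@continuous_comp _ _ _ (fun z : R * R => z.1 ^+ 2 + z.2 ^+ 2) Num.sqrt);
  last exact: sqrt_continuous.
apply: cvgD; apply: (@continuous_comp _ _ _ _ (fun x : R => x ^+ 2));
  by [exact: cvg_fst|exact: cvg_snd|exact: exprn_continuous].
Qed.

Lemma continuous_arg z : off_ray z -> {for z, continuous arg}.
Proof.
move=> h; rewrite /arg; apply: cvgM; first exact: cvg_cst.
apply: (@continuous_comp _ _ _ (fun z : R * R => z.2 / (z.1 + norm2 z)) atan); last exact: continuous_atan.
apply: cvgM; first exact: cvg_snd.
apply: cvgV; first by rewrite gt_eqF// off_ray_gt0.
apply: cvgD; [exact: cvg_fst|exact: continuous_norm2].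
Qed.

(** The principal angle is additive only up to multiples of [2 * pi]; no multiple
    occurs between vectors of one open half-plane, because relative to its axis
    [u] their angles stay below [pi / 2]. *)
Lemma arg_quot_half u z w : 0 < dot z u -> 0 < dot w u ->
  arg (quot z w) = arg (quot z u) - arg (quot w u).
Proof.
move=> hz hw; symmetry.
have az := arg_is_angle (gt0_off_ray (hz : 0 < (quot z u).1)).
have aw := arg_is_angle (gt0_off_ray (hw : 0 < (quot w u).1)).
have bz := arg_lt_pihalf (hz : 0 < (quot z u).1).
have bw := arg_lt_pihalf (hw : 0 < (quot w u).1).
have a : is_angle (quot z w) (arg (quot z u) - arg (quot w u)).
  have := is_angle_quot az aw.
  have -> : quot (quot z u) (quot w u) =
    (dot u u * (quot z w).1, dot u u * (quot z w).2).
    by rewrite /quot /dot /=; congr (_, _); ring.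
  move/is_angle_scale; apply; rewrite /dot -!expr2 lt_neqAle addr_ge0 ?sqr_ge0// andbT.
  rewrite eq_sym paddr_eq0 ?sqr_ge0// !sqrf_eq0; apply/negP => /andP[/eqP u1 /eqP u2].
  by move: hz; rewrite /dot u1 u2 !mulr0 addr0 ltxx.
have b : `|arg (quot z u) - arg (quot w u)| < pi.
  by rewrite (le_lt_trans (ler_normB _ _))//; lra.
apply: arg_uniq => //.
case: a => r r0 ->; rewrite /off_ray /=; move: b; set t := (_ - _) => b.
have [/eqP|//] := eqVneq (r * sin t) 0; rewrite mulf_eq0 gt_eqF//= => /eqP s0.
rewrite mulr_gt0//; have [t0|t0] := eqVneq t 0; first by rewrite t0 cos0.
have : sin `|t| = 0.
  by case: (ger0P t) => _ //; rewrite sinN s0 oppr0.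
by move=> e; have := @sin_gt0_pi _ `|t|; rewrite normr_gt0 t0 b e ltxx => /(_ isT).
Qed.

Lemma is_angle_quotC z w c : is_angle (quot z w) c -> is_angle (quot w z) (- c).
Proof.
case=> r r0 [e1 e2]; exists r => //; rewrite cosN sinN mulrN -e1 -e2 /quot.
by congr (_, _); ring.
Qed.

Lemma dotC z w : dot z w = dot w z.
Proof. by rewrite /dot mulrC [X in _ + X]mulrC. Qed.

Lemma off_ray_quot z w : 0 < dot z w -> off_ray (quot z w).
Proof. by move=> h; apply: gt0_off_ray. Qed.

Lemma dot_self z w : 0 < dot z w -> 0 < dot w w.
Proof.
move=> h; rewrite /dot -!expr2 lt_neqAle addr_ge0 ?sqr_ge0// andbT eq_sym.
rewrite paddr_eq0 ?sqr_ge0// !sqrf_eq0; apply/negP => /andP[/eqP w1 /eqP w2].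
by move: h; rewrite /dot w1 w2 !mulr0 addr0 ltxx.
Qed.

Lemma arg_quot_self z w : 0 < dot z w -> arg (quot w w) = 0.
Proof. by move=> /dot_self h; have := arg_quot_half h h; rewrite subrr. Qed.

Lemma arg_quot_sym z w : 0 < dot z w -> arg (quot w z) = - arg (quot z w).
Proof.
by move=> h; rewrite (arg_quot_half (dot_self h) h) (arg_quot_self h) sub0r.
Qed.

Lemma arg_imag (y : R) : 0 < y -> arg (0, y) = pi / 2.
Proof.
move=> y0; rewrite /arg /norm2 /= expr0n /= add0r add0r sqrtr_sqr gtr0_norm//.
by rewrite divff ?gt_eqF// atan1; field.
Qed.

Lemma arg_imagN (y : R) : 0 < y -> arg (0, - y) = - (pi / 2).
Proof.
move=> y0; rewrite /arg /norm2 /= expr0n /= add0r add0r sqrtr_sqr normrN gtr0_norm//.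
by rewrite mulNr divff ?gt_eqF// atanN atan1; field.
Qed.

Lemma is_angle_opp z t : is_angle (- z) t -> is_angle z (t + pi).
Proof.
case=> r r0 e; exists r => //; rewrite cosDpi sinDpi !mulrN.
by rewrite -[z]opprK e.
Qed.

Lemma is_angle_period z t (k : int) :
  is_angle z t -> is_angle z (t + 2 * pi * k%:~R).
Proof.
have pn (n : nat) : cos (2 * pi * n%:R) = 1 :> R /\ sin (2 * pi * n%:R) = 0 :> R.
  have -> : 2 * pi * n%:R = 0 + (pi *+ 2) *+ n :> R.
    by rewrite add0r -[pi *+ 2]mulr_natl -[RHS]mulr_natr.
  by rewrite (periodicn (@cosD2pi R)) (periodicn (@sinD2pi R)) cos0 sin0.
have [ck sk] : cos (2 * pi * k%:~R) = 1 :> R /\ sin (2 * pi * k%:~R) = 0 :> R.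
  case: k => n; first exact: pn.
  by rewrite NegzE mulrNz mulrN cosN sinN; have [-> ->] := pn n.+1; rewrite oppr0.
by case=> r r0 ->; exists r => //; rewrite cosD sinD ck sk !mulr0 !mulr1 subr0 addr0.
Qed.

Lemma norm2_polar (r t : R) : 0 < r -> norm2 (r * cos t, r * sin t) = r.
Proof.
move=> r0; rewrite /norm2 /= !exprMn -mulrDr cos2Dsin2 mulr1 sqrtr_sqr.
by rewrite gtr0_norm.
Qed.

Lemma eq_polar z w t : is_angle z t -> is_angle w t -> norm2 z = norm2 w -> z = w.
Proof. by move=> [r r0 ->] [s s0 ->]; rewrite !norm2_polar// => ->. Qed.

Lemma dot_near z w : `|z - w| < `|z| / 2 -> 0 < dot z w.
Proof.
case: z w => z1 z2 [w1 w2]; rewrite !prod_normE /= /dot /=.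
move=> h.
have {h} [h1 h2] : `|z1 - w1| < Num.max `|z1| `|z2| / 2 /\
  `|z2 - w2| < Num.max `|z1| `|z2| / 2.
  by move: h; rewrite gt_max => /andP[].
wlog zz : z1 z2 w1 w2 h1 h2 / `|z2| <= `|z1|.
  move=> H; have [/H|/ltW /H] := leP `|z2| `|z1|; first exact.
  by rewrite addrC; apply => //; rewrite maxC.
rewrite (max_l zz) in h1 h2.
rewrite -[z1 * w1](_ : z1 * z1 - z1 * (z1 - w1) = _); last by ring.
rewrite -[z2 * w2](_ : z2 * z2 - z2 * (z2 - w2) = _); last by ring.
have a1 : z1 * (z1 - w1) <= `|z1| * `|z1 - w1| by rewrite -normrM ler_norm.
have a2 : z2 * (z2 - w2) <= `|z2| * `|z2 - w2| by rewrite -normrM ler_norm.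
have b1 : z1 * z1 = `|z1| * `|z1| by rewrite -expr2 -[RHS]expr2 real_normK// num_real.
have b2 : z2 * z2 = `|z2| * `|z2| by rewrite -expr2 -[RHS]expr2 real_normK// num_real.
rewrite b1 b2.
have := normr_ge0 z2; have := normr_ge0 (z2 - w2); have := normr_ge0 (z1 - w1).
move: h1 h2 zz a1 a2.
set c1 := z1 * (_ - _); set c2 := z2 * (_ - _).
move: `|z1| `|z2| `|z1 - w1| `|z2 - w2| c1 c2 => x y p q c1 c2.
move=> h1 h2 zz a1 a2 p0 q0 y0.
have x0 : 0 < x by lra.
have : x * p < x * (x / 2) by rewrite ltr_pM2l.
have : y * q <= x * q by exact: ler_wpM2r.
have : x * q < x * (x / 2) by rewrite ltr_pM2l.
have : 0 <= y * y by exact: mulr_ge0.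
by move=> ? ? ? ?; lra.
Qed.

End Angles.

(** * Continuity on subsets and continuous angles *)

Section Continuity.
Variable R : realType.

Lemma within_continuousP (V W : normedModType R) (A : set V) (f : V -> W) :
  {within A, continuous f} <->
  forall x, A x -> forall e, 0 < e -> exists2 d, 0 < d &
    forall y, A y -> `|x - y| < d -> `|f x - f y| < e.
Proof.
split=> [/subspace_continuousP cf x Ax e e0|h].
  have /cvgrPdist_lt /(_ e e0) := cf x Ax.
  rewrite near_withinE => /nbhs_normP[d /= d0 hd]; exists d => // y Ay xy.
  exact: hd.
apply/subspace_continuousP => x Ax; apply/cvgrPdist_lt => e e0.
have [d d0 hd] := h x Ax e e0.
by rewrite near_withinE; apply/nbhs_normP; exists d => //= y xy Ay; exact: hd.
Qed.

Lemma within_comp (T U W : topologicalType) (A : set T) (B : set U)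
    (f : T -> U) (g : U -> W) :
  {within A, continuous f} -> {within B, continuous g} ->
  (forall x, A x -> B (f x)) -> {within A, continuous (g \o f)}.
Proof.
move=> /subspace_continuousP cf /subspace_continuousP cg AB.
apply/subspace_continuousP => x Ax.
move=> P nP.
have h1 : nbhs (f x) (fun u => B u -> P (g u)) by exact: (cg (f x) (AB x Ax) P nP).
have h2 : nbhs x (fun y => A y -> B (f y) -> P (g (f y))) by exact: (cf x Ax _ h1).
by apply: filterS h2 => y yP Ay; exact: yP Ay (AB _ Ay).
Qed.

Lemma continuous_within (T U : topologicalType) (A : set T) (f : T -> U) :
  (forall x, A x -> {for x, continuous f}) -> {within A, continuous f}.
Proof. by move=> cf; apply: continuous_in_subspaceT => x /set_mem /cf. Qed.

Lemma within_ext (T U : topologicalType) (A : set T) (f g : T -> U) :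
  (forall x, A x -> f x = g x) -> {within A, continuous f} ->
  {within A, continuous g}.
Proof.
by move=> fg; apply: subspace_eq_continuous => x /set_mem; exact: fg.
Qed.

(** Heine-Cantor, for maps continuous on a compact subset only. *)
Lemma uniform_within (V W : normedModType R) (A : set V) (f : V -> W) :
  compact A -> {within A, continuous f} -> forall e, 0 < e ->
  exists2 d, 0 < d & forall x y, A x -> A y -> `|x - y| < d -> `|f x - f y| < e.
Proof.
move=> cA /within_continuousP cf e e0.
have e2 : 0 < e / 2 by rewrite divr_gt0.
move: cA; rewrite compact_near_coveringP => cA.
have /= [] := cA R 0^'+ (fun d x => forall y, A x -> A y -> `|x - y| < d -> `|f x - f y| < e).
  move=> x Ax; have [d d0 hd] := cf x Ax _ e2.
  near=> x' r => /= y Ax' Ay /= xy.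
  rewrite -(subrKA (f x)) (splitr e) (le_lt_trans (ler_normD _ _))//.
  have xx' : `|x - x'| < d / 2.
    by near: x'; apply/nbhs_normP; exists (d / 2) => //=; rewrite divr_gt0.
  rewrite ltrD//; last first.
    apply: hd => //; rewrite -(subrKA x') (le_lt_trans (ler_normD _ _))//.
    rewrite (splitr d) ltrD// (lt_trans xy)//.
    by near: r; apply: nbhs_right_lt; rewrite divr_gt0.
  by rewrite distrC; apply: hd => //; lra.
move=> d /= d0 hd; exists (d / 2) => [|x y Ax Ay xy]; first by rewrite divr_gt0.
apply: (hd (d / 2)) => //=; rewrite ?divr_gt0//.
by rewrite sub0r normrN gtr0_norm ?divr_gt0//; lra.
Unshelve. all: by end_near.
Qed.

Lemma within_away0 (V W : normedModType R) (A : set V) (f : V -> W) :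
  compact A -> {within A, continuous f} -> (forall x, A x -> f x != 0) ->
  exists2 m, 0 < m & forall x, A x -> m <= `|f x|.
Proof.
move=> cA cf f0; have [->|/set0P A0] := eqVneq A set0.
  by exists 1.
have cn : {within A, continuous (fun x => `|f x|)}.
  by move=> x; apply: cvg_norm; exact: cf.
have [c /set_mem Ac hc] := compact_EVT_min A0 cA cn.
exists `|f c|; first by rewrite normr_gt0 f0.
by move=> x Ax; apply: hc; exact/mem_set.
Qed.

Lemma near_dist (x : R * R) (d : R) : 0 < d -> \forall y \near x, `|x - y| < d.
Proof. by move=> d0; apply/(@nbhs_normP R (R * R)%type); exists d. Qed.

Lemma near_distP (x : R * R) (P : set (R * R)) :
  (\forall y \near x, P y) -> exists2 d : R, 0 < d & forall y, `|x - y| < d -> P y.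
Proof. by move=> /(@nbhs_normP R (R * R)%type)[d d0 h]; exists d => // y; exact: h. Qed.

Definition itv01 : set R := [set t | 0 <= t <= 1].

Lemma itv_compact (n : R) : compact [set t : R | 0 <= t <= n].
Proof.
have -> : [set t : R | 0 <= t <= n] = `[0, n]%classic.
  by apply/seteqP; split=> t /=; rewrite in_itv.
exact: segment_compact.
Qed.

Lemma itv_connected (n : R) : connected [set t : R | 0 <= t <= n].
Proof.
apply/connected_intervalP => a b /= /andP[? ?] /andP[? ?] z /andP[? ?].
by apply/andP; split; lra.
Qed.

Section Pairs.
Variables (T : topologicalType) (A : set T).

Lemma within_pair (U W : topologicalType) (f : T -> U) (g : T -> W) :
  {within A, continuous f} -> {within A, continuous g} ->
  {within A, continuous (fun x => (f x, g x))}.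
Proof. by move=> cf cg x; apply: cvg_pair; [exact: cf|exact: cg]. Qed.

Lemma within_fst (U W : topologicalType) (f : T -> U * W) :
  {within A, continuous f} -> {within A, continuous (fun x => (f x).1)}.
Proof. by move=> cf x; apply: (cvg_comp _ _ (cf x)); exact: cvg_fst. Qed.

Lemma within_snd (U W : topologicalType) (f : T -> U * W) :
  {within A, continuous f} -> {within A, continuous (fun x => (f x).2)}.
Proof. by move=> cf x; apply: (cvg_comp _ _ (cf x)); exact: cvg_snd. Qed.

Lemma withinD (V : normedModType R) (f g : T -> V) :
  {within A, continuous f} -> {within A, continuous g} ->
  {within A, continuous (fun x => f x + g x)}.
Proof. by move=> cf cg x; apply: cvgD; [exact: cf|exact: cg]. Qed.

Lemma withinB (V : normedModType R) (f g : T -> V) :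
  {within A, continuous f} -> {within A, continuous g} ->
  {within A, continuous (fun x => f x - g x)}.
Proof. by move=> cf cg x; apply: cvgB; [exact: cf|exact: cg]. Qed.

Lemma withinM (f g : T -> R) :
  {within A, continuous f} -> {within A, continuous g} ->
  {within A, continuous (fun x => f x * g x)}.
Proof. by move=> cf cg x; apply: cvgM; [exact: cf|exact: cg]. Qed.

Lemma within_cst (U : topologicalType) (c : U) : {within A, continuous (fun=> c)}.
Proof. by move=> x; exact: cvg_cst. Qed.

Lemma within_quot (f g : T -> R * R) :
  {within A, continuous f} -> {within A, continuous g} ->
  {within A, continuous (fun x => quot (f x) (g x))}.
Proof.
move=> cf cg; have [f1 f2] := (within_fst cf, within_snd cf).
have [g1 g2] := (within_fst cg, within_snd cg).
by apply: within_pair; [apply: withinD|apply: withinB]; exact: withinM.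
Qed.

Lemma within_arg (f : T -> R * R) :
  {within A, continuous f} -> (forall x, A x -> off_ray (f x)) ->
  {within A, continuous (fun x => arg (f x))}.
Proof.
move=> cf h; apply: (@within_comp _ _ _ A (@off_ray R) f (@arg R)) => //.
exact/continuous_within/continuous_arg.
Qed.

End Pairs.

Lemma within_id (T : topologicalType) (A : set T) : {within A, continuous id}.
Proof. by apply: continuous_within => x _; exact: cvg_id. Qed.

(** A continuous branch of the argument of [g] on [A]. *)
Definition angle_lift (T : topologicalType) (A : set T) (g : T -> R * R) (th : T -> R) :=
  {within A, continuous th} /\ forall x, A x -> is_angle (g x) (th x).

(** The difference of two branches takes its values in the multiples of [2 * pi],
    and its image is an interval. *)
Lemma lift_connected (T : topologicalType) (C : set T) (g : T -> R * R)
    (th1 th2 : T -> R) : connected C -> angle_lift C g th1 -> angle_lift C g th2 ->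
  forall x y, C x -> C y -> th1 x - th2 x = th1 y - th2 y.
Proof.
move=> cC [c1 l1] [c2 l2].
have cD : {within C, continuous (fun x => th1 x - th2 x)} by exact: withinB.
have /connected_intervalP iD := connected_continuous_connected cC cD.
have int x : C x -> exists k : int, th1 x - th2 x = 2 * pi * k%:~R.
  by move=> Cx; exact: is_angle_uniq (l1 x Cx) (l2 x Cx).
suff H x y : C x -> C y -> ~ (th1 x - th2 x < th1 y - th2 y).
  move=> x y Cx Cy; apply/eqP; rewrite eq_le !leNgt.
  by apply/andP; split; apply/negP; exact: H.
move=> Cx Cy; have [k ek] := int x Cx; have [l el] := int y Cy.
have p0 : 0 < pi :> R := pi_gt0 R.
have p2 : 0 < 2 * pi :> R by rewrite mulr_gt0.
rewrite ek el ltr_pM2l// ltr_int => kl.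
have [|||z Cz ez] := iD (2 * pi * k%:~R) (2 * pi * l%:~R) _ _ (2 * pi * k%:~R + pi).
- by exists x; [exact: Cx|exact: ek].
- by exists y; [exact: Cy|exact: el].
- rewrite lerDl (ltW p0)/=.
  have kl1 : (k%:~R + 1 : R) <= l%:~R by rewrite -(intrD _ k 1) ler_int lezD1.
  have : 2 * pi * (k%:~R + 1) <= 2 * pi * l%:~R :> R by rewrite ler_pM2l.
  by rewrite mulrDr mulr1; lra.
have [m em] := int z Cz; move: ez; rewrite em => ez.
have : (2 * (m - k))%:~R = 1%:~R :> R.
  by rewrite intrM intrB; apply: (mulfI (lt0r_neq0 p0)); lra.
move/(@intr_inj R); lia.
Qed.

End Continuity.

(** * Existence and transport of continuous angles *)

Section LiftTools.
Variable R : realType.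

(** Contract [A] along its radii.  By uniform continuity the values of [g] at the
    points [i / n.+1] and [i.+1 / n.+1] of a radius make a small principal angle,
    which depends continuously on the radius; add up these angles, starting from
    an angle of [g 0]. *)
Lemma star_lift (V : normedModType R) (A : set V) (g : V -> R * R) :
  compact A -> (forall x k, A x -> 0 <= k <= 1 -> A (k *: x)) ->
  {within A, continuous g} -> (forall x, A x -> g x != 0) ->
  exists th, angle_lift A g th.
Proof.
move=> cA sA cg g0; have [A0|/set0P[x0 Ax0]] := eqVneq A set0.
  by exists (fun=> 0); split; [exact: within_cst|rewrite A0].
have A0 : A 0 by rewrite -(scale0r x0); apply: sA; rewrite // lexx ler01.
have [m m0 hm] := within_away0 cA cg g0.
have [d d0 hd] := uniform_within cA cg (divr_gt0 m0 (ltr0n R 2)).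
have [B B0 hB] := ex_strict_bound_gt0 (compact_bounded cA).
have [n hn] : exists n : nat, B / n.+1%:R < d.
  exists (Num.truncn (B / d)); rewrite ltr_pdivrMr// mulrC -ltr_pdivrMr//.
  by have /andP[] := truncn_itv (ltW (divr_gt0 B0 d0)).
pose h i (x : V) := (i%:R / n.+1%:R : R) *: x.
have Ah i x : (i <= n.+1)%N -> A x -> A (h i x).
  move=> ni Ax; apply: sA => //; rewrite divr_ge0//=.
  by rewrite ler_pdivrMr ?ltr0n// mul1r ler_nat.
pose q i x := quot (g (h i.+1 x)) (g (h i x)).
have near i x : (i < n.+1)%N -> A x -> 0 < dot (g (h i.+1 x)) (g (h i x)).
  move=> ni Ax; apply: dot_near; apply: lt_le_trans (_ : m / 2 <= _).
    apply: hd; [exact: Ah|exact/Ah/Ax/ltnW|].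
    rewrite /h -scalerBl normrZ -mulrBl -natrB// subSnn.
    rewrite normrM normr1 mul1r gtr0_norm ?invr_gt0 ?ltr0n// mulrC.
    by apply: lt_trans hn; rewrite ltr_pM2r ?invr_gt0 ?ltr0n//; exact: hB.
  by rewrite ler_pM2r ?invr_gt0//; apply: hm; exact: Ah.
have [t0 ht0] := is_angle_ex (g0 0 A0).
pose th (k : nat) (x : V) : R := t0 + \sum_(i < k) arg (q i x).
have angle k x : (k <= n.+1)%N -> A x -> is_angle (g (h k x)) (th k x).
  move=> + Ax; elim: k => [_|k IH kn].
    by rewrite /th big_ord0 addr0 /h mul0r scale0r.
  rewrite /th big_ord_recr /= addrA; apply: is_angle_quotK (IH (ltnW kn)).
  by apply: arg_is_angle; apply: gt0_off_ray; exact: near.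
exists (th n.+1); split; last first.
  move=> x Ax; have := angle n.+1 x (leqnn _) Ax.
  by rewrite {1}/h divff ?scale1r.
have ch i : (i <= n.+1)%N -> {within A, continuous (fun x => g (h i x))}.
  move=> ni; have hc : {within A, continuous (h i)}.
    by apply: continuous_within => x _; apply: cvgZ; [exact: cvg_cst|exact: cvg_id].
  by have := within_comp hc cg (Ah i ^~ ni).
suff H k : (k <= n.+1)%N -> {within A, continuous (th k)} by exact: H.
elim: k => [_|k IH kn].
  apply: (@within_ext _ _ A (fun=> t0)); last exact: within_cst.
  by move=> x _; rewrite /th big_ord0 addr0.
apply: (@within_ext _ _ _ (fun x => th k x + arg (q k x))).
  by move=> x _; rewrite /th big_ord_recr addrA.
apply: withinD; first exact/IH/ltnW.
apply: within_arg; first by apply: within_quot; apply: ch => //; exact: ltnW.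
by move=> x Ax; apply: gt0_off_ray; exact: near.
Qed.

(** A continuous map from a compact set to a Hausdorff space is a quotient map
    onto its image: what is constant on its fibres descends.  At [q t0], points
    of [A] off the fibre have neighbourhoods with images away from [q t0], and
    compactness makes this uniform. *)
Lemma within_quotient (T U : topologicalType) (W : normedModType R) (A : set T)
    (q : T -> U) (w : T -> W) : hausdorff_space U -> compact A ->
  {within A, continuous q} -> {within A, continuous w} ->
  (forall s t, A s -> A t -> q s = q t -> w s = w t) ->
  exists2 w' : U -> W, {within q @` A, continuous w'} &
    forall t, A t -> w' (q t) = w t.
Proof.
move=> hU cA /subspace_continuousP cq /subspace_continuousP cw qw.
have /choice[w' hw'] : forall u, exists y, forall t, A t -> q t = u -> y = w t.
  move=> u; have [[t At tu]|nu] := pselect (exists2 t, A t & q t = u).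
    by exists (w t) => s As su; apply: qw => //; rewrite su.
  by exists 0 => t At tu; case: nu; exists t.
exists w' => [|t At]; last exact: hw'.
apply/subspace_continuousP => _ [t0 At0 <-].
apply/cvgrPdist_lt => e e0; rewrite near_withinE /from_subspace.
have -> : w' (q t0) = w t0 by exact: hw'.
move: cA; rewrite compact_near_coveringP => cA.
have H : \forall u \near q t0,
    A `<=` (fun t => A t -> q t = u -> `|w t0 - w t| < e).
  apply: cA => t At; have [tt0|tt0] := pselect (q t = q t0).
    have wt : w t = w t0 by exact: qw.
    have /cvgrPdist_lt /(_ e e0) := cw t At.
    rewrite near_withinE /from_subspace (_ : w t = w t0)// => hw.
    by near=> t' u => /= At' _; move: At'; near: t'; exact: hw.
  move: hU; rewrite open_hausdorff => /(_ (q t) (q t0)) [|[P Q] /= [Pt Qt0] [oP oQ PQ]].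
    exact/eqP.
  have hP : \forall t' \near t, A t' -> P (q t').
    apply: (cq t At); apply: open_nbhs_nbhs; split => //; exact: set_mem.
  have hQ : nbhs (q t0) Q by apply: open_nbhs_nbhs; split => //; exact: set_mem.
  near=> t' u => /= At' qu; exfalso.
  have : (P `&` Q) (q t').
    split; first by move: At' {qu}; near: t'; exact: hP.
    by rewrite qu; clear At' qu; near: u; exact: hQ.
  by move/eqP : PQ => ->.
apply: filterS H => u Hu [t At tu]; rewrite (hw' u t At tu).
exact: Hu.
Unshelve. all: by end_near.
Qed.

Definition segment (p q : R * R) : set (R * R) :=
  [set p + k *: (q - p) | k in [set k : R | 0 <= k <= 1]].

(** The ratio [(x - q) / (x - p)] is real and nonpositive exactly when [x] lies
    between [p] and [q]. *)
Lemma off_ray_segment (x p q : R * R) : ~ segment p q x ->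
  off_ray (quot (x - q) (x - p)).
Proof.
move=> xs; apply/negPn/negP; rewrite negb_or negbK -leNgt.
case: x p q xs => x1 x2 [p1 p2] [q1 q2] xs; rewrite /quot /= => /andP[/eqP cr dt].
move: cr dt.
(* [D] is the dot product of [x - p] and [q - p]; it vanishes only when [x = p],
   and otherwise [x - p] is [q - p] times [|x - p|^2 / D]. *)
set a1 := x1 - p1; set a2 := x2 - p2; set b1 := x1 - q1; set b2 := x2 - q2.
move=> cr dt; apply: xs; set D := a1 ^+ 2 + a2 ^+ 2 - (b1 * a1 + b2 * a2).
have a0 : 0 <= a1 ^+ 2 + a2 ^+ 2 by rewrite addr_ge0 ?sqr_ge0.
have D0 : 0 <= D by rewrite /D; lra.
have [D00|Dn0] := eqVneq D 0.
  have : a1 ^+ 2 + a2 ^+ 2 = 0 by apply/eqP; rewrite eq_le a0 andbT; move: D00; rewrite /D; lra.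
  move/eqP; rewrite paddr_eq0 ?sqr_ge0// !sqrf_eq0 => /andP[/eqP a10 /eqP a20].
  exists 0; rewrite /= ?lexx ?ler01// scale0r addr0.
  by congr (_, _); apply/esym/eqP; rewrite -subr_eq0 -?/a1 -?/a2 ?a10 ?a20.
have Dp : 0 < D by rewrite lt_neqAle eq_sym Dn0.
exists ((a1 ^+ 2 + a2 ^+ 2) / D) => /=.
  by rewrite divr_ge0//= ler_pdivrMr// mul1r /D; lra.
have e1 : (a1 ^+ 2 + a2 ^+ 2) * (q1 - p1) = D * a1.
  have -> : q1 - p1 = a1 - b1 by rewrite /a1 /b1; ring.
  have -> : D * a1 = (a1 ^+ 2 + a2 ^+ 2) * (a1 - b1) + a2 * (b2 * - a1 + b1 * a2).
    by rewrite /D; ring.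
  by rewrite (_ : b2 * - a1 + b1 * a2 = 0) ?mulr0 ?addr0//; lra.
have e2 : (a1 ^+ 2 + a2 ^+ 2) * (q2 - p2) = D * a2.
  have -> : q2 - p2 = a2 - b2 by rewrite /a2 /b2; ring.
  have -> : D * a2 = (a1 ^+ 2 + a2 ^+ 2) * (a2 - b2) + a1 * (b2 * a1 - b1 * a2).
    by rewrite /D; ring.
  by rewrite cr mulr0 addr0.
congr (_, _) => /=.
  rewrite -[_ *: _]/(_ * _) mulrAC e1 mulrAC divff// mul1r /a1; ring.
rewrite -[_ *: _]/(_ * _) mulrAC e2 mulrAC divff// mul1r /a2; ring.
Qed.

Lemma within_subr (A : set (R * R)) (p : R * R) : {within A, continuous (fun x => x - p)}.
Proof. by apply: withinB; [exact: within_id|exact: within_cst]. Qed.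

(** The angle seen from [p] gives one seen from [q], as long as [K] does not cut
    the segment between them. *)
Lemma angle_lift_move (K : set (R * R)) (p q : R * R) th :
  (forall x, K x -> ~ segment p q x) ->
  angle_lift K (fun x => x - p) th ->
  angle_lift K (fun x => x - q) (fun x => th x + arg (quot (x - q) (x - p))).
Proof.
move=> Ks [cth ath]; split.
  apply: withinD => //; apply: within_arg.
    by apply: within_quot; exact: within_subr.
  by move=> x Kx; apply/off_ray_segment/Ks.
move=> x Kx; apply: is_angle_quotK (ath x Kx).
by apply/arg_is_angle/off_ray_segment/Ks.
Qed.

Lemma angle_lift_half (T : topologicalType) (K : set T) (g : T -> R * R) u :
  {within K, continuous g} -> u != 0 -> (forall x, K x -> 0 < dot (g x) u) ->
  exists th, angle_lift K g th.
Proof.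
move=> cg u0 h; have [b hb] := is_angle_ex u0.
exists (fun x => b + arg (quot (g x) u)); split.
  apply: withinD; first exact: within_cst.
  apply: within_arg; first by apply: within_quot => //; exact: within_cst.
  by move=> x Kx; apply: gt0_off_ray; exact: h.
move=> x Kx; apply: is_angle_quotK hb; apply: arg_is_angle; apply: gt0_off_ray.
exact: h.
Qed.

End LiftTools.

(** * Fixed points on non-separating continua *)

Section PlaneFixedPoint.
Variable R : realType.
Implicit Types (K C : set (R * R)) (f : R * R -> R * R).

(** Uniform local connectedness: close points of [K] are joined by small
    connected subsets of [K]. *)
Definition ulc K := forall e : R, 0 < e -> exists2 d : R, 0 < d &
  forall x y, K x -> K y -> `|x - y| < d ->
  exists C, [/\ connected C, C `<=` K, C x, C y & forall z, C z -> `|x - z| < e].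

(** For compact [K] this says that the complement of [K] is connected; the form
    with continuous angles is the one that is produced and used. *)
Definition nonseparating K :=
  forall p, ~ K p -> exists th, angle_lift K (fun x => x - p) th.

Lemma segment_box (p q x : R * R) (a b : R) : segment p q x ->
  (a <= p.1 <= b -> a <= q.1 <= b -> a <= x.1 <= b) /\
  (a <= p.2 <= b -> a <= q.2 <= b -> a <= x.2 <= b).
Proof.
case=> k /= /andP[k0 k1] <-.
split=> /andP[h1 h2] /andP[h3 h4] /=; rewrite -[_ *: _]/(_ * _);
  by apply/andP; split; nra.
Qed.

Lemma segmentl (p q : R * R) : segment p q p.
Proof. by exists 0; rewrite /= ?lexx ?ler01// scale0r addr0. Qed.

Lemma segmentr (p q : R * R) : segment p q q.
Proof. by exists 1; rewrite /= ?lexx ?ler01// scale1r subrKC. Qed.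

(** Discrete Green formula: [h i j] and [v i j] are the values on the horizontal
    and on the vertical edge starting at the vertex [(i, j)]. *)
Lemma sum_circulation (h v : nat -> nat -> R) (N : nat) :
  \sum_(i < N) \sum_(j < N) (h i j + v i.+1 j - h i j.+1 - v i j) =
  \sum_(i < N) (h i 0%N - h i N) + \sum_(j < N) (v N j - v 0%N j).
Proof.
have tele (F : nat -> R) : \sum_(k < N) (F k.+1 - F k) = F N - F 0%N.
  rewrite -(big_mkord xpredT (fun k => F k.+1 - F k)).
  by rewrite telescope_sumr.
transitivity (\sum_(i < N) \sum_(j < N) (h i j - h i j.+1) +
  \sum_(i < N) \sum_(j < N) (v i.+1 j - v i j)).
  rewrite -big_split; apply: eq_bigr => i _ /=; rewrite -big_split.
  by apply: eq_bigr => j _ /=; ring.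
congr (_ + _).
  apply: eq_bigr => i _; rewrite -[LHS]opprK -sumrN.
  under eq_bigr do rewrite opprB.
  by rewrite tele opprB.
by rewrite exchange_big; apply: eq_bigr => j _; rewrite (tele (v^~ j)).
Qed.

Section Edge.
Variables (K : set (R * R)) (f : R * R -> R * R) (m : R).
Hypothesis K_conn : connected K.
Hypothesis f_cont : {within K, continuous f}.
Hypothesis fK : forall x, K x -> K (f x).
Hypothesis m_gt0 : 0 < m.
Let g x := f x - x.
Hypothesis g_ge : forall x, K x -> m <= `|g x|.

Let dot_fg v x : K x -> `|x - v| < m / 2 -> 0 < dot (f x - v) (g x).
Proof.
move=> Kx xv; rewrite dotC; apply: dot_near.
rewrite /g opprB addrC subrKA distrC -normrN opprB.
by rewrite distrC (lt_le_trans xv)// ler_pM2r ?invr_gt0//; exact: g_ge.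
Qed.

Let g_cont : {within K, continuous g}.
Proof. by apply: withinB => //; exact: within_id. Qed.

(** The edge from [v] to [w] misses [K].  Between the ends of the edge, the turn of
    the direction to [p0] and the turn of the displacement [g] differ by the
    increment of a function of the vertex and of the point of [K] attached to it.
    The reason is that [p0] and [f aw] both belong to [K], on which the branches
    [Lv] and [Lw] differ, up to a constant, by the turn of the direction along
    the edge, while the
    direction from [v] to [f x] stays close to that of [g x] for [x] near [v]. *)
Lemma edge_identity (p0 v w av aw : R * R) Lv Lw C :
  angle_lift K (fun x => x - v) Lv -> angle_lift K (fun x => x - w) Lw ->
  (forall x, K x -> ~ segment v w x) -> K p0 -> K aw -> `|aw - w| < m / 2 ->
  connected C -> C `<=` K -> C av -> C aw ->
  (forall x, C x -> `|x - v| < m / 2) ->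
  (forall x, C x -> `|g x - g av| < m / 2) ->
  arg (quot (p0 - w) (p0 - v)) - arg (quot (g aw) (g av)) =
  (arg (quot (f aw - w) (g aw)) - Lw (f aw) + Lw p0) -
  (arg (quot (f av - v) (g av)) - Lv (f av) + Lv p0).
Proof.
move=> hLv hLw hs Kp0 Kaw aww cC CK Cav Caw Cv Cg.
(* E1: passing from [v] to [w] changes the branches at [p0] and at [f aw] alike.
   E2: [f aw - w], [f aw - v] and [g aw] lie in one half-plane.
   E3: along [C], correcting the angle of [f x - v] gives an angle of [g x].
   E4: [arg (quot (g av) (g av))] vanishes. *)
have E1 := lift_connected K_conn hLw (angle_lift_move hs hLv) Kp0 (fK Kaw).
have E2 := arg_quot_half (dot_fg Kaw aww) (dot_fg Kaw (Cv _ Caw)).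
have gdot x : C x -> 0 < dot (g x) (g av).
  move=> Cx; rewrite dotC; apply: dot_near; rewrite distrC.
  by rewrite (lt_le_trans (Cg x Cx))// ler_pM2r ?invr_gt0//; exact/g_ge/CK.
have gav0 : g av != 0 by rewrite -normr_gt0 (lt_le_trans m_gt0)//; exact/g_ge/CK.
have cfC := continuous_subspaceW CK f_cont; have cgC := continuous_subspaceW CK g_cont.
have l1 : angle_lift C g (fun x => Lv (f x) - arg (quot (f x - v) (g x))).
  split.
    apply: withinB.
      by apply: (@within_comp _ _ _ C K f Lv) => //; [exact: (proj1 hLv)|move=> x /CK /fK].
    apply: within_arg; last by move=> x Cx; apply/gt0_off_ray/dot_fg/Cv/Cx/CK.
    apply: within_quot => //; apply: withinB => //; exact: within_cst.
  move=> x Cx.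
  apply: is_angle_quotK (proj2 hLv _ (fK (CK _ Cx))); apply: is_angle_quotC.
  by apply/arg_is_angle/gt0_off_ray/dot_fg/Cv/Cx/CK.
have [b hb] := is_angle_ex gav0.
have l2 : angle_lift C g (fun x => b + arg (quot (g x) (g av))).
  split.
    apply: withinD; first exact: within_cst.
    apply: within_arg; last by move=> x Cx; apply/gt0_off_ray/gdot.
    by apply: within_quot => //; exact: within_cst.
  move=> x Cx; apply: is_angle_quotK hb; apply/arg_is_angle/gt0_off_ray.
  exact: gdot.
have E3 := lift_connected cC l1 l2 Cav Caw.
have E4 := arg_quot_half (gdot av Cav) (gdot av Cav).
move: E1 E2 E3 E4 => /=; rewrite !opprD !addrA.
lra.
Qed.

End Edge.

Lemma ler_prod_norm (z : R * R) (e : R) : (`|z| <= e) = (`|z.1| <= e) && (`|z.2| <= e).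
Proof. by rewrite prod_normE ge_max. Qed.

Lemma ltr_prod_norm (z : R * R) (e : R) : (`|z| < e) = (`|z.1| < e) && (`|z.2| < e).
Proof. by rewrite prod_normE gt_max. Qed.

Lemma subrDl (a b c : R) : a + b - (a + c) = b - c. Proof. by ring. Qed.

Lemma itv_dist (a s x y : R) : a <= x <= a + s -> a <= y <= a + s -> `|x - y| <= s.
Proof. by move=> /andP[? ?] /andP[? ?]; rewrite ler_norml; apply/andP; split; lra. Qed.

Theorem plane_fixed_point K f : compact K -> connected K -> K !=set0 ->
  ulc K -> nonseparating K -> {within K, continuous f} ->
  (forall x, K x -> K (f x)) -> exists2 x, K x & f x = x.
Proof.
move=> cK K_conn [p0 Kp0] ulcK nsK f_cont fK; apply: contrapT => nofix.
pose g x := f x - x.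
have g0 x : K x -> g x != 0.
  by move=> Kx; apply/negP; rewrite subr_eq0 => /eqP fx; apply: nofix; exists x.
have g_cont : {within K, continuous g} by apply: withinB => //; exact: within_id.
have [m m0 g_ge] := within_away0 cK g_cont g0.
have m2 : 0 < m / 2 by rewrite divr_gt0.
have [dg dg0 hg] := uniform_within cK g_cont m2.
(* A subset of [K] of radius [e] changes [g] by less than [m / 2] and, if its
   centre is at most [s] away from a vertex, stays within [m / 2] of that
   vertex.  Points attached to vertices at distance at most [s] are less than
   [4 * s <= d] apart, so that such a subset joins them. *)
pose e := Num.min dg (m / 4).
have e0 : 0 < e by rewrite lt_min dg0 divr_gt0.
have edg : e <= dg by rewrite ge_min lexx.
have em : e <= m / 4 by rewrite ge_min lexx orbT.
have [d d0 hC] := ulcK e e0.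
pose s := Num.min d e / 4.
have s0 : 0 < s by rewrite divr_gt0// lt_min d0.
have sd : s * 4 <= d by rewrite /s mulfVK// ge_min lexx.
have se : s * 4 <= e by rewrite /s mulfVK// ge_min lexx orbT.
have [B B0 hB] := ex_strict_bound_gt0 (compact_bounded cK).
pose n := (Num.truncn ((B + B) / s)).+1.
have hn : B + B < s * n%:R.
  rewrite mulrC -ltr_pdivrMr//.
  by have /andP[] := truncn_itv (ltW (divr_gt0 (addr_gt0 B0 B0) s0)).
(* Coordinates of the grid lines relative to [p0]; the half step makes [p0] the
   centre of the square with lower left corner [(n, n)]. *)
pose c (i : nat) : R := s * (i%:R - n%:R - 2^-1).
have cS i : c i.+1 = c i + s by rewrite /c -natr1; ring.
have c_mono i j : (i <= j)%N -> c i <= c j.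
  by move=> ij; rewrite /c ler_pM2l// !lerB// ler_nat.
have cn : c n = - (s / 2) by rewrite /c subrr sub0r mulrN.
pose V i j : R * R := (p0.1 + c i, p0.2 + c j).
have /choice[L hL] : forall p, exists th : R * R -> R,
    ~ K p -> angle_lift K (fun x => x - p) th.
  by move=> p; have [Kp|/nsK[th hth]] := pselect (K p); [exists (fun=> 0)|exists th].
pose N v := exists2 a, K a & `|v - a| <= s.
have /choice[a ha] : forall v, exists a, N v -> K a /\ `|v - a| <= s.
  by move=> v; have [[x Kx vx]|nN] := pselect (N v); [exists x|exists 0].
(* [om] and [eta] are the two turns along an edge, and [psi] is the coboundary of
   [edge_identity].  [D], their defect, is set to zero on the edges that miss
   [K]; by that identity this agrees with the formula ([DE]). *)
pose psi v := arg (quot (f (a v) - v) (g (a v))) - L v (f (a v)) + L v p0.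
pose om v w := arg (quot (p0 - w) (p0 - v)).
pose eta v w := arg (quot (g (a w)) (g (a v))).
pose meets v w := exists2 x, K x & segment v w x.
pose D v w := if `[< meets v w >] then om v w - eta v w - (psi w - psi v) else 0.
have aa v w : N v -> N w -> `|v - w| <= s -> `|a v - a w| < s * 4.
  move=> /ha[_ h1] /ha[_ h2] h3.
  rewrite -(subrKA v) (le_lt_trans (ler_normD _ _))// -(subrKA w v).
  rewrite [X in X + _]distrC.
  have := ler_normD (v - w) (w - a w); lra.
have DE v w : N v -> N w -> `|v - w| <= s ->
    D v w = om v w - eta v w - (psi w - psi v).
  move=> Nv Nw vw; rewrite /D; case: asboolP => // nm.
  have hs x : K x -> ~ segment v w x by move=> Kx sx; apply: nm; exists x.
  have nKv : ~ K v by move=> /hs; apply; exact: segmentl.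
  have nKw : ~ K w by move=> /hs; apply; exact: segmentr.
  have [[Kav av] [Kaw aw]] := (ha _ Nv, ha _ Nw).
  have [|C [cC CK Cav Caw Ce]] := hC _ _ Kav Kaw.
    by rewrite (lt_le_trans (aa v w Nv Nw vw)).
  apply/esym/eqP; rewrite subr_eq0; apply/eqP.
  apply: (@edge_identity K f m K_conn f_cont fK m0 g_ge p0 v w (a v) (a w) (L v) (L w) C);
    rewrite //; try exact: hL.
  - by rewrite distrC (le_lt_trans aw)//; lra.
  - move=> x Cx; have h := Ce x Cx.
    by rewrite distrC -(subrKA (a v)) (le_lt_trans (ler_normD _ _))//; lra.
  - move=> x Cx; apply: hg; [exact: CK|exact: Kav|].
    by rewrite distrC (lt_le_trans (Ce x Cx)).
have sq_near i j k l x : K x -> c i <= x.1 - p0.1 <= c i.+1 ->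
    c j <= x.2 - p0.2 <= c j.+1 -> (i <= k <= i.+1)%N -> (j <= l <= j.+1)%N ->
    N (V k l).
  move=> Kx /andP[x1 x2] /andP[y1 y2] /andP[ik ki] /andP[jl lj].
  exists x => //; rewrite ler_prod_norm /=.
  rewrite -[_ + c k - _](_ : c k - (x.1 - p0.1) = _); last by ring.
  rewrite -[_ + c l - _](_ : c l - (x.2 - p0.2) = _); last by ring.
  apply/andP; split; [apply: (@itv_dist (c i))|apply: (@itv_dist (c j))];
    by rewrite -cS ?x1 ?y1 ?c_mono.
have step1 i j : `|V i j - V i.+1 j| <= s.
  by rewrite ler_prod_norm /= !subrDl subrr normr0 cS opprD addrA subrr add0r normrN gtr0_norm// lexx ltW.
have step2 i j : `|V i j - V i j.+1| <= s.
  by rewrite ler_prod_norm /= !subrDl subrr normr0 cS opprD addrA subrr add0r normrN gtr0_norm// lexx ltW.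
have om_center : om (V n n) (V n.+1 n) + om (V n.+1 n) (V n.+1 n.+1)
    - om (V n n.+1) (V n.+1 n.+1) - om (V n n) (V n n.+1) = 2 * pi.
  have s2 : 0 < s ^+ 2 / 2 by rewrite divr_gt0// exprn_gt0.
  have -> : om (V n n) (V n.+1 n) = pi / 2.
    rewrite -(arg_imag s2); congr arg; rewrite /quot /V /= cS cn.
    by congr (_, _); field.
  have -> : om (V n.+1 n) (V n.+1 n.+1) = pi / 2.
    rewrite -(arg_imag s2); congr arg; rewrite /quot /V /= cS cn.
    by congr (_, _); field.
  have -> : om (V n n.+1) (V n.+1 n.+1) = - (pi / 2).
    rewrite -(arg_imagN s2); congr arg; rewrite /quot /V /= cS cn.
    by congr (_, _); field.
  have -> : om (V n n) (V n n.+1) = - (pi / 2).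
    rewrite -(arg_imagN s2); congr arg; rewrite /quot /V /= cS cn.
    by congr (_, _); field.
  by field.
(* A square other than the central one is seen from [p0] inside a half-plane. *)
have om_half u i j : (forall k l, (i <= k <= i.+1)%N -> (j <= l <= j.+1)%N ->
    0 < dot (p0 - V k l) u) ->
    om (V i j) (V i.+1 j) + om (V i.+1 j) (V i.+1 j.+1)
    - om (V i j.+1) (V i.+1 j.+1) - om (V i j) (V i j.+1) = 0.
  move=> hu; have o k l k' l' : (i <= k <= i.+1)%N -> (j <= l <= j.+1)%N ->
      (i <= k' <= i.+1)%N -> (j <= l' <= j.+1)%N -> om (V k l) (V k' l') =
      arg (quot (p0 - V k' l') u) - arg (quot (p0 - V k l) u).
    by move=> *; apply: arg_quot_half; exact: hu.
  by rewrite !o ?leqnn ?leqnSn//; ring.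
have omE i j : om (V i j) (V i.+1 j) + om (V i.+1 j) (V i.+1 j.+1)
    - om (V i j.+1) (V i.+1 j.+1) - om (V i j) (V i j.+1) =
    if (i == n) && (j == n) then 2 * pi else 0.
  have low k l : (k < l)%N -> (l <= n)%N -> forall q, (q <= l)%N -> 0 < - c q.
    move=> _ ln q ql; have := c_mono _ _ (leq_trans ql ln); rewrite cn; lra.
  have high q : (n < q)%N -> 0 < c q.
    by move=> nq; have := c_mono _ _ nq; rewrite cS cn; lra.
  have [i_lt|i_gt|->] := ltngtP i n.
  - apply: (om_half (1, 0)) => k l /andP[_ ki] _; rewrite /dot /=.
      by have := low i i.+1 (leqnn _) i_lt k ki; lra.
  - apply: (om_half (-1, 0)) => k l /andP[ik _] _; rewrite /dot /=.
    by have := high k (leq_trans i_gt ik); lra.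
  have [j_lt|j_gt|->] := ltngtP j n; last exact: om_center.
    apply: (om_half (0, 1)) => k l _ /andP[_ lj]; rewrite /dot /=.
    by have := low j j.+1 (leqnn _) j_lt l lj; lra.
  apply: (om_half (0, -1)) => k l _ /andP[jl _]; rewrite /dot /=.
  by have := high l (leq_trans j_gt jl); lra.
(* On a square that misses [K] every [D] is zero by definition.  On the others
   [psi] cancels, [eta] turns by zero since [g] varies by less than [m / 2], and
   [om] remains. *)
have circ i j : D (V i j) (V i.+1 j) + D (V i.+1 j) (V i.+1 j.+1)
    - D (V i j.+1) (V i.+1 j.+1) - D (V i j) (V i j.+1) =
    if (i == n) && (j == n) then 2 * pi else 0.
  have [[x [Kx x1 x2]]|nQ] := pselect (exists x, [/\ K x,
      c i <= x.1 - p0.1 <= c i.+1 & c j <= x.2 - p0.2 <= c j.+1]); last first.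
    have D0 k l k' l' : (i <= k <= i.+1)%N -> (j <= l <= j.+1)%N ->
        (i <= k' <= i.+1)%N -> (j <= l' <= j.+1)%N -> D (V k l) (V k' l') = 0.
      move=> /andP[k1 k2] /andP[l1 l2] /andP[k1' k2'] /andP[l1' l2'].
      rewrite /D; case: asboolP => // -[x Kx sx]; exfalso; apply: nQ; exists x.
      have [b1 _] := segment_box (p0.1 + c i) (p0.1 + c i.+1) sx.
      have [_ b2] := segment_box (p0.2 + c j) (p0.2 + c j.+1) sx.
      move: b1 b2; rewrite /V /= !lerD2l !c_mono// => /(_ isT isT) b1 /(_ isT isT) b2.
      by split=> //; rewrite lerBrDl lerBlDl.
    rewrite !D0 ?leqnn ?leqnSn// addr0 !subr0.
    case: ifP => // /andP[/eqP i_n /eqP j_n]; exfalso; apply: nQ; exists p0.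
    by rewrite i_n j_n !subrr cS cn; split=> //; apply/andP; split; lra.
  have NV k l : (i <= k <= i.+1)%N -> (j <= l <= j.+1)%N -> N (V k l).
    by move=> ? ?; exact: (sq_near i j k l x).
  have [N00 N10 N01 N11] : [/\ N (V i j), N (V i.+1 j), N (V i j.+1) & N (V i.+1 j.+1)].
    by split; apply: NV; rewrite ?leqnn ?leqnSn.
  rewrite !DE//.
  have etaE k l k' l' : (i <= k <= i.+1)%N -> (j <= l <= j.+1)%N ->
      (i <= k' <= i.+1)%N -> (j <= l' <= j.+1)%N -> eta (V k l) (V k' l') =
      arg (quot (g (a (V k' l'))) (g (a (V i j)))) -
      arg (quot (g (a (V k l))) (g (a (V i j)))).
    have dg' k1 l1 : (i <= k1 <= i.+1)%N -> (j <= l1 <= j.+1)%N ->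
        0 < dot (g (a (V k1 l1))) (g (a (V i j))).
      move=> hk hl; have [K1 _] := ha _ (NV _ _ hk hl).
      have [K2 _] : K (a (V i j)) /\ `|V i j - a (V i j)| <= s.
        by apply/ha/NV; rewrite leqnn leqnSn.
      rewrite dotC; apply: dot_near; apply: (@lt_le_trans _ _ (m / 2)).
        apply: hg => //; apply: (@lt_le_trans _ _ (s * 4)); last by lra.
        apply: aa; [by apply: NV; rewrite leqnn leqnSn|exact: NV|].
        move: hk hl => /andP[ik ki] /andP[jl lj].
        rewrite ler_prod_norm /= !subrDl.
        apply/andP; split; [apply: (@itv_dist (c i))|apply: (@itv_dist (c j))];
          by rewrite -cS ?lexx ?c_mono.
      by rewrite ler_pM2r ?invr_gt0//; exact: g_ge.
    by move=> *; apply: arg_quot_half; exact: dg'.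
  rewrite !etaE ?leqnn ?leqnSn// -omE; ring.
have inside x : K x -> `|x.1 - p0.1| < s * n%:R /\ `|x.2 - p0.2| < s * n%:R.
  move=> Kx; apply/andP; rewrite -(ltr_prod_norm (x - p0)).
  rewrite (le_lt_trans (ler_normB _ _))// (lt_trans _ hn)//.
  by rewrite ltrD//; exact: hB.
pose M := n.*2.+1.
(* The boundary of the grid misses [K], and there [D] is zero. *)
have cM : c M = s * n%:R + s / 2.
  by rewrite /c /M -natr1 -muln2 natrM; field.
have c0E : c 0%N = - (s * n%:R) - s / 2 by rewrite /c; field.
have := sum_circulation (fun i j => D (V i j) (V i.+1 j))
  (fun i j => D (V i j) (V i j.+1)) M.
rewrite [X in _ = X + _]big1 => [|i _]; last first.
  rewrite /D; case: asboolP => [[x Kx sx]|_].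
    have [_] := segment_box (p0.2 + c 0%N) (p0.2 + c 0%N) sx.
    rewrite /= !lexx => /(_ isT isT); have [_ ] := inside x Kx.
    by rewrite c0E ltr_norml => /andP[? ?] /andP[? ?]; exfalso; lra.
  case: asboolP => [[x Kx sx]|_]; last by rewrite subrr.
  have [_] := segment_box (p0.2 + c M) (p0.2 + c M) sx.
  rewrite /= !lexx => /(_ isT isT); have [_ ] := inside x Kx.
  by rewrite cM ltr_norml => /andP[? ?] /andP[? ?]; exfalso; lra.
rewrite [X in _ = _ + X]big1 => [|j _]; last first.
  rewrite /D; case: asboolP => [[x Kx sx]|_].
    have [+ _] := segment_box (p0.1 + c M) (p0.1 + c M) sx.
    rewrite /= !lexx => /(_ isT isT); have [+ _] := inside x Kx.
    by rewrite cM ltr_norml => /andP[? ?] /andP[? ?]; exfalso; lra.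
  case: asboolP => [[x Kx sx]|_]; last by rewrite subrr.
  have [+ _] := segment_box (p0.1 + c 0%N) (p0.1 + c 0%N) sx.
  rewrite /= !lexx => /(_ isT isT); have [+ _] := inside x Kx.
  by rewrite c0E ltr_norml => /andP[? ?] /andP[? ?]; exfalso; lra.
rewrite addr0 => /eqP; apply/negP.
have nM : (n < M)%N by rewrite /M -addnn ltnS leq_addr.
rewrite (bigD1 (Ordinal nM))//= (bigD1 (Ordinal nM))//= circ !eqxx /=.
rewrite big1 ?addr0 => [|j]; last first.
  by rewrite circ eqxx /= -val_eqE /= => /negbTE ->.
rewrite big1 ?addr0 ?mulf_neq0 ?gt_eqF ?pi_gt0// => i.
rewrite -val_eqE /= => /negbTE i_n; apply: big1 => j _.
by rewrite circ i_n.
Qed.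

End PlaneFixedPoint.

(** * From chains to paths *)

Section Paths.
Variable R : realType.
Local Notation V := (R * R)%type.
Implicit Types (K C : set V) (d e : R).

Definition step (C : set V) (d : R) : rel V :=
  fun x y => `[< [/\ C x, C y & `|x - y| < d] >].

(** The points that a chain reaches from [x] form a set which is both open and
    closed in [C]. *)
Lemma connected_chain C d x y : connected C -> 0 < d -> C x -> C y ->
  exists2 l : seq V, path (step C d) x l & last x l = y.
Proof.
move=> cC d0 Cx Cy.
pose D := [set z | C z /\ exists2 l : seq V, path (step C d) x l & last x l = z].
have next z z' : D z -> C z' -> `|z - z'| < d -> D z'.
  move=> [Cz [l pl ll]] Cz' zz'; split => //; exists (rcons l z').
    by rewrite rcons_path pl ll; apply/asboolP.
  by rewrite last_rcons.
suff DC : D = C by have [] : D y by rewrite DC.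
apply: (cC D).
- by exists x; split=> //; exists [::].
- exists (\bigcup_(z in D) ball z d).
    by apply: bigcup_open => z _; exact: ball_open.
  apply/seteqP; split=> [z Dz|z [Cz [z' Dz' zz']]].
    by split; [case: Dz|exists z => //; exact: ballxx].
  by apply: (next z'); rewrite // -ball_normE in zz'.
- exists (~` \bigcup_(z in C `\` D) ball z d).
    by apply: open_closedC; apply: bigcup_open => z _; exact: ball_open.
  apply/seteqP; split=> [z Dz|z [Cz nz]].
    split; first by case: Dz.
    move=> [z' [Cz' nDz'] zz']; apply: nDz'; apply: (next z) => //.
    by move: zz'; rewrite -ball_normE /= distrC.
  by apply: contrapT => nD; apply: nz; exists z => //; exact: ballxx.
Qed.

Lemma geometric_limit K (u : nat -> V) e : compact K -> 0 < e ->
  (forall k, K (u k)) -> (forall k, `|u k - u k.+1| < e / 2 ^+ k) ->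
  exists2 l, K l & forall k, `|u k - l| <= 2 * (e / 2 ^+ k).
Proof.
move=> cK e0 Ku du.
pose a k : R := e / 2 ^+ k.
have a0 k : 0 < a k by rewrite divr_gt0// exprn_gt0.
have aS k : a k = 2 * a k.+1.
  by rewrite /a exprS; field; rewrite expf_neq0.
have tail k j : `|u k - u (k + j)%N| <= 2 * a k - 2 * a (k + j)%N.
  elim: j => [|j IH]; first by rewrite addn0 !subrr normr0.
  rewrite addnS -(subrKA (u (k + j)%N)) (le_trans (ler_normD _ _))//.
  have := du (k + j)%N; rewrite -/(a _) (aS (k + j)%N); move: IH.
  by rewrite (aS (k + j)%N); lra.
have tail2 k j : `|u k - u (k + j)%N| <= 2 * a k.
  by rewrite (le_trans (tail k j))// gerBl mulr_ge0// ltW.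
have [l [Kl cl]] := cK (u @ \oo) _ (filterS (fun k _ => Ku k) filterT : (u @ \oo) K).
exists l => // k; apply/ler_addgt0Pr => d d0.
have [|_ [[j kj <-] uj]] := cl [set u j | j in [set j | (k <= j)%N]] (ball l d) _
    (nbhsx_ballx _ _ d0).
  by exists k => // j kj; exists j.
rewrite -(subrKA (u j)) (le_trans (ler_normD _ _))// lerD//.
  by rewrite -(subnKC kj); exact: tail2.
by move: uj; rewrite -ball_normE /= distrC; exact: ltW.
Qed.

Lemma geometric_small (c d : R) : 0 < c -> 0 < d -> exists k : nat, c / 2 ^+ k < d.
Proof.
move=> c0 d0; exists (Num.truncn (c / d)).+1.
rewrite ltr_pdivrMr ?exprn_gt0// mulrC -ltr_pdivrMr//.
have /andP[_ h] := truncn_itv (ltW (divr_gt0 c0 d0)); apply: (lt_trans h).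
by rewrite -natrX ltr_nat ltn_expl.
Qed.

(** Replace each step of [s] by a chain of smaller steps inside a small connected
    set.  As [s] is eventually constant, one number [N] of smaller steps serves
    for all its steps, repeating the last point where fewer are needed; step [i]
    then occupies the indices from [N * i] on, and the refinements can be
    iterated by plain arithmetic on indices. *)
Lemma refine_chain K (e d d' : R) (s : nat -> V) :
  (forall x y, K x -> K y -> `|x - y| < d ->
    exists C, [/\ connected C, C `<=` K, C x, C y & forall z, C z -> `|x - z| < e]) ->
  0 < d' -> 0 < e -> (forall i, K (s i)) -> (forall i, `|s i - s i.+1| < d) ->
  (exists P, forall i, (P <= i)%N -> s i = s P) ->
  exists (N : nat) (s' : nat -> V), [/\ (0 < N)%N, forall i, K (s' i),
    forall i, `|s' i - s' i.+1| < d', exists P, forall i, (P <= i)%N -> s' i = s' P &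
    forall i j, (j < N)%N -> s' (N * i)%N = s i /\ `|s i - s' (N * i + j)%N| < e].
Proof.
move=> hC d'0 e0 Ks ds [P hP].
have /choice[l hl] : forall i, exists l : seq V, [/\ path (step K d') (s i) l,
    last (s i) l = s i.+1, forall z, z \in l -> `|s i - z| < e &
    (P <= i)%N -> l = [::]].
  move=> i; have [Pi|iP] := leqP P i.
    by exists [::]; split; rewrite //= hP// (hP i.+1)// leqW.
  have [C [cC CK Ci Ci1 Ce]] := hC _ _ (Ks i) (Ks i.+1) (ds i).
  have [l pl ll] := connected_chain cC d'0 Ci Ci1; exists l; split => //.
    by apply: sub_path pl => x y /asboolP[Cx Cy xy]; apply/asboolP; split; rewrite //; exact: CK.
  move=> z zl; apply: Ce.
  elim: l (s i) pl zl {ll Ci} => // a l IH x /= /andP[/asboolP[_ Ca _] pl].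
  by rewrite inE => /orP[/eqP ->//|]; exact: IH pl.
have [M hM] : exists M, forall i, (size (l i) <= M)%N.
  exists (\max_(i < P) size (l i)) => i.
  have [iP|Pi] := ltnP i P; last by have [_ _ _ ->] := hl i.
  exact: (leq_bigmax (Ordinal iP)).
pose w i := nth (s i.+1) (s i :: l i).
have w0 i : w i 0%N = s i by [].
have wend i j : (M < j)%N -> w i j = s i.+1.
  by move=> Mj; rewrite /w nth_default//= (leq_ltn_trans (hM i)).
have Kw i j : K (w i j).
  rewrite /w; case: (hl i) => + _ _ _; elim: (l i) (s i) (Ks i) j => [|a l' IH] x Kx [|j] //=.
    by move=> _; case: j => /= *; exact: Ks.
  by move=> /andP[/asboolP[_ Ka _] pl]; exact: IH.
have dw i j : `|w i j - w i j.+1| < d'.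
  case: (hl i) => pl ll _ _; have [jl|lj] := ltnP j (size (l i)).
    have /pathP := pl; move=> /(_ (s i.+1) j jl) /asboolP[_ _].
    by rewrite /w.
  have -> : w i j = s i.+1.
    move: lj; rewrite leq_eqVlt => /orP[/eqP e1|lj]; last by rewrite /w nth_default.
    by rewrite /w -e1 nth_last /= ll.
  by rewrite /w nth_default //= subrr normr0.
have ew i j : `|s i - w i j| < e.
  case: (hl i) => _ ll hz _; have [jl|lj] := leqP j (size (l i)).
    rewrite /w; case: j jl => [|j jl] /=; first by rewrite subrr normr0.
    by apply: hz; exact: mem_nth.
  rewrite /w nth_default //= -ll; case: (l i) hz => [|a l'] hz /=.
    by rewrite subrr normr0.
  by apply: hz; exact: mem_last.
exists M.+1, (fun k => w (k %/ M.+1)%N (k %% M.+1)%N); split=> //.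
- move=> k; have [kM|kM] := ltnP (k %% M.+1).+1 M.+1.
    have e1 : k.+1 = ((k %/ M.+1) * M.+1 + (k %% M.+1).+1)%N.
      by rewrite addnS -divn_eq.
    have -> : (k.+1 %/ M.+1 = k %/ M.+1)%N by rewrite {1}e1 divnMDl// (divn_small kM) addn0.
    have -> : (k.+1 %% M.+1 = (k %% M.+1).+1)%N by rewrite {1}e1 modnMDl (modn_small kM).
    exact: dw.
  have e1 : k.+1 = ((k %/ M.+1).+1 * M.+1)%N.
    have r1 : ((k %% M.+1).+1 = M.+1)%N by apply/eqP; rewrite eqn_leq kM ltn_mod.
    by rewrite mulSn addnC -[X in (_ + X)%N]r1 addnS -divn_eq.
  have -> : (k.+1 %/ M.+1 = (k %/ M.+1).+1)%N by rewrite {1}e1 mulnK.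
  have -> : (k.+1 %% M.+1 = 0)%N by rewrite {1}e1 modnMl.
  rewrite w0 -(wend _ M.+1)//.
  have -> : (k %% M.+1 = M)%N.
    by apply/eqP; rewrite eqn_leq -ltnS ltn_mod -ltnS.
  exact: dw.
- exists (P * M.+1)%N => k hk.
  have wP i j : (P <= i)%N -> w i j = s P.
    move=> Pi; have [_ _ _ /(_ Pi) li] := hl i; rewrite /w li.
    by case: j => [|j] /=; rewrite ?nth_nil hP// leqW.
  by rewrite !wP ?mulnK// leq_divRL.
- move=> i j jN; rewrite mulKn// modnMr w0; split=> //.
  by rewrite mulnC divnMDl// modnMDl divn_small// modn_small// addn0.
Qed.

(** Refine the chain again and again, with steps and deviations that decrease
    geometrically.  After [k] refinements each original step has become [P k]
    small steps, and the point of index [trunc (t * P k)] is an approximation to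
    [g t]; these points converge uniformly in [t]. *)
Lemma chain_path K e : compact K -> ulc K -> 0 < e -> exists2 d, 0 < d &
  forall s : nat -> V, (forall i, K (s i)) -> (forall i, `|s i - s i.+1| < d) ->
  (exists P, forall i, (P <= i)%N -> s i = s P) ->
  exists g : R -> V, [/\ continuous g, forall t, K (g t), forall i, g i%:R = s i &
    forall i t, i%:R <= t <= i.+1%:R -> `|s i - g t| < e].
Proof.
move=> cK ulcK e_gt0; pose e0 := e / 4.
have e00 : 0 < e0 by rewrite divr_gt0.
pose a k : R := e0 / 2 ^+ k.
have a0 k : 0 < a k by rewrite divr_gt0// exprn_gt0.
have /choice[d hd] : forall k, exists d : R, [/\ 0 < d, d <= a k &
    forall x y, K x -> K y -> `|x - y| < d -> exists C,
     [/\ connected C, C `<=` K, C x, C y & forall z, C z -> `|x - z| < a k]].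
  move=> k; have [d d0 h] := ulcK _ (a0 k); exists (Num.min d (a k)).
  split; rewrite ?lt_min ?d0 ?a0// ?ge_min ?lexx ?orbT// => x y Kx Ky.
  by rewrite lt_min => /andP[xy _]; exact: h.
have d0 k : 0 < d k by case: (hd k).
exists (d 0%N) => // s Ks ds sP.
pose good k (s : nat -> V) := [/\ forall i, K (s i),
  forall i, `|s i - s i.+1| < d k & exists P, forall i, (P <= i)%N -> s i = s P].
have /choice[ref href] : forall ks : nat * (nat -> V), exists Ns : nat * (nat -> V),
    good ks.1 ks.2 -> [/\ (0 < Ns.1)%N, good ks.1.+1 Ns.2 &
      forall i j, (j < Ns.1)%N -> Ns.2 (Ns.1 * i)%N = ks.2 i /\
        `|ks.2 i - Ns.2 (Ns.1 * i + j)%N| < a ks.1].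
  move=> [k u]; have [[Ku du uP]|ng] := pselect (good k u); last by exists (0%N, u).
  have [_ _ hC] := hd k.
  have [N [s' [N0 Ks' ds' s'P h]]] := refine_chain hC (d0 k.+1) (a0 k) Ku du uP.
  by exists (N, s').
pose st := fix st k : nat -> V := if k is k'.+1 then (ref (k', st k')).2 else s.
have st_good k : good k (st k).
  by elim: k => [|k IH] //=; case: (href (k, st k) IH).
pose N k := (ref (k, st k)).1.
have N0 k : (0 < N k)%N by case: (href (k, st k) (st_good k)).
have hst k i j : (j < N k)%N -> st k.+1 (N k * i)%N = st k i /\
    `|st k i - st k.+1 (N k * i + j)%N| < a k.
  by case: (href (k, st k) (st_good k)) => _ _; apply.
pose P k := (\prod_(j < k) N j)%N.
have PS k : P k.+1 = (P k * N k)%N by rewrite /P big_ord_recr.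
have P0 k : (0 < P k)%N by rewrite /P; apply: prodn_gt0 => j; exact: N0.
pose idx k (t : R) := Num.truncn (t * (P k)%:R).
have idxS k t : exists2 j, (j < N k)%N & idx k.+1 t = (N k * idx k t + j)%N.
  rewrite /idx PS natrM mulrA; set x := t * _.
  have N0r : 0 < (N k)%:R :> R by rewrite ltr0n.
  have [x0|x0] := leP 0 x; last first.
    have trunc0 (y : R) : y < 0 -> Num.truncn y = 0%N.
      by move=> y0; apply/eqP; rewrite -leqn0 truncn_le_nat (lt_trans y0).
    exists 0%N; first exact: N0.
    by rewrite (trunc0 x x0) (trunc0 (x * _)) ?muln0// pmulr_llt0.
  have /andP[h1 h2] := truncn_itv x0.
  have xN0 : 0 <= x * (N k)%:R by rewrite mulr_ge0// ltW.
  have le1 : (N k * Num.truncn x <= Num.truncn (x * (N k)%:R))%N.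
    by rewrite truncn_ge_nat// natrM mulrC ler_pM2r.
  exists (Num.truncn (x * (N k)%:R) - N k * Num.truncn x)%N; last by rewrite subnKC.
  by rewrite ltn_subLR// -mulnSr truncn_lt_nat// natrM mulrC ltr_pM2l.
(* Times closer than [1 / P k] have equal or consecutive indices. *)
have near_idx k t t' : `|t - t'| < (P k)%:R^-1 ->
    `|st k (idx k t) - st k (idx k t')| < d k.
  have [_ dst _] := st_good k.
  have pk0 : 0 < (P k)%:R :> R by rewrite ltr0n.
  wlog tt : t t' / t <= t'.
    move=> H; have [/H//|/ltW /H {}H] := leP t t'.
    by rewrite distrC => /H; rewrite distrC.
  rewrite distrC ger0_norm ?subr_ge0// -(ltr_pM2r pk0) mulVf ?gt_eqF// mulrBl.
  rewrite ltrBlDl -/(idx k t); set x := t * _; set x' := t' * _ => xx'.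
  have [->|->] : idx k t' = idx k t \/ idx k t' = (idx k t).+1.
    have le1 : (idx k t <= idx k t')%N by apply: le_truncn; rewrite ler_pM2r.
    have : (idx k t' < (idx k t).+2)%N.
      rewrite ltnS truncn_le_nat -natr1; apply: (lt_le_trans xx').
      by have := truncnS_gt x; rewrite -/(idx k t); lra.
    by lia.
    by rewrite subrr normr0.
  exact: dst.
have /choice[g hg] : forall t, exists l, K l /\
    forall k, `|st k (idx k t) - l| <= 2 * a k.
  move=> t; have [|k|l Kl hl] := @geometric_limit K (fun k => st k (idx k t)) e0 cK e00.
  - by move=> k; case: (st_good k).
  - by have [j jN ->] := idxS k t; case: (hst k (idx k t) j jN).
  - by exists l.
have st_pow k i : st k (P k * i)%N = s i.
  elim: k => [|k IH]; first by rewrite /P big_ord0 mul1n.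
  by rewrite PS mulnAC mulnC; have [-> _] := hst k (P k * i)%N 0%N (N0 k).
have g_near k t t' : `|t - t'| < (P k)%:R^-1 -> `|g t - g t'| < 5 * a k.
  move=> tt'; have [_ /(_ k) h1] := hg t; have [_ /(_ k) h2] := hg t'.
  have h3 := near_idx _ _ _ tt'; have [_ dk _] := hd k.
  rewrite -(subrKA (st k (idx k t))) (le_lt_trans (ler_normD _ _))//.
  have := ler_normD (st k (idx k t) - st k (idx k t')) (st k (idx k t') - g t').
  by rewrite subrKA [`|g t - _|]distrC; lra.
exists g; split.
- move=> t; apply/cvgrPdist_lt => r r0.
  have [k hk] := geometric_small (mulr_gt0 (ltr0n R 5) e00) r0.
  rewrite -mulrA -/(a k) in hk.
  apply/nbhs_normP; exists (P k)%:R^-1; first by rewrite /= invr_gt0 ltr0n.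
  by move=> t' /= /g_near h; exact: lt_trans hk.
- by move=> t; case: (hg t).
- move=> i; apply/eqP; rewrite -subr_eq0 -normr_le0; apply/ler_addgt0Pr => r r0.
  have [k hk] := geometric_small (mulr_gt0 (ltr0n R 2) e00) r0.
  have [_ /(_ k)] := hg i%:R.
  rewrite /idx -natrM natrK mulnC st_pow distrC add0r => h.
  by rewrite (le_trans h)// ltW// /a mulrA.
- move=> i t /andP[it ti].
  have [_ /(_ 0%N)] := hg t; rewrite /= /idx /P big_ord0 mulr1 /a expr0 divr1.
  have ee : e = 4 * e0 by rewrite /e0; field.
  have [_ da _] := hd 0%N; rewrite /a expr0 divr1 in da.
  have t0 : 0 <= t by rewrite (le_trans _ it).
  have /andP[t1 t2] := truncn_itv t0.
  have [->|->] : Num.truncn t = i \/ Num.truncn t = i.+1.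
    have : (i < (Num.truncn t).+1)%N by rewrite -(ltr_nat R) (le_lt_trans it).
    have : (Num.truncn t <= i.+1)%N by rewrite -(ler_nat R) (le_trans t1).
    by lia.
    by move=> h; rewrite ee; lra.
  move=> h; rewrite -(subrKA (s i.+1)) (le_lt_trans (ler_normD _ _))//.
  by have := ds i; rewrite ee; lra.
Qed.

End Paths.

(** * Loops that turn around a point *)

Section Loops.
Variable R : realType.
Local Notation V := (R * R)%type.
Implicit Types (K : set V) (p : V).

Section AngleSum.
Variable p : V.

(** The total turn around [p] along the chain [x :: l]. *)
Fixpoint angle_sum (x : V) (l : seq V) : R :=
  if l is y :: l' then arg (quot (y - p) (x - p)) + angle_sum y l' else 0.

Lemma angle_sum_cat x l1 l2 :
  angle_sum x (l1 ++ l2) = angle_sum x l1 + angle_sum (last x l1) l2.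
Proof. by elim: l1 x => [|y l1 IH] x /=; rewrite ?add0r// IH addrA. Qed.

Variables (K : set V) (d : R).
Hypothesis dK : forall x y, K x -> K y -> `|x - y| < d -> 0 < dot (x - p) (y - p).

Lemma angle_sum_rev x l : path (step K d) x l ->
  angle_sum (last x l) (rev (belast x l)) = - angle_sum x l.
Proof.
elim: l x => [|y l IH] x /=; first by rewrite oppr0.
move=> /andP[/asboolP[Kx Ky xy] pl]; rewrite rev_cons -cats1 angle_sum_cat IH//.
have -> : last (last y l) (rev (belast y l)) = y.
  by case: l {IH pl} => //= z l; rewrite rev_cons last_rcons.
by rewrite /= addr0 opprD addrC arg_quot_sym//; apply: dK; rewrite // distrC.
Qed.

Lemma is_angle_sum x l t : path (step K d) x l -> is_angle (x - p) t ->
  is_angle (last x l - p) (t + angle_sum x l).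
Proof.
elim: l x t => [|y l IH] x t /=; first by rewrite addr0.
move=> /andP[/asboolP[Kx Ky xy] pl] hx; rewrite addrA; apply: IH => //.
apply: is_angle_quotK hx; apply: arg_is_angle; apply: gt0_off_ray.
by rewrite -/(dot _ _) /=; apply: dK; rewrite // distrC.
Qed.

End AngleSum.

Lemma interval_lift (g : R -> V) (n : R) : continuous g -> 0 <= n ->
  (forall t, 0 <= t <= n -> g t != 0) ->
  exists th : R -> R, angle_lift [set t : R | 0 <= t <= n] g th.
Proof.
move=> cg n0 g0; apply: (@star_lift R R^o) => //.
- exact: itv_compact.
- move=> t k /= /andP[t0 tn] /andP[k0 k1]; rewrite -[_ *: _]/(_ * _).
  have h1 : 0 <= k * t by exact: mulr_ge0.
  have h2 : k * t <= 1 * t by rewrite ler_wpM2r.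
  by apply/andP; split=> //; lra.
- by apply: continuous_within => x _; exact: cg.
Qed.

(** If all closed chains of small steps had angle sum zero, the sum along a chain
    from [x0] would depend on its end only and define a continuous angle on [K].
    So some closed chain has a nonzero sum.  The path that [chain_path] draws
    through it stays so close to the chain that its angle changes, on each step,
    by the angle of the step. *)
Lemma essential_loop K p : compact K -> connected K -> ulc K -> ~ K p ->
  ~ (exists th, angle_lift K (fun x => x - p) th) ->
  exists (g : R -> V) (th : R -> R) (n : nat),
    [/\ continuous g, forall t, K (g t), g 0 = g n%:R, th 0 != th n%:R &
      angle_lift [set t : R | 0 <= t <= n%:R] (fun t => g t - p) th].
Proof.
move=> cK K_conn ulcK nKp nolift; apply: contrapT => noloop; apply: nolift.
have [K0|/set0P[x0 Kx0]] := eqVneq K set0.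
  by exists (fun=> 0); rewrite K0; split => //; exact: within_cst.
have [r r0 hr] : exists2 r, 0 < r & forall x, K x -> r <= `|x - p|.
  apply: (within_away0 cK (@within_subr R K p)) => x Kx.
  by apply/negP; rewrite subr_eq0 => /eqP xp; apply: nKp; rewrite -xp.
have rK x y : K x -> `|x - y| < r / 2 -> 0 < dot (x - p) (y - p).
  move=> Kx xy; apply: dot_near; rewrite opprB addrA subrK.
  by rewrite (lt_le_trans xy)// ler_pM2r ?invr_gt0//; exact: hr.
have [d' d'0 hd'] := chain_path cK ulcK (divr_gt0 r0 (ltr0n R 2)).
pose d := Num.min d' (r / 2).
have d0 : 0 < d by rewrite lt_min d'0 divr_gt0.
have dK x y : K x -> K y -> `|x - y| < d -> 0 < dot (x - p) (y - p).
  by move=> Kx _; rewrite lt_min => /andP[_]; exact: rK.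
have loop0 x l : K x -> path (step K d) x l -> last x l = x ->
    angle_sum p x l = 0.
  move=> Kx pl ll; pose s i := nth x (x :: l) i.
  have Ks i : K (s i).
    have [il|li] := leqP i (size l); last by rewrite /s nth_default.
    have : s i \in x :: l by exact: mem_nth.
    rewrite inE => /orP[/eqP ->//|]; elim: (l) {il} (x) pl => //= y l' IH z.
    by move=> /andP[/asboolP[_ Ky _] pl']; rewrite inE => /orP[/eqP ->//|]; exact: IH pl'.
  have ds i : `|s i - s i.+1| < d'.
    have [il|li] := ltnP i (size l).
      have /pathP := pl; move=> /(_ x i il) /asboolP[_ _].
      by rewrite lt_min => /andP[].
    have -> : s i.+1 = x by rewrite /s nth_default.
    suff -> : s i = x by rewrite subrr normr0.
    move: li; rewrite leq_eqVlt => /orP[/eqP e1|li]; last by rewrite /s nth_default.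
    by rewrite /s -e1 nth_last.
  have [|g [cg Kg gs ge]] := hd' s Ks ds.
    by exists (size l).+1 => i li; rewrite /s !nth_default.
  have [|t _|th hth] := @interval_lift (fun t => g t - p) (size l)%:R _ (ler0n _ _).
  - by move=> t; apply: cvgB; [exact: cg|exact: cvg_cst].
  - by apply/negP; rewrite subr_eq0 => /eqP gp; apply: nKp; rewrite -gp.
  have th_step i : (i < size l)%N ->
      th i.+1%:R - th i%:R = arg (quot (s i.+1 - p) (s i - p)).
    move=> il; have iS : i%:R <= i.+1%:R :> R by rewrite ler_nat.
    have sub : [set t : R | i%:R <= t <= i.+1%:R] `<=` [set t : R | 0 <= t <= (size l)%:R].
      move=> t /= /andP[h1 h2]; rewrite (le_trans _ h1) ?ler0n//=.
      by rewrite (le_trans h2)// ler_nat.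
    have conI : connected [set t : R | i%:R <= t <= i.+1%:R].
      by apply/connected_intervalP => a b /= /andP[? ?] /andP[? ?] z /andP[? ?];
        apply/andP; split; lra.
    have dots t : i%:R <= t <= i.+1%:R -> 0 < dot (g t - p) (s i - p).
      move=> ti; rewrite dotC; apply: rK; [exact: Ks|exact: ge].
    have l1 : angle_lift [set t : R | i%:R <= t <= i.+1%:R] (fun t => g t - p) th.
      by split; [exact: continuous_subspaceW sub (proj1 hth)|move=> t /sub; exact: (proj2 hth)].
    have l2 : angle_lift [set t : R | i%:R <= t <= i.+1%:R] (fun t => g t - p)
        (fun t => th i%:R + arg (quot (g t - p) (s i - p))).
      split.
        apply: withinD; first exact: within_cst.
        apply: within_arg; last by move=> t /dots; exact: off_ray_quot.
        apply: within_quot; last exact: within_cst.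
        apply: withinB; last exact: within_cst.
        by apply: continuous_within => t _; exact: cg.
      move=> t ti; apply: (@is_angle_quotK _ _ (s i - p)).
        by apply/arg_is_angle/gt0_off_ray; exact: dots.
      by rewrite -gs; apply: (proj2 hth); apply: sub; rewrite /= lexx iS.
    have := lift_connected conI l1 l2 (_ : i%:R <= i%:R <= i.+1%:R)
      (_ : i%:R <= i.+1%:R <= i.+1%:R).
    rewrite !lexx iS /= !gs => /(_ isT isT).
    rewrite (@arg_quot_self R (s i - p)); last by rewrite -{1}(gs i); apply: dots; rewrite lexx iS.
    by lra.
  have : th 0 = th (size l)%:R.
    apply/eqP/negPn/negP => nth0; apply: noloop; exists g, th, (size l); split => //.
    by rewrite gs (gs 0%N) /s nth_last /= ll.
  suff sumE k : (k <= size l)%N -> angle_sum p x (take k l) = th k%:R - th 0.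
    by move=> e0; rewrite -(take_size l) sumE// -e0 subrr.
  elim: k => [_|k IH kl]; first by rewrite take0 subrr.
  rewrite (take_nth x kl) -cats1 angle_sum_cat IH ?(ltnW kl)//= addr0.
  have -> : last x (take k l) = s k.
    rewrite /s (last_nth x) size_take kl; case: k kl {IH} => //= k kl.
    by rewrite nth_take.
  by have := th_step k kl; rewrite {1}/s /= => <-; ring.
have step_sym x y : step K d x y = step K d y x.
  by apply/asboolP/asboolP => -[? ? ?]; split; rewrite // distrC.
(* Going along [l1] and returning along [l2] is a closed chain. *)
have uniq z l1 l2 : path (step K d) x0 l1 -> path (step K d) x0 l2 ->
    last x0 l1 = z -> last x0 l2 = z -> angle_sum p x0 l1 = angle_sum p x0 l2.
  move=> p1 p2 e1 e2; have := angle_sum_rev dK p2.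
  have := loop0 x0 (l1 ++ rev (belast x0 l2)) Kx0.
  rewrite cat_path p1 angle_sum_cat last_cat e1 -e2 rev_path.
  have -> : path (fun a b => step K d b a) x0 l2.
    by rewrite (eq_path (e' := step K d)).
  case: (l2) => [|y l'] /=; first by move=> /(_ isT erefl) + _; rewrite addr0.
  rewrite rev_cons last_rcons => /(_ isT erefl) + e3; rewrite e3.
  by move/eqP; rewrite subr_eq0 => /eqP.
have /choice[ch hch] : forall z, exists l, K z -> path (step K d) x0 l /\ last x0 l = z.
  move=> z; have [Kz|] := pselect (K z); last by exists [::].
  by have [l pl ll] := connected_chain K_conn d0 Kx0 Kz; exists l.
have x0p : x0 - p != 0.
  by rewrite subr_eq0; apply/eqP => xp; apply: nKp; rewrite -xp.
have [t0 ht0] := is_angle_ex x0p.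
exists (fun z => t0 + angle_sum p x0 (ch z)); split; last first.
  move=> z Kz; have [pz lz] := hch z Kz.
  by have := is_angle_sum dK pz ht0; rewrite lz.
have near z z' : K z -> K z' -> `|z - z'| < d ->
    angle_sum p x0 (ch z') = angle_sum p x0 (ch z) + arg (quot (z' - p) (z - p)).
  move=> Kz Kz' zz'; have [pz lz] := hch z Kz; have [pz' lz'] := hch z' Kz'.
  rewrite (uniq z' (ch z') (rcons (ch z) z'))// ?last_rcons//; last first.
    by rewrite rcons_path pz lz; apply/asboolP.
  by rewrite -cats1 angle_sum_cat lz /= addr0.
apply/within_continuousP => z Kz e e0.
have ca : {within K `&` ball z d, continuous (fun z' => arg (quot (z' - p) (z - p)))}.
  apply: within_arg; last first.
    move=> z' [Kz' zz']; apply/gt0_off_ray; rewrite -/(dot _ _) /=.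
    by apply: dK; rewrite // distrC; move: zz'; rewrite -ball_normE.
  by apply: within_quot; [exact: within_subr|exact: within_cst].
have /within_continuousP /(_ z (conj Kz (ballxx _ d0)) e e0) [d1 d10 h] := ca.
exists (Num.min d d1); first by rewrite lt_min d0.
move=> y Ky; rewrite lt_min => /andP[zy1 zy2].
rewrite (near z y Kz Ky zy1).
have yB : ball z d y by rewrite -ball_normE.
have := h y (conj Ky yB) zy2; rewrite (@arg_quot_self R (z - p)); last first.
  by apply: (dK z z) => //; rewrite subrr normr0.
by rewrite sub0r => h1; rewrite addrA opprD addrA subrr sub0r.
Qed.

End Loops.

(** * Arcs inside paths *)

Section Arcs.
Variable R : realType.

Lemma last_point (M : set R) (s u : R) : closed M -> M s -> s <= u ->
  exists s', [/\ s <= s' <= u, M s' & forall x, s' < x <= u -> ~ M x].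
Proof.
move=> clM Ms su; pose S := [set x | s <= x <= u /\ M x].
have S0 : S !=set0 by exists s; rewrite /S /= lexx su.
have Sub : ubound S u by move=> x [/andP[]].
have hS : has_sup S by split => //; exists u.
have sS : s <= sup S by apply: sup_upper_bound => //; rewrite /S /= lexx su.
have Su : sup S <= u by exact: ge_sup.
exists (sup S); split; first by rewrite sS.
  have : closure S (sup S) by apply: closure_sup => //; exists u.
  have clS : closed S.
    have -> : S = `[s, u]%classic `&` M.
      by apply/seteqP; split=> x; rewrite /= in_itv.
    by apply: closedI => //; exact: interval_closed.
  by move=> /clS[].
move=> x /andP[sx xu] Mx.
have : x <= sup S by apply: sup_upper_bound => //; split => //; rewrite xu (le_trans sS (ltW sx)).
by rewrite leNgt sx.
Qed.

Lemma first_point (M : set R) (u t : R) : closed M -> M t -> u <= t ->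
  exists t', [/\ u <= t' <= t, M t' & forall x, u <= x < t' -> ~ M x].
Proof.
move=> clM Mt ut; have clM' : closed [set x | M (- x)].
  have cN : continuous (fun x : R => - x) by move=> x; apply: cvgN; exact: cvg_id.
  by have /continuous_closedP := cN; apply.
have MNt : [set x | M (- x)] (- t) by rewrite /= opprK.
have tu : - t <= - u by rewrite lerN2.
have [t' [/andP[h1 h2] Mt' ht']] := last_point clM' MNt tu.
exists (- t'); split => //; first by rewrite lerNr h2 lerNl h1.
move=> x /andP[ux xt'] Mx; apply: (ht' (- x)).
  by rewrite ltrNr xt' lerN2.
by rewrite /= opprK.
Qed.

(** For a chain of open sets, a finite subcover has a largest member. *)
Lemma compact_chain (T : topologicalType) (A : set T) (F : set (set T)) :
  compact A -> F !=set0 -> total_on F subset -> (forall W, F W -> open W) ->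
  A `<=` \bigcup_(W in F) W -> exists2 W, F W & A `<=` W.
Proof.
move=> cA [W0 FW0] tot oF AF.
pose G := filter_from F (fun W => [set W' | F W' /\ W `<=` W']).
have GF : Filter G.
  apply: filter_from_filter; first by exists W0.
  move=> W1 W2 F1 F2; have [h|h] := tot _ _ F1 F2.
    by exists W2 => // W [FW W2W]; split; split => //; exact: subset_trans W2W.
  by exists W1 => // W [FW W1W]; split; split => //; exact: subset_trans W1W.
move: cA; rewrite compact_near_coveringP => cA.
have : \forall W \near G, A `<=` (fun x => W x).
  apply: cA => x /AF[W FW Wx].
  exists (W, [set W' | F W' /\ W `<=` W']); last first.
    by move=> [x' W'] /= [Wx' [_ WW']]; exact: WW'.
  split => /=; first by apply: open_nbhs_nbhs; split => //; exact: oF.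
  by exists W.
by case=> W FW hW; exists W => //; apply: hW; split.
Qed.

(** Remove from the time interval a maximal open set [W] such that [h] has equal
    values at the two ends of each gap.  By maximality, remaining times with
    equal values of [h] are the two ends of a gap.  Such sets are closed under
    unions of chains: slightly inside a gap of the union, compactness
    finds a single member of the chain, one of whose gaps has its ends near those
    of the given gap. *)
Lemma irreducible_path (V : normedModType R) (h : R -> V) (n : R) :
  continuous h -> 0 <= n -> exists W : set R,
  [/\ open W, W `<=` [set x | 0 < x < n],
   forall s t, 0 <= s -> s < t -> t <= n -> ~ W s -> ~ W t ->
     (forall x, s < x < t -> W x) -> h s = h t &
   forall s t, 0 <= s -> s < t -> t <= n -> ~ W s -> ~ W t -> h s = h t ->
     forall x, s < x < t -> W x].
Proof.
move=> ch n0.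
pose P (W : set R) := [/\ open W, W `<=` [set x | 0 < x < n] &
   forall s t, 0 <= s -> s < t -> t <= n -> ~ W s -> ~ W t ->
     (forall x, s < x < t -> W x) -> h s = h t].
have [|W [[oW sW gW] maxW]] := @Zorn_bigcup R P.
  move=> F FP tot; split.
  - by apply: bigcup_open => W /FP[].
  - by move=> x [W /FP[_ sW _] /sW].
  move=> s t s0 st tn nWs nWt gap; apply/eqP/negPn/negP => hst.
  pose e := `|h s - h t| / 2.
  have e0 : 0 < e by rewrite divr_gt0// normr_gt0 subr_eq0.
  have /cvgrPdist_lt /(_ e e0) /nbhs_normP[d1 /= d10 hd1] := ch s.
  have /cvgrPdist_lt /(_ e e0) /nbhs_normP[d2 /= d20 hd2] := ch t.
  pose d := Num.min (Num.min d1 d2) (t - s) / 3.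
  have dm : 0 < Num.min (Num.min d1 d2) (t - s) by rewrite !lt_min d10 d20 subr_gt0.
  have d0 : 0 < d by rewrite divr_gt0.
  have [dd1 dd2 dts] : [/\ 3 * d <= d1, 3 * d <= d2 & 3 * d <= t - s].
    by rewrite /d mulrC mulfVK// !ge_min !lexx ?orbT.
  have [W FW IW] : exists2 W, F W & `[s + d, t - d]%classic `<=` W.
    apply: compact_chain => //; first exact: segment_compact.
    - have [|W FW _] := gap (s + d); last by exists W.
      by apply/andP; split; lra.
    - by move=> W /FP[].
    - move=> x /=; rewrite in_itv /= => /andP[? ?]; apply: gap.
      by apply/andP; split; lra.
  have [oW sW gW] := FP _ FW.
  have clW : closed (~` W) by exact: open_closedC.
  have nW x : ~ (\bigcup_(W in F) W) x -> (~` W) x by move=> nx Wx; apply: nx; exists W.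
  have [|s' [/andP[s1 s2] Ws' ls']] := last_point clW (nW _ nWs) (_ : s <= s + d); first by lra.
  have [|t' [/andP[t1 t2] Wt' lt']] := first_point clW (nW _ nWt) (_ : t - d <= t); first by lra.
  have e1 : h s' = h t'.
    apply: gW => //; [exact: le_trans s1|lra|exact: le_trans tn|].
    move=> x /andP[xs xt]; apply: contrapT => nWx.
    have [x1|x1] := leP x (s + d); first by apply: (ls' x) => //; rewrite xs.
    have [x2|x2] := leP (t - d) x; first by apply: (lt' x) => //; rewrite x2.
    by apply: nWx; apply: IW; rewrite /= in_itv /= !ltW.
  have h1 : `|h s - h s'| < e by apply: hd1 => /=; rewrite distrC ger0_norm; lra.
  have h2 : `|h t - h t'| < e by apply: hd2 => /=; rewrite ger0_norm; lra.
  rewrite e1 in h1; have := ler_normD (h s - h t') (h t' - h t).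
  rewrite subrKA [`|h t' - _|]distrC.
  by have : `|h s - h t| = e + e; [rewrite /e; field|lra].
(* If the values at [s] and [t] agree, the whole interval may be removed too. *)
exists W; split => // s t s0 st tn nWs nWt hst x xst.
apply: contrapT => nWx; apply: (maxW (W `|` [set x | s < x < t])).
  split; first by move=> y Wy; left.
  by move=> /(_ x) h1; apply: nWx; apply: h1; right.
split.
- apply: openU => //.
  have -> : [set x | s < x < t] = `]s, t[%classic.
    by apply/seteqP; split=> y; rewrite /= in_itv.
  exact: interval_open.
- by move=> y [/sW//|/= /andP[? ?]]; apply/andP; split; lra.
move=> a b a0 ab bn na nb gap.
have [na1 na2] : ~ W a /\ ~ (s < a < t) by split=> ?; apply: na; [left|right].
have [nb1 nb2] : ~ W b /\ ~ (s < b < t) by split=> ?; apply: nb; [left|right].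
have inner y : a < y < b -> ~ W y -> s < y < t.
  by move=> yab nWy; case: (gap y yab).
have [[sb at_]|dis] := pselect (s < b /\ a < t); last first.
  apply: gW => // y yab; apply: contrapT => nWy.
  have /andP[? ?] := inner y yab nWy; apply: dis.
  by have /andP[? ?] := yab; split; lra.
have as_ : a <= s by rewrite leNgt; apply/negP => ?; apply: na2; apply/andP.
have tb : t <= b by rewrite leNgt; apply/negP => ?; apply: nb2; apply/andP.
have -> : a = s.
  apply/eqP; rewrite eq_le as_ leNgt; apply/negP => ?.
  have asb : a < s < b by apply/andP.
  by have := inner s asb nWs; rewrite ltxx.
have -> // : b = t.
apply/eqP; rewrite eq_le tb andbT leNgt; apply/negP => ?.
have atb : a < t < b by apply/andP.
by have := inner t atb nWt; rewrite ltxx andbF.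
Qed.

(** The series of the [E i / 2 ^+ i]: it is continuous where all terms are, and
    strictly monotone as soon as one term is. *)
Lemma weighted_sum (E : nat -> R -> R) (B : R) : 0 < B ->
  (forall i t, 0 <= E i t <= B) -> exists F : R -> R,
  (forall (A : set R), (forall i, {within A, continuous (E i)}) ->
    {within A, continuous F}) /\
  (forall s t, (forall i, E i s <= E i t) ->
    F s <= F t /\ ((exists i, E i s < E i t) -> F s < F t)).
Proof.
move=> B0 EB.
pose u (t : R) (k : nat) : R := \sum_(i < k) E i t / 2 ^+ i.
have uS t k : u t k.+1 = u t k + E k t / 2 ^+ k by rewrite /u big_ord_recr.
have p2 k : 0 < 2 ^+ k :> R by rewrite exprn_gt0.
have utail t k j : u t k <= u t (k + j)%N <= u t k + 2 * (B / 2 ^+ k).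
  suff : u t k <= u t (k + j)%N <= u t k + 2 * (B / 2 ^+ k) - 2 * (B / 2 ^+ (k + j)).
    move=> /andP[-> h]; rewrite (le_trans h)// gerBl mulr_ge0// divr_ge0 ?ltW//.
  elim: j => [|j /andP[h1 h2]]; first by rewrite addn0 lexx addrK lexx.
  have /andP[E0 E1] := EB (k + j)%N t.
  have b0 : 0 <= E (k + j)%N t / 2 ^+ (k + j) by rewrite divr_ge0// ltW.
  have b1 : E (k + j)%N t / 2 ^+ (k + j) <= B / 2 ^+ (k + j).
    by rewrite ler_pM2r// invr_gt0.
  have b2 : 2 * (B / 2 ^+ (k + j).+1) = B / 2 ^+ (k + j).
    by rewrite exprS; field; rewrite gt_eqF.
  by rewrite addnS uS b2; apply/andP; split; lra.
have ucvg t : cvgn (u t).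
  apply: nondecreasing_is_cvgn.
    by apply/nondecreasing_seqP => k; rewrite -addn1; case/andP: (utail t k 1%N).
  exists (u t 0%N + 2 * (B / 2 ^+ 0)) => _ [k _ <-].
  by case/andP: (utail t 0%N k).
pose F t := limn (u t).
have Fu t k : u t k <= F t <= u t k + 2 * (B / 2 ^+ k).
  apply/andP; split.
    apply: limr_ge; first exact: ucvg.
    by exists k => // j /= kj; rewrite -(subnKC kj); case/andP: (utail t k (j - k)%N).
  apply: limr_le; first exact: ucvg.
  by exists k => // j /= kj; rewrite -(subnKC kj); case/andP: (utail t k (j - k)%N).
exists F; split.
  move=> A cE; apply: (proj2 (@within_continuousP R R^o R^o A F)) => x Ax e e0.
  have [k hk] := geometric_small (mulr_gt0 (ltr0n R 2) B0) (divr_gt0 e0 (ltr0n R 4)).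
  rewrite -mulrA in hk.
  have cu : {within A, continuous (fun t => u t k)}.
    rewrite /u; elim: (k) => [|j IH].
      by apply: (@within_ext _ _ A (fun=> 0 : R)); [move=> y _; rewrite big_ord0|exact: within_cst].
    apply: (@within_ext _ _ A (fun t => u t j + E j t / 2 ^+ j : R)).
      by move=> y _; rewrite big_ord_recr.
    by apply: withinD => //; apply: withinM => //; exact: within_cst.
  have e2 : 0 < e / 2 by rewrite divr_gt0.
  have [d d0 hd] := proj1 (@within_continuousP R R^o R^o A _) cu x Ax _ e2.
  exists d => // y Ay xy; have := hd y Ay xy.
  have /andP[? ?] := Fu x k; have /andP[? ?] := Fu y k.
  by rewrite !ltr_norml => /andP[? ?]; apply/andP; split; lra.
move=> s t Est.
have ud k j : u t k - u s k <= u t (k + j)%N - u s (k + j)%N.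
  elim: j => [|j IH]; first by rewrite addn0.
  rewrite addnS !uS; have : E (k + j)%N s / 2 ^+ (k + j) <= E (k + j)%N t / 2 ^+ (k + j).
    by rewrite ler_pM2r// invr_gt0.
  by lra.
have Fd k : u t k - u s k <= F t - F s.
  rewrite -limB; [|exact: ucvg|exact: ucvg]; apply: limr_ge.
    by apply: is_cvgB; exact: ucvg.
  by exists k => // j /= kj; rewrite -(subnKC kj); exact: ud.
split; first by have := Fd 0%N; rewrite /u !big_ord0 subrr subr_ge0.
move=> [i Ei]; have := Fd i.+1; have := ud 0%N i; rewrite add0n !uS.
have : E i s / 2 ^+ i < E i t / 2 ^+ i by rewrite ltr_pM2r// invr_gt0.
by rewrite {1 2}/u !big_ord0; lra.
Qed.

(** Pausing at the last remaining time over each gap of the irreducible set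
    makes the path continuous, as the values at the ends of a gap agree.  It then
    repeats a value only by standing still. *)
Lemma monotone_path (V : normedModType R) (h : R -> V) (n : R) :
  continuous h -> 0 <= n -> exists k : R -> V,
  [/\ {within [set t : R | 0 <= t <= n], continuous k}, k 0 = h 0, k n = h n,
    forall t, 0 <= t <= n -> exists2 u, 0 <= u <= n & k t = h u &
    forall s t u, 0 <= s -> s <= u <= t -> t <= n -> k s = k t -> k u = k s].
Proof.
move=> ch n0; have [W [oW sW gap1 gap2]] := irreducible_path ch n0.
have clM : closed (~` W) by exact: open_closedC.
have M0 : (~` W) 0 by move=> /sW /=; rewrite ltxx.
have Mn : (~` W) n by move=> /sW /=; rewrite ltxx andbF.
have /choice[l hl] : forall t, exists s : R, 0 <= t ->
    [/\ 0 <= s <= t, ~ W s & forall x, s < x <= t -> W x].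
  move=> t; have [t0|t0] := leP 0 t; last by exists 0 => ?; exfalso; lra.
  have [s [h1 h2 h3]] := last_point clM M0 t0; exists s => _; split => // x /h3.
  by move/contrapT.
have lM t : 0 <= t -> ~ W t -> l t = t.
  move=> t0 Wt; have [/andP[_ lt_] _ h3] := hl t t0.
  by apply/eqP; rewrite eq_le lt_ leNgt; apply/negP => ?; apply/Wt/h3; apply/andP.
have lmono s t : 0 <= s -> s <= t -> l s <= l t.
  move=> s0 st; have [/andP[s1 s2] Ws hs] := hl s s0.
  have [/andP[t1 t2] Wt ht] := hl t (le_trans s0 st).
  by rewrite leNgt; apply/negP => ts; apply: Ws; apply: ht; rewrite ts (le_trans s2).
exists (h \o l); split => /=.
- apply/within_continuousP => x Ax e e0.
  have [d d0 hd] := uniform_within (V := R^o) (@itv_compact R n)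
    (continuous_within (fun t _ => ch t)) e0.
  exists d => //.
  suff H s t : 0 <= s -> s <= t -> t <= n -> t - s < d -> `|h (l s) - h (l t)| < e.
    move=> y /= /andP[y0 yn] xy; have /andP[x0 xn] := Ax.
    have [le|/ltW le] := leP x y.
      by apply: H => //; move: xy; rewrite distrC ger0_norm ?subr_ge0.
    by rewrite distrC; apply: H => //; move: xy; rewrite ger0_norm ?subr_ge0.
  move=> s0 st tn std; have [/andP[s1 s2] Ws hs] := hl s s0.
  have [/andP[t1 t2] Wt ht] := hl t (le_trans s0 st).
  have [lts|slt] := leP (l t) s.
    suff -> : l t = l s by rewrite subrr normr0.
    apply/eqP; rewrite eq_le (lmono s t s0 st) andbT leNgt; apply/negP => h1.
    by apply: Wt; apply: hs; rewrite h1.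
  have [r [/andP[r1 r2] Wr hr]] := first_point clM Wt (ltW slt).
  have -> : h (l s) = h r.
    have [->//|lr] := eqVneq (l s) r.
    apply: gap1 => //; [by rewrite lt_neqAle lr (le_trans s2)|exact: le_trans (le_trans t2 tn)|].
    move=> y /andP[y1 y2]; have [ys|sy] := leP y s; first by apply: hs; rewrite y1.
    by apply: contrapT; apply: hr; rewrite (ltW sy).
  apply: hd => /=; [by rewrite (le_trans s0)//= (le_trans r2)// (le_trans t2)|
    by rewrite t1 (le_trans t2)|].
  by rewrite distrC ger0_norm ?subr_ge0//; lra.
- by rewrite lM.
- by rewrite lM.
- move=> t /andP[t0 tn]; exists (l t) => //; have [/andP[h1 h2] _ _] := hl t t0.
  by rewrite h1 (le_trans h2).
move=> s t u s0 /andP[su ut] tn hst.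
have u0 := le_trans s0 su; have t0 := le_trans u0 ut.
have l1 := lmono _ _ s0 su; have l2 := lmono _ _ u0 ut.
have [e1|n1] := eqVneq (l s) (l u); first by rewrite e1.
have [e2|n2] := eqVneq (l u) (l t); first by rewrite e2.
have [/andP[s1 s2] Ws _] := hl s s0; have [/andP[t1 t2] Wt _] := hl t t0.
have [_ Wu _] := hl u u0; exfalso; apply: Wu.
apply: (gap2 (l s) (l t)) => //; last by rewrite !lt_neqAle n1 n2 l1.
  by rewrite (@lt_le_trans _ _ (l u))// lt_neqAle n1.
exact: le_trans tn.
Qed.

(** [E t] is the least distance to [c] up to time [t]. *)
Lemma running_min (V : normedModType R) (k : R -> V) (n : R) (c : V) :
  {within [set t : R | 0 <= t <= n], continuous k} -> 0 <= n ->
  exists E : R -> R, [/\ {within [set t : R | 0 <= t <= n], continuous E},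
    forall t, 0 <= t <= n -> 0 <= E t,
    forall u t, 0 <= u -> u <= t -> t <= n -> E t <= `|k u - c| &
    forall t b, 0 <= t <= n -> (forall u, 0 <= u <= t -> b <= `|k u - c|) -> b <= E t].
Proof.
move=> ck n0; pose S t := [set `|k u - c| | u in [set u : R | 0 <= u <= t]].
pose E t := inf (S t).
have S0 t : 0 <= t -> S t !=set0 by move=> t0; exists `|k 0 - c|, 0 => //=; rewrite lexx.
have lbS t : lbound (S t) 0 by move=> _ [u _ <-].
have E_le u t : 0 <= u -> u <= t -> E t <= `|k u - c|.
  move=> u0 ut; apply: ge_inf; first by exists 0.
  by exists u => //=; rewrite u0.
have E_ge t b : 0 <= t -> (forall u, 0 <= u <= t -> b <= `|k u - c|) -> b <= E t.
  move=> t0 hb; apply: lb_le_inf; first exact: S0.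
  by move=> _ [u /= hu <-]; exact: hb.
exists E; split.
- apply: (proj2 (@within_continuousP R R^o R^o _ E)) => x Ax e e0.
  have e2 : 0 < e / 2 by rewrite divr_gt0.
  have [d d0 hd] := uniform_within (V := R^o) (@itv_compact R n) ck e2.
  exists d => //.
  suff H s t : 0 <= s -> s <= t -> t <= n -> t - s < d -> `|E s - E t| < e.
    move=> y /= /andP[y0 yn] xy; have /andP[x0 xn] := Ax.
    have [le|/ltW le] := leP x y.
      by apply: H => //; move: xy; rewrite distrC ger0_norm ?subr_ge0.
    by rewrite distrC; apply: H => //; move: xy; rewrite ger0_norm ?subr_ge0.
  move=> s0 st tn std.
  have h1 : E t <= E s.
    by apply: E_ge => // u /andP[u0 us]; apply: E_le => //; exact: le_trans st.
  have h2 : E s - e / 2 <= E t.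
    apply: E_ge; first exact: le_trans st.
    move=> u /andP[u0 ut]; have [us|su] := leP u s.
      by have := E_le _ _ u0 us; lra.
    have := E_le _ _ s0 (lexx s).
    have : `|k s - k u| < e / 2.
      apply: hd => /=; [by rewrite s0 (le_trans st)|by rewrite u0 (le_trans ut)|].
      by rewrite distrC ger0_norm; lra.
    by have := ler_normD (k s - k u) (k u - c); rewrite subrKA; lra.
  by rewrite ger0_norm ?subr_ge0//; lra.
- by move=> t /andP[t0 _]; apply: E_ge => // u _.
- by move=> u t u0 ut _; exact: E_le.
- by move=> t b /andP[t0 _]; exact: E_ge.
Qed.

(** After [monotone_path] it remains to remove the pauses, which takes a
    continuous monotone function of time that is constant exactly on them.  For
    each rational time [q] the running minimum of the distance to [k q] decreases
    with time; it is constant during a pause, and if [k] moves then it drops for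
    some [q] close to the later time.  The weighted sum [F] of these minima,
    rescaled, is the new parameter. *)
Lemma path_arc (V : normedModType R) (h : R -> V) (n : R) :
  continuous h -> 0 <= n -> h 0 != h n ->
  exists e : R -> V, [/\ {within @itv01 R, continuous e}, e 0 = h 0, e 1 = h n,
    forall s t, itv01 s -> itv01 t -> e s = e t -> s = t &
    forall t, itv01 t -> exists2 u, 0 <= u <= n & e t = h u].
Proof.
move=> ch n0 h0n.
have [k [ck k0 kn kh kconst]] := monotone_path ch n0.
pose I := [set t : R | 0 <= t <= n].
have I0 : I 0 by rewrite /I /= lexx.
have In : I n by rewrite /I /= lexx n0.
have [B B0 hB] : exists2 B : R, 0 < B & forall t, I t -> `|k t| < B.
  have [B B0 hB] := ex_strict_bound_gt0 (compact_bounded (continuous_compact ck (@itv_compact R n))).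
  by exists B => // t It; apply: hB; exists t.
(* An enumeration of the rationals between [0] and [n]; any other index gives [0]. *)
pose q (i : nat) : R := let r : R := if unpickle i is Some r then ratr (r : rat) else 0 in
  if 0 <= r <= n then r else 0.
have Iq i : I (q i) by rewrite /q /I /=; case: ifP => //; rewrite lexx.
have /choice[E hE] := fun i => running_min (k (q i)) ck n0.
pose cl (t : R) := Num.max 0 (Num.min n t).
have clI t : I (cl t) by rewrite /cl /I /= le_max lexx /= ge_max n0 ge_min lexx.
have clE t : I t -> cl t = t.
  by move=> /andP[t0 tn]; rewrite /cl min_r// max_r.
have B2 : 0 < B + B by rewrite addr_gt0.
have [|F [cF monoF]] := @weighted_sum (fun i t => E i (cl t)) (B + B) B2.
  move=> i t; have [_ E0 Ele _] := hE i; rewrite E0 /=; last exact: clI.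
  have /andP[c0 cn] := clI t.
  rewrite (le_trans (Ele 0 _ (lexx _) c0 cn))// (le_trans (ler_normB _ _))//.
  by rewrite lerD// ltW// hB.
have Eanti i s t : 0 <= s -> s <= t -> t <= n -> E i (cl t) <= E i (cl s).
  move=> s0 st tn; have [_ _ Ele Ege] := hE i.
  have Is : I s by rewrite /I /= s0 (le_trans st).
  have It : I t by rewrite /I /= (le_trans s0 st).
  rewrite !clE//; apply: Ege => // u /andP[u0 us].
  by apply: Ele => //; exact: le_trans st.
have Fanti s t : 0 <= s -> s <= t -> t <= n -> F t <= F s.
  by move=> s0 st tn; apply: (proj1 (monoF t s _)) => i; exact: Eanti.
have F_eq s t : 0 <= s -> s <= t -> t <= n -> k s = k t -> F s = F t.
  move=> s0 st tn kst; apply/eqP; rewrite eq_le (Fanti s t)// andbT.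
  apply: (proj1 (monoF s t _)) => i; have [_ _ Ele Ege] := hE i.
  have Is : I s by rewrite /I /= s0 (le_trans st).
  have It : I t by rewrite /I /= (le_trans s0 st).
  rewrite !clE//; apply: Ege => // u /andP[u0 ut].
  have [us|/ltW su] := leP u s; first by apply: Ele => //; exact: le_trans tn.
  have -> : k u = k s by apply: (kconst s t) => //; rewrite su.
  by apply: Ele => //; exact: le_trans tn.
(* Up to time [s] the path stays at distance at least [m] from [k t].  For a
   rational [r] just before [t], the distance to [k r] is at least [2 * m / 3]
   until [s], and at most [m / 3] at [t]. *)
have F_lt s t : 0 <= s -> s < t -> t <= n -> k s != k t -> F t < F s.
  move=> s0 st tn kst; apply: (proj2 (monoF t s (fun i => Eanti i s t s0 (ltW st) tn))).
  have Is : I s by rewrite /I /= s0 (le_trans (ltW st)).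
  have It : I t by rewrite /I /= (le_trans s0 (ltW st)).
  have [||m m0 hm] := @within_away0 R R^o V [set u : R | 0 <= u <= s]
      (fun u => k u - k t) (@itv_compact R s) _.
  - apply: withinB; last exact: within_cst.
    by apply: continuous_subspaceW ck => u /= /andP[-> us]; rewrite (le_trans us)// (le_trans (ltW st)).
  - move=> u /andP[u0 us]; rewrite subr_eq0; apply: contra_neq kst => kut.
    by rewrite -kut; apply: (kconst u t) => //; rewrite us ltW.
  have m3 : 0 < m / 3 by rewrite divr_gt0.
  have [d d0 hd] := proj1 (@within_continuousP R R^o V I k) ck t It _ m3.
  have [r] : exists r : rat, ratr r \in `]Num.max 0 (t - d), t[.
    apply: rat_in_itvoo; rewrite gt_max (le_lt_trans s0 st) /=; lra.
  rewrite in_itv /= gt_max => /andP[/andP[r0 r1] r2].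
  exists (pickle r); have [_ _ Ele Ege] := hE (pickle r).
  have qr : q (pickle r) = ratr r.
    by rewrite /q pickleK (ltW r0) (le_trans (ltW r2)).
  have Ir : I (ratr r) by rewrite /I /= (ltW r0) (le_trans (ltW r2)).
  have kd : `|k t - k (ratr r)| < m / 3.
    by apply: hd => //; rewrite ger0_norm; lra.
  rewrite !clE//; apply: (@le_lt_trans _ _ (m / 3)).
    apply: le_trans (ltW kd); rewrite -qr; apply: Ele => //.
    by case/andP: It.
  apply: (@lt_le_trans _ _ (m - m / 3)); first by lra.
  apply: Ege => // u /hm mu; rewrite qr.
  have := ler_normD (k u - k (ratr r)) (k (ratr r) - k t).
  by rewrite subrKA [`|k (ratr r) - _|]distrC; lra.
have cFI : {within I, continuous F}.
  apply: cF => i; apply: (@within_ext _ _ I (E i)); last by case: (hE i).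
  by move=> t It; rewrite clE.
have Fn : F n < F 0.
  have [n_0|n_n0] := eqVneq n 0; first by move: h0n; rewrite n_0 eqxx.
  by apply: F_lt; rewrite ?lt_neqAle ?n0 1?eq_sym ?n_n0 ?k0 ?kn// eq_sym.
pose c : R := F 0 - F n.
have c0 : 0 < c by rewrite subr_gt0.
pose phi (t : R) : R := (F 0 - F t) / c.
have cphi : {within I, continuous phi}.
  by apply: withinM; [apply: withinB => //|]; exact: within_cst.
have phi0 : phi 0 = 0 by rewrite /phi subrr mul0r.
have phin : phi n = 1 by rewrite /phi divff ?gt_eqF.
have phi_k s t : I s -> I t -> phi s = phi t <-> k s = k t.
  move=> Is It; have phiF : phi s = phi t <-> F s = F t.
    rewrite /phi; split=> [|-> //]; move/(mulIf (invr_neq0 (lt0r_neq0 c0))).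
    by lra.
  rewrite phiF; have /andP[s0 sn] := Is; have /andP[t0 tn] := It.
  split=> [FF|kk].
    apply/eqP/negPn/negP => kst; have [st|ts|e1] := ltgtP s t.
    - by have := F_lt s t s0 st tn kst; rewrite FF ltxx.
    - by have := F_lt t s t0 ts sn; rewrite eq_sym FF ltxx => /(_ kst).
    - by move: kst; rewrite e1 eqxx.
  have [st|/ltW ts] := leP s t; first exact: F_eq.
  by apply/esym; apply: F_eq.
have [|e ce he] := within_quotient (@Rhausdorff R) (@itv_compact R n) cphi ck.
  by move=> s t Is It /(proj1 (phi_k s t Is It)).
have surj y : itv01 y -> exists2 t, I t & phi t = y.
  move=> /andP[y0 y1].
  have /connected_intervalP iphi := connected_continuous_connected (@itv_connected R n) cphi.
  by have [|||t It <-] := iphi 0 1 _ _ y; [exists 0|exists n|rewrite y0|exists t].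
have ephi t : I t -> e (phi t) = k t by exact: he.
exists e; split.
- by apply: continuous_subspaceW ce => y /surj[t It <-]; exists t.
- by have := ephi 0 I0; rewrite phi0 k0.
- by have := ephi n In; rewrite phin kn.
- move=> s t /surj[s' Is <-] /surj[t' It <-]; rewrite !ephi//.
  by move/(proj2 (phi_k _ _ Is It)).
- by move=> t /surj[t' It <-]; rewrite ephi//; exact: kh.
Qed.

End Arcs.

(** * Simple loops turn once *)

Section SimpleLoops.
Variable R : realType.
Local Notation V := (R * R)%type.
Local Notation I := (@itv01 R).

Lemma itv01_0 : I 0. Proof. by rewrite /itv01 /= lexx ler01. Qed.
Lemma itv01_1 : I 1. Proof. by rewrite /itv01 /= lexx ler01. Qed.

Lemma itv01_connected : connected I. Proof. exact: itv_connected. Qed.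

Lemma half_plane_lift (g : R -> V) : {within I, continuous g} ->
  (forall t, I t -> g t != 0 /\ 0 <= (g t).1) ->
  angle_lift I g (fun t => arg (g t)).
Proof.
move=> cg g0; have off t : I t -> off_ray (g t).
  move=> /g0[gn0 g1]; rewrite /off_ray; have [g2|//] := eqVneq (g t).2 0.
  rewrite lt_neqAle g1 andbT; apply: contra_neq gn0 => e1.
  by rewrite [LHS]surjective_pairing g2 -e1.
by split; [exact: within_arg|move=> t /off; exact: arg_is_angle].
Qed.

(** Polar form of a universal chord theorem.  Without such a chord the vector [u] of the two
    discrepancies does not vanish on the triangle of all [s <= t], and has a
    continuous angle there.  Along the diagonal [u] is constant.  Along the left
    side it goes from below to above through the left half-plane, since [rho] is
    largest at [0]; along the top side it goes back through the right half-plane,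
    since [rho] is largest at [1] too.  Each of the two sides changes the angle by
    [- pi], while their sum should be zero. *)
Lemma chord (rho th : R -> R) (c : R) :
  {within I, continuous rho} -> {within I, continuous th} ->
  (forall t, I t -> rho t <= rho 0) -> rho 0 = rho 1 -> 0 < c ->
  c < th 1 - th 0 ->
  exists s t, [/\ 0 <= s, s <= t, t <= 1, rho s = rho t & th t - th s = c].
Proof.
move=> crho cth max0 rho01 c0 hc; apply: contrapT => nochord.
pose T := [set z : V | [/\ 0 <= z.1, z.1 <= z.2 & z.2 <= 1]].
pose u (z : V) : V := (rho z.2 - rho z.1, th z.2 - th z.1 - c).
have TI1 z : T z -> I z.1 by case=> z1 z2 z3; rewrite /itv01 /= z1 (le_trans z2).
have TI2 z : T z -> I z.2 by case=> z1 z2 z3; rewrite /itv01 /= z3 (le_trans z1).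
have compT : compact T.
  have -> : T = (I `*` I) `&` [set z : V | 0 <= z.2 - z.1].
    apply/seteqP; split=> z.
      by move=> Tz; split; [split; [exact: TI1|exact: TI2]|case: Tz; rewrite /= subr_ge0].
    by move=> [[/andP[? ?] /andP[? ?]]] /=; rewrite subr_ge0 => ?; split.
  apply: compact_closedI; first by apply: compact_setX; exact: itv_compact.
  have cz : continuous (fun z : V => z.2 - z.1).
    by move=> z; apply: cvgB; [exact: cvg_snd|exact: cvg_fst].
  have /continuous_closedP ccz := cz.
  exact: (ccz [set x : R | 0 <= x] (@closed_ge R 0)).
have cu : {within T, continuous u}.
  have c1 : {within T, continuous (fun z : V => z.1)}.
    by apply: continuous_within => z _; exact: cvg_fst.
  have c2 : {within T, continuous (fun z : V => z.2)}.
    by apply: continuous_within => z _; exact: cvg_snd.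
  have r1 := within_comp c1 crho TI1; have r2 := within_comp c2 crho TI2.
  have t1 := within_comp c1 cth TI1; have t2 := within_comp c2 cth TI2.
  by apply: within_pair; [exact: withinB|apply: withinB; [exact: withinB|exact: within_cst]].
have u0 z : T z -> u z != 0.
  move=> [z1 z2 z3]; apply/eqP => -[/eqP h1 /eqP h2]; apply: nochord.
  exists z.1, z.2; split => //; first by apply/eqP; rewrite eq_sym -subr_eq0.
  by apply/eqP; rewrite -subr_eq0.
have [A [cA hA]] : exists A, angle_lift T u A.
  apply: (@star_lift R V) => // z k [z1 z2 z3] /andP[k0 k1].
  rewrite /T /= -[k *: z.1]/(k * z.1) -[k *: z.2]/(k * z.2).
  have h1 : 0 <= k * z.1 by exact: mulr_ge0.
  have h2 : k * z.1 <= k * z.2 by exact: ler_wpM2l.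
  have h3 : k * z.2 <= 1 * z.2 by apply: ler_wpM2r => //; exact: le_trans z2.
  by split => //; lra.
have along (w : R -> V) : {within I, continuous w} -> (forall t, I t -> T (w t)) ->
    angle_lift I (fun t => u (w t)) (fun t => A (w t)).
  move=> cw wT; split; last by move=> t /wT; exact: hA.
  exact: (within_comp cw cA wT).
have cid : {within I, continuous (fun t : R => t)} by exact: within_id.
have T_diag t : I t -> T (t, t) by move=> /andP[? ?]; split.
have T_left t : I t -> T (0, t) by move=> /andP[? ?]; split => /=.
have T_top t : I t -> T (t, 1) by move=> /andP[? ?]; split => /=.
have d1 : A (0, 0) = A (1, 1).
  have l1 := along (fun t => (t, t)) (within_pair cid cid) T_diag.
  have l2 : angle_lift I (fun t => u (t, t)) (fun=> A (0, 0)).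
    split; first exact: within_cst.
    move=> t It; have -> : u (t, t) = u (0, 0) by rewrite /u /= !subrr.
    exact/hA/T_diag/itv01_0.
  by have := lift_connected itv01_connected l1 l2 itv01_0 itv01_1; rewrite subrr => /eqP; rewrite eq_sym subr_eq0 => /eqP.
pose d : R := th 1 - th 0 - c.
have d0 : 0 < d by rewrite subr_gt0.
have d2 : A (0, 1) - A (0, 0) = - pi.
  have c1 : {within I, continuous (fun t : R => (0 : R, t))}.
    by apply: within_pair => //; exact: within_cst.
  have l1 := along _ c1 T_left.
  have cmu : {within I, continuous (fun t => - u (0, t))}.
    move=> x; apply: cvgN; exact: (within_comp c1 cu T_left).
  have l2 : angle_lift I (fun t => u (0, t)) (fun t => arg (- u (0, t)) + pi).
    have [|cl hl] := half_plane_lift cmu.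
      move=> t It; rewrite oppr_eq0 u0; last exact: T_left.
      by split => //; rewrite /= oppr_ge0 subr_le0; exact: max0.
    split; first by apply: withinD => //; exact: within_cst.
    by move=> t /hl; exact: is_angle_opp.
  have := lift_connected itv01_connected l1 l2 itv01_0 itv01_1.
  have -> : - u (0, 0) = (0, c).
    by rewrite [LHS]surjective_pairing /u /= !subrr sub0r oppr0 opprK.
  have -> : - u (0, 1) = (0, - d).
    by rewrite [LHS]surjective_pairing /u /= rho01 subrr oppr0.
  by rewrite arg_imag// arg_imagN//; lra.
have d3 : A (1, 1) - A (0, 1) = - pi.
  have c1 : {within I, continuous (fun t : R => (t, 1 : R))}.
    by apply: within_pair => //; exact: within_cst.
  have l1 := along _ c1 T_top.
  have cmu : {within I, continuous (fun t => u (t, 1))} by exact: (within_comp c1 cu T_top).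
  have l2 : angle_lift I (fun t => u (t, 1)) (fun t => arg (u (t, 1))).
    apply: half_plane_lift => // t It; rewrite u0; last exact: T_top.
    by split => //; rewrite /= subr_ge0 -rho01; exact: max0.
  have := lift_connected itv01_connected l1 l2 itv01_0 itv01_1.
  have -> : u (0, 1) = (0, d) by rewrite /u /= rho01 subrr.
  have -> : u (1, 1) = (0, - c) by rewrite /u /= !subrr sub0r.
  by rewrite arg_imag// arg_imagN//; lra.
by have := pi_gt0 R; lra.
Qed.

Definition simple_loop (g : R -> V) := g 0 = g 1 /\
  forall s t, 0 <= s -> s < t -> t <= 1 -> g s = g t -> s = 0 /\ t = 1.

(** The path [g] run through twice, for [t] between [0] and [2]; the second run
    is translated so as to start where the first one ends.  For a closed path it
    is a repetition, for an angle it adds the total turn. *)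
Definition twice (W : zmodType) (g : R -> W) (t : R) : W :=
  g (Num.min t 1) + g (Num.max t 1 - 1) - g 0.

Lemma twiceE1 (W : zmodType) (g : R -> W) t : t <= 1 -> twice g t = g t.
Proof. by move=> t1; rewrite /twice min_l// max_r// subrr addrK. Qed.

Lemma twiceE2 (W : zmodType) (g : R -> W) t : 1 <= t ->
  twice g t = g (t - 1) + (g 1 - g 0).
Proof. by move=> t1; rewrite /twice min_r// max_l// addrAC addrC. Qed.

Lemma continuous_twice (W : normedModType R) (g : R -> W) :
  continuous g -> continuous (twice g).
Proof.
move=> cg t; apply: cvgB; last exact: cvg_cst.
apply: cvgD.
  apply: (@continuous_comp _ _ _ (fun t : R => Num.min t 1) g); last exact: cg.
  by apply: continuous_min; [exact: cvg_id|exact: cvg_cst].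
apply: (@continuous_comp _ _ _ (fun t : R => Num.max t 1 - 1) g); last exact: cg.
apply: cvgB; last exact: cvg_cst.
by apply: continuous_max; [exact: cvg_id|exact: cvg_cst].
Qed.

Lemma rebase_loop (g : R -> V) (th : R -> R) (p : V) (r : R) :
  continuous g -> continuous th -> simple_loop g ->
  (forall t, I t -> is_angle (g t - p) (th t)) ->
  (exists k : int, th 1 - th 0 = 2 * pi * k%:~R) -> I r ->
  exists (G : R -> V) (TH : R -> R), [/\ continuous G, continuous TH, simple_loop G,
    forall t, I t -> is_angle (G t - p) (TH t) &
    [/\ TH 1 - TH 0 = th 1 - th 0, G 0 = g r & forall t, I t -> exists2 u, I u & G t = g u]].
Proof.
move=> cg cth [g01 simple] hth [k hk] /andP[r0 r1].
have shift (W : normedModType R) (f : R -> W) : continuous f -> continuous (fun t => f (r + t)).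
  move=> cf t; apply: (@continuous_comp _ _ _ (fun t : R => r + t) f); last exact: cf.
  by apply: cvgD; [exact: cvg_cst|exact: cvg_id].
have G1 t : r + t <= 1 -> twice g (r + t) = g (r + t) by exact: twiceE1.
have G2 t : 1 <= r + t -> twice g (r + t) = g (r + t - 1).
  by move=> h; rewrite twiceE2// -g01 subrr addr0.
exists (fun t => twice g (r + t)), (fun t => twice th (r + t)); split.
- exact/shift/continuous_twice.
- exact/(shift R^o)/(@continuous_twice R^o).
- split; first by rewrite addr0 twiceE1// G2 ?lerDr// addrK.
  move=> s t s0 st t1; have [s1|s1] := leP (r + s) 1; last first.
    rewrite !G2; [|lra|lra] => e.
    have [] := simple (r + s - 1) (r + t - 1) _ _ _ e; [lra|lra|lra|].
    by move=> ? ?; split; lra.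
  have [t1'|t1'] := leP (r + t) 1.
    rewrite !G1// => e; have [] := simple (r + s) (r + t) _ _ _ e; [lra|lra|lra|].
    by move=> ? ?; split; lra.
  rewrite G1// G2; last lra; move=> e.
  have [lt|ge] := ltP (r + t - 1) (r + s).
    have [] := simple (r + t - 1) (r + s) _ lt s1 (esym e); [lra|].
    by move=> ? ?; split; lra.
  by split; lra.
- move=> t /andP[t0 t1]; have [h|/ltW h] := leP (r + t) 1.
    by rewrite G1// twiceE1//; apply: hth; apply/andP; split; lra.
  rewrite G2// twiceE2// hk.
  by apply/is_angle_period/hth/andP; split; lra.
split.
- rewrite addr0 (twiceE1 th r1) twiceE2 ?lerDr// addrK; ring.
- by rewrite addr0 twiceE1.
move=> t /andP[t0 t1]; have [h|/ltW h] := leP (r + t) 1.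
  by exists (r + t); [apply/andP; split; lra|exact: G1].
by exists (r + t - 1); [apply/andP; split; lra|exact: G2].
Qed.

(** Start the loop at its point farthest from [p], as [chord] requires.  If the
    loop turned by more than [2 * pi] in either sense, [chord] would give two
    times with equal distances to [p] whose angles differ by [2 * pi]; these are
    the same point, hence the two ends of the loop, where the angles differ by
    more. *)
Lemma simple_loop_degree (g : R -> V) (th : R -> R) (p : V) :
  continuous g -> continuous th -> simple_loop g ->
  (forall t, I t -> is_angle (g t - p) (th t)) -> th 0 != th 1 ->
  th 1 - th 0 = 2 * pi \/ th 1 - th 0 = - (2 * pi).
Proof.
move=> cg cth sg hth th01.
have [k hk] : exists k : int, th 1 - th 0 = 2 * pi * k%:~R.
  apply: (@is_angle_uniq _ (g 0 - p)); last exact/hth/itv01_0.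
  by rewrite (proj1 sg); exact/hth/itv01_1.
have p0 : 0 < 2 * pi :> R by rewrite mulr_gt0// pi_gt0.
have cn : {within I, continuous (fun t => norm2 (g t - p))}.
  apply: continuous_within => t _.
  apply: (@continuous_comp _ _ _ (fun t => g t - p) (@norm2 R)); last exact: continuous_norm2.
  by apply: cvgB; [exact: cg|exact: cvg_cst].
have [r /set_mem Ir rmax] := compact_EVT_max (ex_intro _ 0 itv01_0) (@itv_compact R 1) cn.
have [G [TH [cG cTH [G01 simple] hTH [D0 G0 GI]]]] := rebase_loop cg cth sg hth (ex_intro _ k hk) Ir.
have nochord (sgn : R) : (forall t, I t -> norm2 (G t - p) <= norm2 (G 0 - p)) ->
    sgn = 1 \/ sgn = -1 -> ~ (2 * pi < sgn * (TH 1 - TH 0)).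
  move=> Gmax hs hD.
  have [||||s [t [s0 st t1 rho_eq th_eq]]] := @chord (fun t => norm2 (G t - p)) (fun t => sgn * TH t) (2 * pi) _ _ Gmax _ p0.
  - apply: continuous_within => t _.
    apply: (@continuous_comp _ _ _ (fun t => G t - p) (@norm2 R)); last exact: continuous_norm2.
    by apply: cvgB; [exact: cG|exact: cvg_cst].
  - by apply: continuous_within => t _; apply: cvgM; [exact: cvg_cst|exact: cTH].
  - by rewrite G01.
  - by rewrite -mulrBr.
  have st' : s < t.
    rewrite lt_neqAle st andbT; apply/eqP => e; move: th_eq.
    by rewrite e subrr => /esym/eqP; rewrite gt_eqF.
  have Is : I s by apply/andP; split; lra.
  have It : I t by apply/andP; split; lra.
  have Gst : G s = G t.
    apply: (addIr (- p)); apply: (@eq_polar R _ _ (TH s)) => //; first exact: hTH.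
    have := hTH t It; case: hs => hs; move: th_eq; rewrite hs => th_eq.
      have -> : TH t = TH s + 2 * pi * 1%:~R by rewrite mulr1; lra.
      by move/(is_angle_period (-1)); rewrite mulr1 mulrN1 addrK.
    have -> : TH t = TH s + 2 * pi * (-1)%:~R by rewrite mulrN1; lra.
    by move/(is_angle_period 1); rewrite mulr1 mulrN1 subrK.
  have [s_0 t_1] := simple s t s0 st' t1 Gst.
  by move: th_eq hD; rewrite s_0 t_1 mulrBr => ->; rewrite ltxx.
have Gmax t : I t -> norm2 (G t - p) <= norm2 (G 0 - p).
  by move=> It; have [u Iu ->] := GI t It; rewrite G0; apply: rmax; exact: mem_set.
have := nochord 1 Gmax (or_introl erefl); have := nochord (-1) Gmax (or_intror erefl).
rewrite D0 hk mul1r mulN1r -mulrN -mulrNz => h1 h2.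
have k1 : (k <= 1)%R.
  rewrite leNgt; apply/negP => k1; apply: h2.
  by rewrite -[ltLHS]mulr1 ltr_pM2l// ltr1z.
have k2 : (-1 <= k)%R.
  rewrite leNgt; apply/negP => k2; apply: h1.
  by rewrite -[ltLHS]mulr1 ltr_pM2l// ltr1z ltrNr.
have k0 : k != 0.
  apply: contra_neq th01 => k0; move: hk; rewrite k0 mulr0 => /eqP.
  by rewrite subr_eq0 => /eqP.
have [->|->] : k = 1 \/ k = -1 by move: k1 k2 k0; clear; lia.
  by left; rewrite mulr1.
by right; rewrite mulrN1.
Qed.

End SimpleLoops.

(** * Maps without periodic points *)

Section FreeMap.
Variable R : realType.
Local Notation V := (R * R)%type.
Local Notation I := (@itv01 R).

Lemma clamp_continuous (n : R) : continuous (fun t : R => Num.max 0 (Num.min n t)).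
Proof.
move=> t; apply: continuous_max; first exact: cvg_cst.
by apply: continuous_min; [exact: cvg_cst|exact: cvg_id].
Qed.

Lemma clamp_in (n t : R) : 0 <= n -> 0 <= Num.max 0 (Num.min n t) <= n.
Proof. by move=> n0; rewrite le_max lexx /= ge_max n0 ge_min lexx. Qed.

Lemma clamp_id (n t : R) : 0 <= t <= n -> Num.max 0 (Num.min n t) = t.
Proof. by move=> /andP[t0 tn]; rewrite min_r// max_r. Qed.

Lemma continuous_clamp (T : topologicalType) (f : R -> T) (n : R) : 0 <= n ->
  {within [set t : R | 0 <= t <= n], continuous f} ->
  continuous (fun t => f (Num.max 0 (Num.min n t))).
Proof.
move=> n0 cf; have cc : {within setT, continuous (fun t : R => Num.max 0 (Num.min n t))}.
  by apply: continuous_within => t _; exact: clamp_continuous.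
have := within_comp cc cf (fun t _ => clamp_in t n0).
by move/subspace_continuousP => h t; have := h t Logic.I; rewrite withinET.
Qed.

(** Consider points of an essential loop together with their angles, and take an
    arc in this path.  Two of its points with the same position have angles that
    differ by at least [2 * pi]; hence the pairs of such parameters form a compact
    set [Z], and a pair with the smallest distance cuts out a simple loop. *)
Lemma simple_essential_loop (K : set V) (p : V) :
  compact K -> connected K -> ulc K -> ~ K p ->
  ~ (exists th, angle_lift K (fun x => x - p) th) ->
  exists (g : R -> V) (th : R -> R), [/\ continuous g, continuous th,
    forall t, I t -> K (g t) /\ is_angle (g t - p) (th t), simple_loop g & th 0 != th 1].
Proof.
move=> cK K_conn ulcK nKp nolift.
have [g [th [n [cg Kg g0n th0n [cth hth]]]]] := essential_loop cK K_conn ulcK nKp nolift.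
have n0 : 0 <= n%:R :> R by rewrite ler0n.
pose cl (t : R) : R := Num.max 0 (Num.min n%:R t).
pose h (t : R) : V * R := (g (cl t), th (cl t)).
have ch : continuous h.
  have c1 : continuous (fun t => g (cl t)).
    by move=> t; apply: (@continuous_comp _ _ _ cl g); [exact: clamp_continuous|exact: cg].
  have c2 : continuous (fun t => th (cl t)) by exact: (continuous_clamp n0 cth).
  by move=> t; exact: (cvg_pair (c1 t) (c2 t)).
have hE t : 0 <= t <= n%:R -> h t = (g t, th t) by move=> tn; rewrite /h /cl clamp_id.
have h0n : h 0 != h n%:R.
  rewrite !hE ?lexx ?n0//; apply/eqP => -[_ e]; by move: th0n; rewrite e eqxx.
have [e [ce e0 e1 einj eh]] := path_arc ch n0 h0n.
pose E (t : R) : V * R := e (Num.max 0 (Num.min 1 t)).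
have cE : continuous E by exact: (continuous_clamp ler01 ce).
have EE t : I t -> E t = e t by move=> It; rewrite /E clamp_id.
have Eprop t : I t -> K (E t).1 /\ is_angle ((E t).1 - p) (E t).2.
  move=> It; rewrite EE//; have [u un ->] := eh t It; rewrite hE//=.
  by split; [exact: Kg|exact: hth].
have E01 : (E 0).1 = (E 1).1.
  by rewrite (EE _ (@itv01_0 R)) (EE _ (@itv01_1 R)) e0 e1 !hE ?lexx ?n0.
have Einj s t : I s -> I t -> E s = E t -> s = t.
  by move=> Is It; rewrite !EE//; exact: einj.
have diff s t : I s -> I t -> (E s).1 = (E t).1 -> s != t -> 2 * pi <= `|(E t).2 - (E s).2|.
  move=> Is It Est st.
  have hs : is_angle ((E t).1 - p) (E s).2 by rewrite -Est; case: (Eprop s Is).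
  have [k hk] := is_angle_uniq (proj2 (Eprop t It)) hs.
  rewrite hk normrM gtr0_norm ?mulr_gt0 ?pi_gt0// -[leLHS]mulr1 ler_pM2l ?mulr_gt0 ?pi_gt0//.
  rewrite -intr_norm ler1z.
  suff : k != 0 by lia.
  apply: contra_neq st => k0; apply: Einj => //.
  rewrite [LHS]surjective_pairing [RHS]surjective_pairing Est; congr (_, _).
  by move/eqP: hk; rewrite k0 mulr0 subr_eq0 => /eqP ->.
(* The bound on the angles keeps the pairs [(t, t)] out of [Z]. *)
pose Z := [set z : V | [/\ I z.1, I z.2, z.1 <= z.2, (E z.1).1 = (E z.2).1 &
  2 * pi <= `|(E z.2).2 - (E z.1).2|]].
have compZ : compact Z.
  have c1 : continuous (fun z : V => E z.1).
    by move=> z; apply: (@continuous_comp _ _ _ fst E); [exact: cvg_fst|exact: cE].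
  have c2 : continuous (fun z : V => E z.2).
    by move=> z; apply: (@continuous_comp _ _ _ snd E); [exact: cvg_snd|exact: cE].
  have fst_c (W : topologicalType) (f : W -> V * R) : continuous f -> continuous (fun z => (f z).1).
    by move=> cf z; apply: (cvg_comp _ _ (cf z)); exact: cvg_fst.
  have snd_c (W : topologicalType) (f : W -> V * R) : continuous f -> continuous (fun z => (f z).2).
    by move=> cf z; apply: (cvg_comp _ _ (cf z)); exact: cvg_snd.
  pose f1 (z : V) : R := z.2 - z.1.
  pose f2 (z : V) : R := `|(E z.1).1 - (E z.2).1|.
  pose f3 (z : V) : R := `|(E z.2).2 - (E z.1).2|.
  have /continuous_closedP cf1 : continuous f1.
    by move=> z; apply: cvgB; [exact: cvg_snd|exact: cvg_fst].
  have /continuous_closedP cf2 : continuous f2.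
    by move=> z; apply: cvg_norm; apply: cvgB; [exact: (fst_c _ _ c1 z)|exact: (fst_c _ _ c2 z)].
  have /continuous_closedP cf3 : continuous f3.
    by move=> z; apply: cvg_norm; apply: cvgB; [exact: (snd_c _ _ c2 z)|exact: (snd_c _ _ c1 z)].
  have -> : Z = (I `*` I) `&` (f1 @^-1` [set x | 0 <= x] `&`
      (f2 @^-1` [set x | x <= 0] `&` f3 @^-1` [set x | 2 * pi <= x])).
    apply/seteqP; split=> z.
      move=> [z1 z2 z3 z4 z5]; split; first by split.
      by split; [rewrite /f1 /= subr_ge0|split; rewrite /f2 /f3 /= ?z4 ?subrr ?normr0].
    move=> [[z1 z2] [z3 [z4 z5]]]; split => //; first by rewrite -subr_ge0.
    by apply/eqP; rewrite -subr_eq0 -normr_le0.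
  apply: compact_closedI; first by apply: compact_setX; exact: itv_compact.
  apply: closedI; first exact: (cf1 _ (@closed_ge R 0)).
  apply: closedI; first exact: (cf2 _ (@closed_le R 0)).
  exact: (cf3 _ (@closed_ge R (2 * pi))).
have Z01 : Z (0, 1).
  split => //=; [exact: itv01_0|exact: itv01_1|].
  by apply: diff => //; [exact: itv01_0|exact: itv01_1|rewrite eq_sym oner_eq0].
have cmin : {within Z, continuous (fun z : V => z.2 - z.1)}.
  by apply: continuous_within => z _; apply: cvgB; [exact: cvg_snd|exact: cvg_fst].
have [[s0 t0] /set_mem [/= Is0 It0 st0 Est0 D0] zmin] :=
  compact_EVT_min (ex_intro _ _ Z01) compZ cmin.
have st : s0 < t0.
  rewrite lt_neqAle st0 andbT; apply/eqP => e2; move: D0; rewrite e2 subrr normr0.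
  by rewrite leNgt mulr_gt0// pi_gt0.
pose L := t0 - s0; have L0 : 0 < L by rewrite subr_gt0.
have aff t : I t -> I (s0 + t * L).
  move=> /andP[u0 u1]; have /andP[s1 s2] := Is0; have /andP[t1 t2] := It0.
  have h1 : 0 <= t * L by rewrite mulr_ge0// ltW.
  have h2 : t * L <= 1 * L by rewrite ler_wpM2r// ltW.
  by apply/andP; split; [exact: addr_ge0|move: h2; rewrite mul1r /L; lra].
have caff : continuous (fun t : R => E (s0 + t * L)).
  move=> t; apply: (@continuous_comp _ _ _ (fun t : R => s0 + t * L) E); last exact: cE.
  by apply: cvgD; [exact: cvg_cst|apply: cvgM; [exact: cvg_id|exact: cvg_cst]].
have t0E : s0 + 1 * L = t0 by rewrite mul1r /L addrC subrK.
exists (fun t => (E (s0 + t * L)).1), (fun t => (E (s0 + t * L)).2); split.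
- by move=> t; apply: (cvg_comp _ _ (caff t)); exact: cvg_fst.
- by move=> t; apply: (cvg_comp _ _ (caff t)); exact: cvg_snd.
- by move=> t /aff; exact: Eprop.
- split; first by rewrite mul0r addr0 t0E.
  move=> s t s_0 st1 t_1 e2.
  have Is : I s by apply/andP; split; lra.
  have It : I t by apply/andP; split; lra.
  have lt2 : s0 + s * L < s0 + t * L by rewrite ltrD2l ltr_pM2r.
  have := zmin (s0 + s * L, s0 + t * L).
  have Zst : Z (s0 + s * L, s0 + t * L).
    split => //=; [exact: aff|exact: aff|exact: ltW|].
    by apply: diff => //; [exact: aff|exact: aff|rewrite lt_eqF].
  move=> /(_ (mem_set Zst)) /=.
  have -> : s0 + t * L - (s0 + s * L) = (t - s) * L by ring.
  rewrite -/L -{1}[L]mul1r ler_pM2r// => h3; split; lra.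
- rewrite mul0r addr0 t0E; apply/eqP => e2.
  by move: D0; rewrite e2 subrr normr0 leNgt mulr_gt0// pi_gt0.
Qed.

(** The square root of two: in [2 * n ^ 2 = k ^ 2] the exponent of two is odd on
    the left and even on the right. *)
Lemma irrational_exists : exists a : R, forall (n : nat) (k : int),
  (0 < n)%N -> n%:R * a <> k%:~R.
Proof.
exists (Num.sqrt 2) => n k n0 e.
have : (2 * n ^ 2 = `|k| ^ 2)%N.
  apply: (@mulrIn R 1); first exact: oner_neq0.
  rewrite natrM !natrX natr_absz intr_norm real_normK ?num_real// -e exprMn sqr_sqrtr//.
  by rewrite mulrC.
move=> /(congr1 (fun m => odd (logn 2 m))).
have k0 : (0 < `|k|)%N.
  rewrite absz_gt0; apply/eqP => k0; move: e; rewrite k0 => /eqP.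
  by rewrite mulf_eq0 pnatr_eq0 gt_eqF//= sqrtr_eq0 leNgt ltr0n.
rewrite lognM// ?expn_gt0 ?n0// !lognX logn_prime// eqxx oddD !oddM /=.
by [].
Qed.

Lemma continuous_near_eq (U W : normedModType R) (f g : U -> W) (x : U) (d : R) :
  0 < d -> (forall y, `|x - y| < d -> f y = g y) ->
  {for x, continuous g} -> {for x, continuous f}.
Proof.
move=> d0 fg cg; apply/cvgrPdist_lt => e e0.
have /cvgrPdist_lt /(_ e e0) /nbhs_normP[d1 /= d10 h] := cg.
apply/nbhs_normP; exists (Num.min d d1); first by rewrite /= lt_min d0.
move=> y /=; rewrite lt_min => /andP[xy1 xy2].
rewrite (fg x) ?subrr ?normr0// (fg y)//; exact: h.
Qed.

Definition periodize (W : zmodType) (g : R -> W) (y : R) : W := g (y - (Num.floor y)%:~R).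

Lemma floor_bounds (y : R) : 0 <= y - (Num.floor y)%:~R < 1.
Proof.
have := floor_le y; have := floorD1_gt y; rewrite intrD => ? ?.
by apply/andP; split; lra.
Qed.

Lemma periodizeD (W : zmodType) (g : R -> W) (y : R) (k : int) :
  periodize g (y + k%:~R) = periodize g y.
Proof.
rewrite /periodize floorDrz ?intr_int// intrKfloor intrD.
by congr g; ring.
Qed.

(** Near [y] the function is the doubled path, shifted by one less than the floor
    of [y]; this covers the integers, where the floor jumps. *)
Lemma continuous_periodize (W : normedModType R) (g : R -> W) :
  continuous g -> g 0 = g 1 -> continuous (periodize g).
Proof.
move=> cg g01 y; set m : R := (Num.floor y)%:~R.
have /andP[y0 y1] := floor_bounds y.
apply: (@continuous_near_eq R^o W _ (fun y' => twice g (y' - m + 1)) y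
  (1 - (y - m))).
- by rewrite /m; lra.
- move=> y' yy'; rewrite /periodize.
  have /andP[z0 z1] := floor_bounds y'.
  have [b1 b2] : -1 < y' - m /\ y' - m < 1.
    by move: yy'; rewrite ltr_norml -/m in y0 y1 * => /andP[? ?]; split; lra.
  have [lt|ge] := ltP y' m.
    have -> : Num.floor y' = Num.floor y - 1.
      by apply: floor_def; rewrite subrK intrB -/m; apply/andP; split; lra.
    rewrite twiceE1 ?intrB ?opprB; last by lra.
    by congr g; rewrite /m; ring.
  have -> : Num.floor y' = Num.floor y.
    by apply: floor_def; rewrite intrD -/m ge; lra.
  rewrite twiceE2; last by lra.
  by rewrite g01 subrr addr0; congr g; rewrite /m; ring.
apply: (@continuous_comp _ _ _ (fun y' : R => y' - m + 1) (twice g)).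
  by apply: cvgD; [apply: cvgB|]; [exact: cvg_id|exact: cvg_cst|exact: cvg_cst].
exact: continuous_twice.
Qed.

(** As the loop turns once, its angle is [2 * pi * s] times its parameter, with
    [s] a sign, up to a constant and a function [w] that takes equal values at
    the two ends of the loop.  So [w] is a continuous function of the point of
    the loop, and it extends to a function [u] on the plane.  For [x] different
    from [p], subtracting [u x] from an angle of [x - p] gives a parameter modulo
    one.  [F x] is the point of the loop at this parameter increased by an
    irrational [a]: on the loop, [F] shifts the parameter by [a]. *)
Lemma free_map (g : R -> V) (th : R -> R) (p : V) :
  continuous g -> continuous th -> simple_loop g ->
  (forall t, I t -> is_angle (g t - p) (th t)) -> th 0 != th 1 ->
  exists F : V -> V, [/\ forall x, x != p -> {for x, continuous F},
    forall x, exists2 t, I t & F x = g t &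
    forall x n, x != p -> (0 < n)%N -> iter n F x <> x].
Proof.
move=> cg cth sg hth th01; have [g01 simple] := sg.
have [s [s1 hs]] : exists s : int, (s * s = 1) /\ th 1 - th 0 = 2 * pi * s%:~R.
  have [->|->] := simple_loop_degree cg cth sg hth th01.
    by exists 1; rewrite !mulr1.
  by exists (-1); rewrite mulN1r opprK; split => //; rewrite mulrN1.
have s1R : s%:~R * s%:~R = 1 :> R by rewrite -intrM s1.
have p0 : 0 < 2 * pi :> R by rewrite mulr_gt0// pi_gt0.
have [a ha] := irrational_exists.
pose w (t : R) : R := th t - th 0 - 2 * pi * s%:~R * t.
have cw : {within I, continuous w}.
  apply: continuous_within => t _; apply: cvgB.
    by apply: cvgB; [exact: cth|exact: cvg_cst].
  by apply: cvgM; [exact: cvg_cst|exact: cvg_id].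
have cgI : {within I, continuous g} by apply: continuous_within => t _; exact: cg.
have gw s' t : I s' -> I t -> g s' = g t -> w s' = w t.
  wlog st : s' t / s' <= t.
    by move=> H ? ? ?; have [/H->//|/ltW/H<-//] := leP s' t.
  move=> /andP[s0 _] /andP[_ t1] gst; have [->//|nst] := eqVneq s' t.
  have [-> ->] : s' = 0 /\ t = 1 by apply: simple => //; rewrite lt_neqAle nst.
  by rewrite /w subrr mulr0 mulr1 hs !subrr.
have [w' cw' hw'] := within_quotient (W := R^o) (@norm_hausdorff _ _) (@itv_compact R 1) cgI cw gw.
have cS : compact (g @` I) by apply: continuous_compact => //; exact: itv_compact.
have clS : closed (g @` I) by apply: compact_closed => //; exact: norm_hausdorff.
have [M M0 hM] := ex_strict_bound_gt0 (compact_bounded (continuous_compact cw' cS)).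
have [u [uE cu _]] : exists u : V -> R, [/\ {in g @` I, w' =1 u}, continuous u & forall x, `|u x| <= M].
  apply: (continuous_bounded_extension (@pseudometric_normal R V) clS M0 cw').
  by move=> x Sx; apply/ltW/hM; exists x.
have u_g t : I t -> u (g t) = w t.
  by move=> It; rewrite -uE ?hw'//; apply/mem_set; exists t.
have /choice[A hA] : forall x : V, exists t : R, x != p -> is_angle (x - p) t.
  move=> x; have [->|xp] := eqVneq x p; first by exists 0.
  by have [t ht] : exists t, is_angle (x - p) t; [apply: is_angle_ex; rewrite subr_eq0|exists t].
(* The parameter read off from an angle [b] of [x - p], shifted. *)
pose beta (b : R) (x : V) : R := s%:~R * (b - u x - th 0) / (2 * pi) + a.
have beta_per b b' x : (exists k : int, b - b' = 2 * pi * k%:~R) ->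
    periodize g (beta b x) = periodize g (beta b' x).
  move=> [k hk]; rewrite -[RHS](periodizeD g _ (s * k)); congr periodize.
  rewrite /beta intrM (_ : b = b' + 2 * pi * k%:~R); last by rewrite -hk; ring.
  have pi0 : pi != 0 :> R by rewrite gt_eqF// pi_gt0.
  by move: (@pi R) pi0 => q q0; field.
pose F x := periodize g (beta (A x) x).
have gp t : I t -> g t != p.
  by move=> /hth/is_angle_neq0; rewrite subr_eq0.
have Fper y : F (periodize g y) = periodize g (y + a).
  have /andP[t0 /ltW t1] := floor_bounds y.
  have [t et It] : exists2 t, y = t + (Num.floor y)%:~R & I t.
    by exists (y - (Num.floor y)%:~R); [rewrite subrK|apply/andP].
  have -> : periodize g y = g t by rewrite /periodize {1}et addrK.
  rewrite /F (@beta_per _ (th t)); last exact: is_angle_uniq (hA _ (gp t It)) (hth t It).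
  rewrite [RHS](_ : _ = periodize g (t + a)); last by rewrite {1}et addrAC periodizeD.
  rewrite /beta u_g// /w; congr periodize; congr (_ + _).
  have -> : th t - (th t - th 0 - 2 * pi * s%:~R * t) - th 0 = 2 * pi * (s%:~R * t) by ring.
  have pi0 : pi != 0 :> R by rewrite gt_eqF// pi_gt0.
  transitivity (s%:~R * s%:~R * t : R); first by move: (@pi R) pi0 => q q0; field.
  by rewrite s1R mul1r.
exists F; split.
- move=> x xp.
  (* The angles [A] are chosen arbitrarily; near [x] they may be replaced by the
     continuous branch [B]. *)
  pose B (y : V) : R := A x + arg (quot (y - p) (x - p)).
  have xp0 : 0 < `|x - p| / 2 by rewrite divr_gt0// normr_gt0 subr_eq0.
  have dotx y : `|x - y| < `|x - p| / 2 -> 0 < dot (y - p) (x - p).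
    by move=> xy; rewrite dotC; apply: dot_near; rewrite opprB addrA subrK.
  apply: (@continuous_near_eq V V F (fun y => periodize g (beta (B y) y)) x _ xp0).
    move=> y /dotx xy; apply: beta_per.
    have yp : y != p.
      by apply: contraTneq xy => ->; rewrite /dot subrr /= !mul0r addr0 ltxx.
    apply: (@is_angle_uniq _ (y - p)); first exact: hA.
    apply: is_angle_quotK (hA x xp).
    by apply: arg_is_angle; exact: off_ray_quot.
  apply: (@continuous_comp _ _ _ (fun y => beta (B y) y) (periodize g)); last exact: continuous_periodize.
  apply: cvgD; last exact: cvg_cst.
  apply: cvgM; last exact: cvg_cst.
  apply: cvgM; first exact: cvg_cst.
  apply: cvgB; last exact: cvg_cst.
  apply: cvgB; last exact: cu.
  apply: cvgD; first exact: cvg_cst.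
  have ox : off_ray (quot (x - p) (x - p)) by apply/off_ray_quot/dotx; rewrite subrr normr0.
  have /subspace_continuousP cq : {within setT, continuous (fun y : V => quot (y - p) (x - p))}.
    by apply: within_quot; [exact: within_subr|exact: within_cst].
  have := cq x Logic.I; rewrite withinET => cqx.
  exact: (cvg_comp _ _ cqx (continuous_arg ox)).
- move=> x; rewrite /F /periodize; set y := _ - _; exists y => //.
  by have /andP[? /ltW ?] := floor_bounds (beta (A x) x); apply/andP.
(* A periodic point lies on the loop, and [n * a] would be an integer. *)
move=> x n xp n0 it.
have [y xE] : exists y, x = periodize g y.
  by case: n n0 it => // n _ /=; rewrite /F; set z := beta _ _ => <-; exists z.
have iterF k : iter k F (periodize g y) = periodize g (y + k%:R * a).
  elim: k => [|k IH]; first by rewrite mul0r addr0.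
  by rewrite iterS IH Fper -natr1; congr periodize; ring.
move: it; rewrite xE iterF {1}/periodize [RHS]/periodize.
set y1 := y + _; have := floor_bounds y; have := floor_bounds y1.
set k1 := Num.floor y1; set k2 := Num.floor y.
move=> /andP[h1 h2] /andP[h3 h4] e.
have e2 : y1 - k1%:~R = y - k2%:~R.
  have [lt|lt|//] := ltgtP (y1 - k1%:~R) (y - k2%:~R).
    by have [_ e1] := simple _ _ h1 lt (ltW h4) e; move: h4; rewrite e1 ltxx.
  by have [_ e1] := simple _ _ h3 lt (ltW h2) (esym e); move: h2; rewrite e1 ltxx.
by apply: (ha n (k1 - k2) n0); rewrite intrB; move: e2; rewrite /y1; lra.
Qed.

End FreeMap.

(** * Small locally connected continua *)

Section LocalContinua.
Variable R : realType.
Local Notation V := (R * R)%type.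
Implicit Types (K C D A : set V) (x y z u : V).

Definition joined K x y (e : R) := exists C,
  [/\ connected C, C `<=` K, C x, C y & forall z, C z -> `|x - z| < e].

(** Connectedness im kleinen: close to a point of [K], the points of [K] are
    joined to it by small connected sets, which need not be neighbourhoods. *)
Definition cik K := forall x, K x -> forall e, 0 < e -> exists2 d : R, 0 < d &
  forall y, K y -> `|x - y| < d -> joined K x y e.

Lemma star_connected A z : A z ->
  (forall y, A y -> exists D, [/\ connected D, D `<=` A, D z & D y]) -> connected A.
Proof.
move=> Az h; have /choice[D hD] : forall y, exists D, A y ->
    [/\ connected D, D `<=` A, D z & D y].
  by move=> y; have [/h[D]|] := pselect (A y); [exists D|exists set0].
have -> : A = \bigcup_(y in A) D y.
  apply/seteqP; split=> [y Ay|y [y' Ay' Dy]]; first by exists y => //; case: (hD y Ay).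
  by case: (hD y' Ay') => _ + _ _; exact.
apply: bigcup_connected; last by move=> y /hD[].
by exists z => y /hD[].
Qed.

Lemma cik_ulc K : compact K -> cik K -> ulc K.
Proof.
move=> cK cikK e e0; have e2 : 0 < e / 2 by rewrite divr_gt0.
move: cK; rewrite compact_near_coveringP => cK.
have [] := cK R 0^'+ (fun d x => forall y, K x -> K y -> `|x - y| < d -> joined K x y e).
  move=> x Kx; have [r r0 hr] := cikK x Kx _ e2.
  have m0 : 0 < Num.min r e / 2 by rewrite divr_gt0// lt_min r0.
  have mr : Num.min r e / 2 <= r / 2 by rewrite ler_pM2r ?invr_gt0// ge_min lexx.
  have me : Num.min r e / 2 <= e / 2 by rewrite ler_pM2r ?invr_gt0// ge_min lexx orbT.
  near=> x' d => /= y Kx' Ky xy.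
  have xx' : `|x - x'| < Num.min r e / 2.
    by near: x'; exact: near_dist.
  have dr : d < r / 2 by near: d; apply: nbhs_right_lt; rewrite divr_gt0.
  have [C1 [cC1 C1K C1x C1x' C1e]] : joined K x x' (e / 2) by apply: hr => //; lra.
  have [C2 [cC2 C2K C2x C2y C2e]] : joined K x y (e / 2).
    by apply: hr => //; have := ler_normD (x - x') (x' - y); rewrite subrKA; lra.
  exists (C1 `|` C2); split.
  - by apply: connectedU => //; exists x.
  - by move=> z [/C1K|/C2K].
  - by left.
  - by right.
  move=> z Cz; have : `|x - z| < e / 2 by case: Cz => [/C1e|/C2e].
  by have := ler_normD (x' - x) (x - z); rewrite subrKA [`|x' - x|]distrC; lra.
move=> d /= d0 hd; exists (d / 2) => [|x y Kx Ky xy]; first by rewrite divr_gt0.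
apply: (hd (d / 2)) => //=; rewrite ?divr_gt0//.
by rewrite sub0r normrN gtr0_norm ?divr_gt0//; lra.
Unshelve. all: by end_near.
Qed.

Lemma closure_dist A u (r : R) : (forall z, A z -> `|u - z| <= r) ->
  forall z, closure A z -> `|u - z| <= r.
Proof.
move=> h; have cn : continuous (fun z : V => `|u - z|).
  by move=> z; apply: cvg_norm; apply: cvgB; [exact: cvg_cst|exact: cvg_id].
have /continuous_closedP ccn := cn.
have cl := ccn [set x : R | x <= r] (@closed_le R r).
move=> z Az; have : closure ((fun z : V => `|u - z|) @^-1` [set x : R | x <= r]) z.
  by apply: closureS Az.
by rewrite -(closure_id _).1.
Qed.

Section Chains.
Variables (K : set V) (e0 : R).
Hypothesis e0_gt0 : 0 < e0.
Hypothesis ulcK : ulc K.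

Let a k : R := e0 / 2 ^+ k.
Let a_gt0 k : 0 < a k. Proof. by rewrite divr_gt0// exprn_gt0. Qed.
Let aS k : a k = 2 * a k.+1.
Proof. by rewrite /a exprS; field; rewrite expf_neq0. Qed.

(** [z] and [y] are linked by [n] connected subsets of [K], with radii
    [a k], [a k.+1] and so on, halved at each link: the size of the whole is
    controlled whatever [n] is. *)
Fixpoint chained (k n : nat) z y : Prop :=
  if n is n'.+1 then exists2 w, joined K z w (a k) & chained k.+1 n' w y else z = y.

Lemma joined_refl z k : K z -> joined K z z (a k).
Proof.
move=> Kz; exists [set z]; split => //; first exact: connected1.
  by move=> ? ->.
by move=> ? ->; rewrite subrr normr0.
Qed.

Lemma chained_in k n z y : K z -> chained k n z y -> K y.
Proof.
elim: n k z => [|n IH] k z Kz /=; first by move=> <-.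
by case=> w [C [_ CK _ Cw _]]; apply: IH; exact: CK.
Qed.

Lemma chained_dist k n z y : chained k n z y -> `|z - y| <= 2 * a k.
Proof.
elim: n k z => [|n IH] k z /=.
  by move=> ->; rewrite subrr normr0 mulr_ge0// ltW.
case=> w [C [_ _ _ Cw Ce]] /IH wy; have := Ce w Cw; have := aS k.
by have := ler_normD (z - w) (w - y); rewrite subrKA; lra.
Qed.

Lemma chained_cat k n m z y w : chained k n z y -> chained (k + n) m y w ->
  chained k (n + m) z w.
Proof.
elim: n k z => [|n IH] k z /=; first by move=> ->; rewrite addn0.
by case=> v zv vy; rewrite addnS -addSn => yw; exists v => //; exact: IH.
Qed.

Lemma chained_split k n m z w : chained k (n + m) z w ->
  exists2 y, chained k n z y & chained (k + n) m y w.
Proof.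
elim: n k z => [|n IH] k z /=; first by rewrite addn0; exists z.
case=> v zv /IH[y vy yw]; exists y; first by exists v.
by rewrite addnS -addSn.
Qed.

Lemma chained_pad k n m z y : K z -> chained k n z y -> chained k (n + m) z y.
Proof.
move=> Kz zy; have Ky := chained_in Kz zy.
apply: chained_cat zy _.
elim: m (k + n)%N => //= m IH j; exists y; [exact: joined_refl|exact: IH].
Qed.

Definition reach k z : set V := [set y | exists n, chained k n z y].

Lemma reach_refl k z : reach k z z. Proof. by exists 0%N. Qed.

Lemma reach_star k z y : reach k z y ->
  exists D, [/\ connected D, D `<=` reach k z, D z & D y].
Proof.
case=> n; elim: n k z => [|n IH] k z /=.
  move=> <-; exists [set z]; split => //; first exact: connected1.
  by move=> ? ->; exact: reach_refl.
case=> w [C [cC CK Cz Cw Ce]] /IH[D [cD DR Dw Dy]].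
exists (C `|` D); split; [|move=> u|by left|by right].
  by apply: connectedU => //; exists w.
case=> [Cu|/DR[m wu]]; last first.
  by exists m.+1; exists w => //; exists C.
by exists 1%N; exists u => //; exists C.
Qed.

Lemma reach_connected k z : connected (reach k z).
Proof. by apply: (star_connected (reach_refl k z)) => y; exact: reach_star. Qed.

Lemma reach_in k z : K z -> reach k z `<=` K.
Proof. by move=> Kz y [n]; exact: chained_in. Qed.

Lemma reach_dist k z y : reach k z y -> `|z - y| <= 2 * a k.
Proof. by case=> n; exact: chained_dist. Qed.

Lemma reach_open z y : K z -> reach 0 z y -> exists2 d, 0 < d &
  forall y', K y' -> `|y - y'| < d -> reach 0 z y'.
Proof.
move=> Kz [n zy]; have [d d0 hd] := ulcK (a_gt0 n); exists d => // y' Ky' yy'.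
have Ky := chained_in Kz zy.
by exists (n + 1)%N; apply: chained_cat zy _; exists y' => //; exact: hd.
Qed.

Lemma reach_split k z y : K z -> reach 0 z y -> exists2 u, chained 0 k z u & reach k u y.
Proof.
move=> Kz [n zy]; have := chained_pad k Kz zy; rewrite addnC => /chained_split[u zu uy].
by exists u => //; exists n.
Qed.

Lemma reach_cat k z u y : chained 0 k z u -> reach k u y -> reach 0 z y.
Proof. by move=> zu [n uy]; exists (k + n)%N; exact: chained_cat zu uy. Qed.

(** Near [y], a point of the reach of [x] is attained from a chain point [u'] of
    stage [k] by links of total size at most [2 * a k].  Collect in [P u] the
    pieces attained from all chain points of stage [k] close to [u]: this is a
    connected set of small diameter.  By compactness of [K] finitely many [P u]
    cover the reach of [x].  Those without [y] in their closure stay away from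
    [y]; each of the others has a closure that joins [y] to its points. *)
Lemma reach_closure_near x y (eta : R) : compact K -> K x -> closure (reach 0 x) y ->
  0 < eta -> exists2 r, 0 < r & forall y', reach 0 x y' -> `|y - y'| < r ->
    joined (closure (reach 0 x)) y y' eta.
Proof.
move=> cK Kx Vy eta0.
have [k hk] := geometric_small (mulr_gt0 (ltr0n R 8) e0_gt0) eta0.
rewrite -mulrA -/(a k) in hk.
have [d' d'0 hd'] := ulcK (a_gt0 k).
pose d := Num.min d' (a k); have d0 : 0 < d by rewrite lt_min d'0 a_gt0.
have da : d <= a k by rewrite ge_min lexx orbT.
have hd u u' : K u -> K u' -> `|u - u'| < d -> joined K u u' (a k).
  by move=> Ku Ku'; rewrite lt_min => /andP[+ _]; exact: hd'.
have d2 : 0 < d / 2 by rewrite divr_gt0.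
pose P u := \bigcup_(u' in [set u' | chained 0 k x u' /\ `|u - u'| < d / 2]) reach k u'.
have PV u : P u `<=` reach 0 x by move=> z [u' [xu' _] u'z]; exact: reach_cat xu' u'z.
have Pdist u z : P u z -> `|u - z| <= 3 * a k.
  move=> [u' [_ uu'] /reach_dist u'z].
  by have := ler_normD (u - u') (u' - z); rewrite subrKA; lra.
have Pconn u : connected (P u).
  have [[u0 [xu0 uu0]]|none] := pselect (exists u0, chained 0 k x u0 /\ `|u - u0| < d / 2); last first.
    have -> : P u = set0.
      by rewrite -subset0 => z [u' hu' _]; apply: none; exists u'.
    exact: connected0.
  apply: (@star_connected _ u0); first by exists u0 => //; exact: reach_refl.
  move=> z [u' [xu' uu'] u'z]; exists (reach k u0 `|` reach k u'); split.
  - apply: connectedU; [|exact: reach_connected|exact: reach_connected].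
    exists u'; split; last exact: reach_refl.
    exists 1%N; exists u' => //; apply: hd; [exact: chained_in xu0|exact: chained_in xu'|].
    by have := ler_normD (u0 - u) (u - u'); rewrite subrKA [`|u0 - u|]distrC; lra.
  - by move=> v [hv|hv]; [exists u0|exists u'].
  - by left; exact: reach_refl.
  - by right.
have : \forall y' \near y, K `<=` (fun u => chained 0 k x u -> reach k u y' ->
    joined (closure (reach 0 x)) y y' eta).
  move: cK; rewrite compact_near_coveringP => cK.
  apply: (cK V (nbhs y) (fun y' u => chained 0 k x u -> reach k u y' ->
    joined (closure (reach 0 x)) y y' eta)) => u Ku.
  have [Py|nPy] := pselect (closure (P u) y).
    near=> u' y' => /= xu' u'y'.
    have uu' : `|u - u'| < d / 2 by near: u'; exact: near_dist.
    have Py' : P u y' by exists u'.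
    have Pu z : closure (P u) z -> `|u - z| <= 3 * a k by apply: closure_dist; exact: Pdist.
    exists (closure (P u)); split => //; [exact: connected_closure|exact: (closureS (@PV u))|exact: subset_closure|].
    move=> z /Pu uz; have uy := Pu _ Py.
    have := ler_normD (y - u) (u - z); rewrite subrKA [`|y - u|]distrC.
    by have := a_gt0 k; lra.
  have /near_distP[r r0 hr] : nbhs y (~` closure (P u)).
    by apply: open_nbhs_nbhs; split => //; apply: closed_openC; exact: closed_closure.
  near=> u' y' => /= xu' u'y'; exfalso.
  have uu' : `|u - u'| < d / 2 by near: u'; exact: near_dist.
  have yy' : `|y - y'| < r by near: y'; exact: near_dist.
  by apply: (hr y' yy'); apply: subset_closure; exists u'.
move/near_distP => [r r0 hr]; exists r => // y' xy' yy'.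
have [u xu uy'] := reach_split k Kx xy'.
by apply: (hr y' yy' u) => //; exact: chained_in xu.
Unshelve. all: by end_near.
Qed.

(** A point [y'] of the closure is joined first to a point of the reach close to
    it. *)
Lemma reach_closure_cik x : compact K -> K x -> cik (closure (reach 0 x)).
Proof.
move=> cK Kx y Vy e e_gt0; have e2 : 0 < e / 2 by rewrite divr_gt0.
have [r r0 hr] := reach_closure_near cK Kx Vy e2.
exists (Num.min (r / 2) (e / 4)); first by rewrite lt_min !divr_gt0.
move=> y' Vy'; rewrite lt_min => /andP[yr ye].
have e4 : 0 < e / 4 by rewrite divr_gt0.
have [r' r'0 hr'] := reach_closure_near cK Kx Vy' e4.
have m0 : 0 < Num.min r' (r / 2) by rewrite lt_min r'0 divr_gt0.
have [y'' [xy'' yy'']] := Vy' _ (nbhsx_ballx y' _ m0).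
move: yy''; rewrite -ball_normE /= lt_min => /andP[y1 y2].
have [C [cC CV Cy' Cy'' Ce]] := hr' y'' xy'' y1.
have [|D [cD DV Dy Dy'' De]] := hr y'' xy''.
  by have := ler_normD (y - y') (y' - y''); rewrite subrKA; lra.
exists (C `|` D); split; [|by move=> z [/CV|/DV]|by right|by left|].
  by apply: connectedU => //; exists y''.
move=> z [/Ce h|/De h]; last by lra.
by have := ler_normD (y - y') (y' - z); rewrite subrKA; lra.
Qed.

End Chains.

(** A connected neighbourhood in [K] need not have a locally connected closure;
    the set of points that chains of shrinking links attain from [x] does. *)
Lemma small_continuum K x (e : R) : compact K -> ulc K -> K x -> 0 < e ->
  exists W : set V, [/\ W x /\ W `<=` K,
    forall y, W y -> exists2 d, 0 < d & forall y', K y' -> `|y - y'| < d -> W y',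
    connected W, forall y, W y -> `|x - y| <= e & cik (closure W)].
Proof.
move=> cK ulcK Kx e0; have e2 : 0 < e / 2 by rewrite divr_gt0.
exists (reach K (e / 2) 0 x); split.
- by split; [exact: reach_refl|exact: reach_in].
- by move=> y; exact: reach_open.
- exact: reach_connected.
- move=> y /reach_dist; rewrite expr0 divr1 => h; apply: le_trans (h _) _; lra.
- exact: reach_closure_cik.
Qed.

End LocalContinua.

(** * Filling holes *)

Section Filling.
Variable R : realType.
Local Notation V := (R * R)%type.
Implicit Types (K A : set V) (p q x y z : V).

(** For compact [K] these are the points of the unbounded component of the
    complement (Borsuk and Eilenberg); taken as a definition, it makes components
    superfluous, as the property spreads along segments that avoid [K]
    ([outside_move]). *)
Definition outside K : set V :=
  [set p | ~ K p /\ exists th, angle_lift K (fun x => x - p) th].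

Definition fill K : set V := ~` outside K.

Lemma segment_sym p q : segment p q `<=` segment q p.
Proof.
move=> z [k /= /andP[k0 k1] <-]; exists (1 - k) => /=; first by apply/andP; split; lra.
by rewrite scalerBl scale1r addrA subrKC -scalerN opprB.
Qed.

Lemma segment_dist p q z : segment p q z -> `|p - z| <= `|p - q|.
Proof.
case=> k /= /andP[k0 k1] <-.
rewrite opprD addrA subrr sub0r normrN normrZ ger0_norm// distrC.
by rewrite -[leRHS]mul1r ler_wpM2r.
Qed.

Lemma segment_connected p q : connected (segment p q).
Proof.
apply: connected_continuous_connected; first exact: (@itv_connected R 1).
apply: continuous_within => t _.
by apply: cvgD; [exact: cvg_cst|apply: cvgZ; [exact: cvg_id|exact: cvg_cst]].
Qed.

Lemma outside_move K p q : outside K p -> (forall z, segment p q z -> ~ K z) -> outside K q.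
Proof.
move=> [nKp [th hth]] h; split; first by apply: h; exact: segmentr.
exists (fun x => th x + arg (quot (x - q) (x - p))).
by apply: angle_lift_move hth => x Kx /h.
Qed.

Lemma fill_sub K : K `<=` fill K. Proof. by move=> x Kx []. Qed.

Lemma fill_move K p q : fill K p -> (forall z, segment p q z -> ~ K z) -> fill K q.
Proof.
by move=> fp h oq; apply: fp; apply: (outside_move oq) => z /segment_sym; exact: h.
Qed.

Section CompactFill.
Variable K : set V.
Hypothesis K_compact : compact K.

Let K_closed : closed K.
Proof. by apply: compact_closed => //; exact: norm_hausdorff. Qed.

Let ball_miss p : ~ K p -> exists2 d, 0 < d & forall z, `|p - z| < d -> ~ K z.
Proof.
move=> nKp; apply: (@near_distP _ p (~` K)).
by apply: open_nbhs_nbhs; split => //; exact: closed_openC.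
Qed.

Lemma outside_open : open (outside K).
Proof.
rewrite openE => p op; have [d d0 hd] := ball_miss (proj1 op).
apply: filterS (near_dist p d0) => q pq; apply: (outside_move op) => z /segment_dist pz.
by apply: hd; exact: le_lt_trans pz pq.
Qed.

Lemma hole_open : open (fill K `\` K).
Proof.
rewrite openE => p [fp nKp]; have [d d0 hd] := ball_miss nKp.
apply: filterS (near_dist p d0) => q pq; split; last exact: hd.
by apply: (fill_move fp) => z /segment_dist pz; apply: hd; exact: le_lt_trans pz pq.
Qed.

Lemma fill_closed : closed (fill K).
Proof. exact/open_closedC/outside_open. Qed.

(** A point beyond a side of a square that contains [K] sees [K] within an open
    half-plane. *)
Lemma fill_bounded x (r : R) : (forall z, K z -> `|x - z| <= r) ->
  forall z, fill K z -> `|x - z| <= r.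
Proof.
move=> hK p fp; rewrite leNgt; apply/negP => pr; apply: fp.
have nKp : ~ K p by move=> /hK; rewrite leNgt pr.
split => //.
have half u : u != 0 -> (forall z, K z -> 0 < dot (z - p) u) ->
    exists th, angle_lift K (fun z => z - p) th.
  by move=> u0 h; apply: (angle_lift_half (@within_subr R K p) u0 h).
have Kb z : K z -> `|x.1 - z.1| <= r /\ `|x.2 - z.2| <= r.
  by move=> /hK; rewrite ler_prod_norm => /andP[].
have ne (s t : R) : (s != 0) || (t != 0) -> (s, t) != 0 :> V.
  by apply: contraTneq => -[-> ->]; rewrite eqxx.
have : (r < `|x.1 - p.1|) || (r < `|x.2 - p.2|).
  by move: pr; rewrite prod_normE lt_max.
rewrite !ltr_normr => /orP[/orP[h|h]|/orP[h|h]].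
- apply: (half (1, 0)); first by rewrite ne// oner_eq0.
  move=> z /Kb[b _]; move: b; rewrite ler_norml => /andP[? ?].
  by rewrite /dot /=; lra.
- apply: (half (-1, 0)); first by rewrite ne// oppr_eq0 oner_eq0.
  move=> z /Kb[b _]; move: b; rewrite ler_norml => /andP[? ?].
  by rewrite /dot /=; lra.
- apply: (half (0, 1)); first by rewrite ne// oner_eq0 orbT.
  move=> z /Kb[_ b]; move: b; rewrite ler_norml => /andP[? ?].
  by rewrite /dot /=; lra.
- apply: (half (0, -1)); first by rewrite ne// oppr_eq0 oner_eq0 orbT.
  move=> z /Kb[_ b]; move: b; rewrite ler_norml => /andP[? ?].
  by rewrite /dot /=; lra.
Qed.

Lemma box_compact (r : R) : compact [set z : V | `|z| <= r].
Proof.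
have -> : [set z : V | `|z| <= r] = `[- r, r]%classic `*` `[- r, r]%classic.
  apply/seteqP; split=> z; rewrite /= !in_itv /= ler_prod_norm !ler_norml.
    by move=> /andP[-> ->].
  by move=> [-> ->].
by apply: compact_setX; exact: segment_compact.
Qed.

Lemma fill_compact : compact (fill K).
Proof.
have [B B0 hB] := ex_strict_bound_gt0 (compact_bounded K_compact).
apply: (@subclosed_compact _ _ [set z : V | `|z| <= B]).
- exact: fill_closed.
- exact: box_compact.
move=> z fz; have := @fill_bounded 0 B _ z fz; rewrite sub0r normrN; apply.
by move=> y Ky; rewrite sub0r normrN ltW//; exact: hB.
Qed.

(** Until it hits [K], a segment that starts in [fill K] stays there. *)
Lemma first_hit p q : (exists2 z, segment p q z & K z) -> fill K p ->
  exists a, [/\ K a, segment p q a & segment p a `<=` fill K].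
Proof.
move=> [z [k0 /= /andP[k00 k01] <-] Kz] fp.
pose f (k : R) : V := p + k *: (q - p).
have cf : continuous f.
  by move=> t; apply: cvgD; [exact: cvg_cst|apply: cvgZ; [exact: cvg_id|exact: cvg_cst]].
have clf : closed (f @^-1` K) by have /continuous_closedP := cf; apply.
have [k [/andP[k1 k2] Kk hk]] := first_point clf (Kz : (f @^-1` K) k0) k00.
have kI : 0 <= k <= 1 by rewrite k1 (le_trans k2).
exists (f k); split => //; first by exists k.
have shift (t : R) : f t - p = t *: (q - p) by rewrite /f addrAC subrr add0r.
move=> y [j /= /andP[j0 j1] <-].
have [->|j_1] := eqVneq j 1; first by rewrite scale1r subrKC; exact: fill_sub.
rewrite shift scalerA -/(f (j * k)).
have [kz|knz] := eqVneq k 0.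
  by apply: fill_sub; move: Kk; rewrite kz mulr0.
apply: (fill_move fp) => w [i /= /andP[i0 i1] <-].
rewrite shift scalerA -/(f (i * (j * k))); apply: hk.
rewrite !mulr_ge0//=.
have kp : 0 < k by rewrite lt_neqAle eq_sym knz.
have jk : j * k < k by rewrite gtr_pMl// lt_neqAle j_1.
have : i * (j * k) <= 1 * (j * k) by rewrite ler_wpM2r// mulr_ge0.
by lra.
Qed.

(** A horizontal segment from a point of [fill K] to a distant point, which is
    outside, must hit [K]; the part before joins the point to [K]. *)
Lemma fill_connected : connected K -> K !=set0 -> connected (fill K).
Proof.
move=> K_conn [z0 Kz0].
have [B B0 hB] := ex_strict_bound_gt0 (compact_bounded K_compact).
apply: (@star_connected _ _ z0); first exact: fill_sub.
move=> y fy; pose q : V := (y.1 + (`|y.1| + B + B), y.2).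
have oq : outside K q.
  apply: contrapT => fq; have := @fill_bounded 0 B _ q fq.
  rewrite sub0r normrN ler_prod_norm /= => h.
  have /h/andP[] : forall z, K z -> `|0 - z| <= B.
    by move=> z Kz; rewrite sub0r normrN ltW//; exact: hB.
  rewrite ler_norml => /andP[_ +] _.
  have : - y.1 <= `|y.1| by rewrite -normrN ler_norm.
  by lra.
have [|a [Ka _ sa]] := @first_hit y q _ fy.
  apply: contrapT => no; apply: (fill_move fy (q := q)) => //.
  by move=> z sz Kz; apply: no; exists z.
exists (segment y a `|` K); split.
- by apply: connectedU => //; [exists a; split => //; exact: segmentr|exact: segment_connected].
- by move=> z [/sa|/fill_sub].
- by right.
- by left; exact: segmentl.
Qed.

(** A point [y] of [fill K] near the point [x] of [K] is linked to [K] by the part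
    of the segment from [y] to [x] before it hits [K]. *)
Lemma fill_cik : cik K -> cik (fill K).
Proof.
move=> cikK x fx e e0.
have [Kx|nKx] := pselect (K x); last first.
  have [d d0 hd] := ball_miss nKx.
  exists (Num.min d e); first by rewrite lt_min d0.
  move=> y fy; rewrite lt_min => /andP[xyd xye].
  exists (segment x y); split; [exact: segment_connected| |exact: segmentl|exact: segmentr|].
    move=> z sz; apply: (fill_move fx) => w sw; apply: hd.
    by rewrite (le_lt_trans (segment_dist sw))// (le_lt_trans (segment_dist sz)).
  by move=> z /segment_dist xz; exact: le_lt_trans xye.
have e2 : 0 < e / 2 by rewrite divr_gt0.
have [d d0 hd] := cikK x Kx _ e2.
exists (Num.min d (e / 4)); first by rewrite lt_min d0 divr_gt0.
move=> y fy; rewrite lt_min => /andP[xyd xye].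
have [|a [Ka sya sa]] := @first_hit y x _ fy; first by exists x => //; exact: segmentr.
have ya := segment_dist sya.
have xa := segment_dist (segment_sym sya).
have [C [cC CK Cx Ca Ce]] := hd a Ka (le_lt_trans xa xyd).
exists (C `|` segment y a); split.
- by apply: connectedU => //; [exists a; split => //; exact: segmentr|exact: segment_connected].
- by move=> z [/CK/fill_sub|/sa].
- by left.
- by right; exact: segmentl.
move=> z [/Ce h|/segment_dist yz]; first by lra.
have := ler_normD (x - y) (y - z); rewrite subrKA.
by move: ya; rewrite [`|y - x|]distrC; lra.
Qed.

(** Extend the angle of [K], seen from the outside point [p], to a continuous
    function [u] on the plane.  On [fill K] the vector [z - p] turned back by [u z]
    does not vanish, and on [K] it is a positive real; so it continues by positive
    reals over the rest of the plane to a map [k] without zeros.  On a large square, [k]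
    has a continuous angle [kap], and [u + kap] is an angle of [z - p] on
    [fill K]. *)
Lemma fill_nonseparating : nonseparating (fill K).
Proof.
move=> p nfp.
have [nKp [L [cL hL]]] : outside K p by apply: contrapT.
have [B B0 hB] := ex_strict_bound_gt0 (compact_bounded (continuous_compact cL K_compact)).
have [u [uE cu _]] : exists u : V -> R, [/\ {in K, L =1 u}, continuous u & forall x, `|u x| <= B].
  apply: (continuous_bounded_extension (@pseudometric_normal R V) K_closed B0 cL).
  by move=> x Kx; apply/ltW/hB; exists x.
have u_K x : K x -> is_angle (x - p) (u x).
  by move=> Kx; rewrite -uE ?inE//; exact: hL.
pose E (z : V) : V := (cos (u z), sin (u z)).
have E_angle z : is_angle (E z) (u z) by exists 1; rewrite ?mul1r.
have cE : continuous E.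
  have c1 : continuous (fun z => cos (u z)).
    by move=> z; apply: (@continuous_comp _ _ _ u cos); [exact: cu|exact: continuous_cos].
  have c2 : continuous (fun z => sin (u z)).
    by move=> z; apply: (@continuous_comp _ _ _ u sin); [exact: cu|exact: continuous_sin].
  by move=> z; exact: (cvg_pair (c1 z) (c2 z)).
pose rho (z : V) : R := norm2 (z - p).
have crho : continuous rho.
  move=> z; apply: (@continuous_comp _ _ _ (fun z : V => z - p) (@norm2 R)); last exact: continuous_norm2.
  by apply: cvgB; [exact: cvg_id|exact: cvg_cst].
have [c c0 hc] : exists2 c, 0 < c & forall z, K z -> c <= rho z.
  have [||c c0 hc] := @within_away0 R V R^o K rho K_compact.
  - by apply: continuous_within => z _; exact: crho.
  - by move=> z /u_K[r r0 e]; rewrite /rho e norm2_polar// gt_eqF.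
  by exists c => // z /hc; rewrite ger0_norm// norm2_ge0.
pose inner z := quot (z - p) (E z).
pose outer (z : V) : V := (Num.max c (rho z), 0).
pose k z := if `[< fill K z >] then inner z else outer z.
have inner_outer z : K z -> inner z = outer z.
  move=> Kz; rewrite /outer max_r; last exact: hc.
  have [r r0 e] := u_K z Kz; rewrite /inner /rho e norm2_polar// /quot /E /=.
  congr (_, _); last by ring.
  by rewrite -[RHS]mulr1 -(cos2Dsin2 (u z)); ring.
have ck : {within setT, continuous k}.
  have -> : [set: V] = fill K `|` ~` (fill K `\` K).
    apply/seteqP; split=> // z _; have [fz|nfz] := pselect (fill K z); first by left.
    by right=> -[].
  apply: withinU_continuous; first exact: fill_closed.
  - exact/open_closedC/hole_open.
  - apply: (@within_ext _ _ (fill K) inner); first by move=> z fz; rewrite /k asboolT.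
    apply: within_quot; first exact: within_subr.
    by apply: continuous_within => z _; exact: cE.
  - apply: (@within_ext _ _ _ outer).
      move=> z nz; rewrite /k; case: asboolP => // fz; rewrite inner_outer//.
      by apply: contrapT => nKz; apply: nz.
    apply: within_pair; last exact: within_cst.
    apply: continuous_within => z _; apply: (@continuous_max R _ (fun=> c) rho).
      exact: cvg_cst.
    exact: crho.
have k0 z : k z != 0.
  rewrite /k; case: asboolP => [fz|_]; last first.
    by apply/eqP => -[/eqP]; rewrite gt_eqF// lt_max c0.
  have zp : z - p != 0 by rewrite subr_eq0; apply: contra_notN nfp => /eqP <-.
  have [t ht] := is_angle_ex zp.
  exact: is_angle_neq0 (is_angle_quot ht (E_angle z)).
have [M M0 hM] := ex_strict_bound_gt0 (compact_bounded fill_compact).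
have [kap [ckap hkap]] : exists th, angle_lift [set z : V | `|z| <= M] k th.
  apply: star_lift => //.
  - exact: box_compact.
  - move=> z j /= zM /andP[j0 j1]; rewrite normrZ ger0_norm//.
    have := ler_wpM2r (normr_ge0 z) j1; rewrite mul1r => h; exact: le_trans h zM.
  - exact: continuous_subspaceW ck.
have fM : fill K `<=` [set z : V | `|z| <= M] by move=> z /hM /ltW.
exists (fun z => u z + kap z); split.
  apply: withinD; last exact: continuous_subspaceW fM ckap.
  by apply: continuous_within => z _; exact: cu.
move=> z fz; apply: is_angle_quotK (E_angle z).
by have := hkap z (fM z fz); rewrite /k asboolT.
Qed.

End CompactFill.
End Filling.

(** * The equivalences *)

Section Assembly.

(** The closure of a subset of [X] is a subspace of a subspace of the plane;
    embeddings compose, which avoids comparing the iterated topologies. *)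
Definition embedding (S T : topologicalType) (e : S -> T) :=
  injective e /\ forall O : set S, open O <-> exists2 O', open O' & e @^-1` O' = O.

Lemma embedding_val (T : topologicalType) (A : set T) : embedding (@set_val T A).
Proof. by split=> [x y|O]; [exact: val_inj|split]. Qed.

Lemma embedding_comp (S T U : topologicalType) (e : S -> T) (e' : T -> U) :
  embedding e -> embedding e' -> embedding (e' \o e).
Proof.
move=> [ie ope] [ie' ope']; split=> [x y /ie' /ie // |O].
split.
  by move=> /ope [ O1 + <-] => /ope' [ O2 oO2 <-]; exists O2.
by move=> [ O2 oO2 <-]; apply/ope; exists (e' @^-1` O2) => //; apply/ope'; exists O2.
Qed.

Lemma restrict_map (T : topologicalType) (A : set T) (F : T -> T) :
  {within A, continuous F} -> (forall x, A x -> A (F x)) ->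
  exists2 f : set_type A -> set_type A, continuous f &
    forall x, set_val (f x) = F (set_val x).
Proof.
move=> /subspace_sigL_continuousP cF FA.
have FA' (x : set_type A) : F (set_val x) \in A.
  by apply: mem_set; apply: FA; exact: set_valP.
exists (fun x => exist _ (F (set_val x)) (FA' x)) => //.
apply/continuousP => O [ O' oO' <-].
have /continuousP /(_ O' oO') := cF.
exact.
Qed.

Lemma iter_restrict (T : Type) (A : set T) (F : T -> T) (f : set_type A -> set_type A) n x :
  (forall x, set_val (f x) = F (set_val x)) -> set_val (iter n f x) = iter n F (set_val x).
Proof. by move=> h; elim: n => //= n IH; rewrite h IH. Qed.

Variable R : realType.
Local Notation V := (R * R)%type.

(** Conjugates a self-map of [T] to one of [K], by a choice of preimages. *)
Lemma embedding_FPP (T : topologicalType) (e : T -> V) (K : set V) : embedding e ->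
  range e = K -> compact K -> connected K -> K !=set0 -> ulc K -> nonseparating K ->
  FPP T.
Proof.
move=> [ie ope] eK cK K_conn K0 ulcK nsK f cf.
have /choice[g hg] : forall z, exists t, K z -> e t = z.
  have [z0 Kz0] := K0; have [t0 _ _] : range e z0 by rewrite eK.
  move=> z; have [|] := pselect (K z); last by exists t0.
  by rewrite -{1}eK => -[t _ <-]; exists t.
have ge t : g (e t) = t by apply: ie; apply: hg; rewrite -eK; exists t.
have Ke t : K (e t) by rewrite -eK; exists t.
have [||z Kz Fz] := @plane_fixed_point R K (fun z => e (f (g z))) cK K_conn K0 ulcK nsK.
- apply/subspace_continuousP => z Kz O /=.
  rewrite nbhsE => -[ O1 [oO1 O1z] O1O].
  have oO2 : open (f @^-1` (e @^-1` O1)).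
    have /continuousP := cf; apply.
    by apply/ope; exists O1.
  have [ O3 oO3 e3] := proj1 (ope _) oO2.
  have O3z : O3 z.
    have : (e @^-1` O3) (g z) by rewrite e3.
    by rewrite /preimage /= hg.
  have nO3 : nbhs z O3 by apply: open_nbhs_nbhs.
  rewrite /within /=; apply: filterS nO3 => w O3w Kw; apply: O1O.
  have : (e @^-1` O3) (g w) by rewrite /preimage /= hg.
  by rewrite e3.
- by [].
by exists (g z); apply: ie; rewrite Fz hg.
Qed.

Lemma FPP_PPP (T : topologicalType) : FPP T -> PPP T.
Proof. by move=> h f cf; have [x fx] := h f cf; exists x; exists 1%N. Qed.

Lemma LFPP_wLFPP (T : topologicalType) : LFPP T -> wLFPP T.
Proof.
move=> [B bB hB]; exists B => // U f BU cf fU.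
have fcl x : closure U x -> closure U (f x).
  by move=> cx; apply: subset_closure; apply: fU; exists x.
have [h ch hE] := restrict_map (continuous_within (fun x _ => cf x)) fcl.
have [x hx] := hB U BU h ch; exists (set_val x); last by rewrite -hE hx.
by rewrite -hx hE; apply: fU; exists (set_val x) => //; exact: set_valP.
Qed.

Lemma LPPP_wLPPP (T : topologicalType) : LPPP T -> wLPPP T.
Proof.
move=> [B bB hB]; exists B => // U f BU cf fU.
have fcl x : closure U x -> closure U (f x).
  by move=> cx; apply: subset_closure; apply: fU; exists x.
have [h ch hE] := restrict_map (continuous_within (fun x _ => cf x)) fcl.
have [x [n n1 hx]] := hB U BU h ch.
have fx : iter n f (set_val x) = set_val x by rewrite -(iter_restrict n x hE) hx.
exists (set_val x); last by exists n.
rewrite -fx; case: n n1 {hx fx} => // n _; rewrite iterS; apply: fU.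
by exists (iter n f (set_val x)) => //; rewrite -(iter_restrict n x hE); exact: set_valP.
Qed.

Lemma wLFPP_wLPPP (T : topologicalType) : wLFPP T -> wLPPP T.
Proof.
move=> [B bB hB]; exists B => // U f BU cf fU.
by have [x Ux fx] := hB U f BU cf fU; exists x => //; exists 1%N.
Qed.

Lemma LFPP_LPPP (T : topologicalType) : LFPP T -> LPPP T.
Proof. by move=> [B bB hB]; exists B => // U /hB /FPP_PPP. Qed.

Lemma free_self_map (X K : set V) (p : V) : K `<=` X -> compact K -> connected K ->
  ulc K -> ~ X p -> ~ (exists th, angle_lift K (fun x => x - p) th) ->
  exists f : set_type X -> set_type X, [/\ continuous f, forall x, K (set_val (f x)) &
    forall x, ~ periodic_point f x].
Proof.
move=> KX cK K_conn ulcK nXp nolift.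
have nKp : ~ K p by move=> /KX.
have [g [th [cg cth hg sg th01]]] := simple_essential_loop cK K_conn ulcK nKp nolift.
have hth t : itv01 t -> is_angle (g t - p) (th t) by case/hg.
have [F [cF FS Fper]] := free_map cg cth sg hth th01.
have Xp x : X x -> x != p by move=> Xx; apply/eqP => xp; apply: nXp; rewrite -xp.
have FK x : K (F x) by have [t It ->] := FS x; case: (hg t It).
have [f cf fE] := @restrict_map _ X F (continuous_within (fun x Xx => cF x (Xp x Xx)))
  (fun x _ => KX _ (FK x)).
exists f; split => //; first by move=> x; rewrite fE.
move=> x [n n1 fx]; apply: (Fper (set_val x) n _ n1); first exact/Xp/set_valP.
by rewrite -(iter_restrict n x fE) fx.
Qed.

Section Continuum.
Variable X : set V.
Hypothesis X_compact : compact X.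
Hypothesis X_connected : connected X.
Hypothesis X_nonempty : X !=set0.
Hypothesis X_cik : cik X.

Let X_ulc : ulc X. Proof. exact: cik_ulc. Qed.

(** A point off [X] from which [X] has no continuous angle would give a map of
    [X] without periodic points. *)
Lemma PPP_FPP : PPP (set_type X) -> FPP (set_type X).
Proof.
move=> hP; apply: (embedding_FPP (@embedding_val _ X) _ X_compact) => //.
  by apply/seteqP; split=> [_ [x _ <-]|x Xx]; [exact: set_valP|exists (exist _ x (mem_set Xx))].
move=> p nXp; apply: contrapT => nolift.
have [f [cf _ fP]] := free_self_map (@subset_refl _ X) X_compact X_connected X_ulc nXp nolift.
by have [x] := hP f cf; exact: fP.
Qed.

(** A basis for the local fixed point property is given by all open sets whose
    closure has the fixed point property; around [x], one is the union [U']
    of a small open set and of the holes of its closure, taken within a set [U]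
    of the given basis; its closure is the filled continuum [F]. *)
Lemma wLPPP_LFPP : wLPPP (set_type X) -> LFPP (set_type X).
Proof.
move=> [B [bB nB] hB].
exists [set U | [/\ open U, U !=set0 & FPP (set_type (closure U))]]; last by move=> U [].
split; last by move=> U [].
split; first by move=> U [].
move=> x N Nx; have [U [BU Ux] UN] := proj2 bB x N Nx.
have [ O oO OU] : open U by exact: (proj1 bB).
have Ox : O (set_val x) by rewrite -OU in Ux.
have [e e0 he] := near_distP (open_nbhs_nbhs (conj oO Ox)).
have e2 : 0 < e / 2 by rewrite divr_gt0.
have [W [[Wx WX] W_open W_conn W_dist W_cik]] :=
  small_continuum X_compact X_ulc (set_valP x) e2.
have X_closed : closed X by apply: compact_closed => //; exact: norm_hausdorff.
pose K := closure W; pose F := fill K.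
have KX : K `<=` X by move=> z /(closureS WX); rewrite -(closure_id _).1.
have K_compact : compact K by apply: subclosed_compact KX => //; exact: closed_closure.
have K_conn : connected K by exact: connected_closure.
have K_dist z : K z -> `|set_val x - z| <= e / 2 by apply: closure_dist.
have K_ulc : ulc K by exact: cik_ulc.
have F_dist z : F z -> `|set_val x - z| <= e / 2 by exact: fill_bounded.
have F_U z (Xz : X z) : F z -> U (exist _ z (mem_set Xz)).
  by move=> /F_dist h; rewrite -OU; apply: he => /=; rewrite (le_lt_trans h)//; lra.
(* A map into [K], which lies in [U], sends the closure of [U] into [U]. *)
have FX : F `<=` X.
  move=> p Fp; apply: contrapT => nXp.
  have nolift : ~ exists th, angle_lift K (fun x => x - p) th.
    by move=> lp; apply: Fp; split => // /KX.
  have [f [cf fK fP]] := free_self_map KX K_compact K_conn K_ulc nXp nolift.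
  have [|y _] := hB U f BU cf; last exact: fP.
  move=> _ [y _ <-]; have := F_U _ (KX _ (fK y)) (fill_sub (fK y)).
  by congr U; exact: val_inj.
(* [W] is open in [X] and the holes are open in the plane; the closure adds what
   [K] has beyond [W]. *)
pose U' : set (set_type X) := [set y | W (set_val y) \/ (F `\` K) (set_val y)].
have U'x : U' x by left.
have oU' : open U'.
  rewrite openE => y [Wy|Hy]; last first.
    have h : open (@set_val _ X @^-1` (F `\` K)) by exists (F `\` K) => //; exact: hole_open.
    by apply: filterS (open_nbhs_nbhs (conj h Hy)) => z; right.
  have [d d0 hd] := W_open _ Wy.
  have h : open (@set_val _ X @^-1` ball (set_val y) d).
    by exists (ball (set_val y) d) => //; exact: ball_open.
  have hy : (@set_val _ X @^-1` ball (set_val y) d) y by exact: ballxx.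
  apply: filterS (open_nbhs_nbhs (conj h hy)) => z zb; left.
  by apply: hd; [exact: set_valP|move: zb; rewrite /preimage /= -ball_normE].
have clU' : closure U' = @set_val _ X @^-1` F.
  apply/seteqP; split.
    have clF : closed (@set_val _ X @^-1` F).
      by have /continuous_closedP := (@initial_continuous _ _ (@set_val _ X)); apply; exact: fill_closed.
    rewrite (closure_id (@set_val _ X @^-1` F)).1//; apply: closureS => y [Wy|[] //].
    by apply: fill_sub; exact: subset_closure.
  move=> y Fy; have [Ky|nKy] := pselect (K (set_val y)); last first.
    by apply: subset_closure; right.
  move=> M; rewrite nbhsE => -[M' [[ O' oO' <-] O'y] M'M].
  have [w [Ww O'w]] := Ky O' (open_nbhs_nbhs (conj oO' O'y)).
  have Xw := mem_set (WX _ Ww).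
  by exists (exist _ w Xw); split; [left|apply: M'M].
exists U'; last first.
  apply: subset_trans UN => y hy.
  have Fy : F (set_val y).
    by case: hy => [Wy|[] //]; apply: fill_sub; exact: subset_closure.
  have := F_U _ (set_valP y) Fy; congr U; exact: val_inj.
split => //; split => //; first by exists x.
apply: (embedding_FPP (embedding_comp (@embedding_val _ _) (@embedding_val _ X)) (K := F)).
- apply/seteqP; split.
    have clF z : closure U' z -> F (set_val z) by rewrite clU'.
    by move=> _ [y _ <-]; apply: clF; exact: set_valP.
  move=> z Fz; have cz : closure U' (exist _ z (mem_set (FX _ Fz))) by rewrite clU'.
  pose zz : set_type (closure U') := exist (fun y => y \in closure U') _ (mem_set cz).
  by exists zz.
- exact: fill_compact.
- by apply: fill_connected => //; exists (set_val x); exact: subset_closure.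
- by exists (set_val x); apply: fill_sub; exact: subset_closure.
- by apply: cik_ulc; [exact: fill_compact|exact: fill_cik].
- exact: fill_nonseparating.
Qed.

End Continuum.

Lemma locally_connected_cik (X : set V) : locally_connected (set_type X) -> cik X.
Proof.
move=> [B bB cB] x Xx e e0; pose x' : set_type X := exist _ x (mem_set Xx).
have nx : nbhs x' (@set_val _ X @^-1` ball x e).
  apply: open_nbhs_nbhs; split; last exact: ballxx.
  by exists (ball x e) => //; exact: ball_open.
have [U [BU Ux] Ue] := proj2 bB x' _ nx.
have [ O oO OU] : open U by exact: (proj1 bB).
have Ox : O x by rewrite -OU in Ux.
have [d d0 hd] := near_distP (open_nbhs_nbhs (conj oO Ox)).
exists d => // y Xy xy; exists (@set_val _ X @` U); split.
- apply: connected_continuous_connected; first exact: cB.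
  by apply: continuous_within => z _; exact: initial_continuous.
- by move=> _ [z _ <-]; exact: set_valP.
- by exists x'.
- exists (exist _ y (mem_set Xy)) => //; rewrite -OU; exact: hd.
- by move=> _ [z /Ue zb <-]; move: zb; rewrite /preimage /= -ball_normE.
Qed.

End Assembly.

Theorem theorem4 (R : realType) (X : set (R * R))
    (X_continuum : metric_continuum R (set_type X))
    (X_lc : locally_connected (set_type X)) :
  (FPP (set_type X) <-> PPP (set_type X)) /\
  [/\ wLFPP (set_type X) <-> LFPP (set_type X),
      wLFPP (set_type X) <-> wLPPP (set_type X) &
      wLFPP (set_type X) <-> LPPP (set_type X)].
Proof.
have [[x0 _] cX connX _] := X_continuum.
have c_val : {within [set: set_type X], continuous (@set_val _ X)}.
  by apply: continuous_within => z _; exact: initial_continuous.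
have rng : @set_val _ X @` [set: set_type X] = X.
  apply/seteqP; split=> [_ [x _ <-]|x Xx]; first exact: set_valP.
  by exists (exist _ x (mem_set Xx)).
have X_compact : compact X by rewrite -rng; exact: continuous_compact.
have X_conn : connected X by rewrite -rng; exact: connected_continuous_connected.
have X_ne : X !=set0 by exists (set_val x0); exact: set_valP.
have X_cik := locally_connected_cik X_lc.
have weak := @wLPPP_LFPP R X X_compact X_cik.
split; first by split; [exact: FPP_PPP|exact: PPP_FPP].
split; split.
- by move=> /wLFPP_wLPPP /weak.
- exact: LFPP_wLFPP.
- exact: wLFPP_wLPPP.
- by move=> /weak /LFPP_wLFPP.
- by move=> /wLFPP_wLPPP /weak /LFPP_LPPP.
- by move=> /LPPP_wLPPP /weak /LFPP_wLFPP.
Qed.
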